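(* Let $T$ be a complete continuous first order theory in a countable language, having non compact models, and let $\mathfrak p$ be a weakly open perturbation system for $T$. Then $T$ is $\mathfrak p$-$\aleph_0$-categorical if and only if for every $n$, the topology induced by the metric $\tilde d_{\mathfrak p}$ coincides with the logic topology on $S_n(T)$.
   Context: We work in continuous first order logic; structures are bounded complete metric structures with metric $d$. $S_n(T)$ is the compact Hausdorff space of complete $n$-types of $T$ with the logic topology. Perturbation pre-radii. A perturbation pre-radius $\rho$ for $T$ is a family of closed sets $\rho_n \subseteq S_n(T)^2$ ($n\in\mathbb N$), each containing the diagonal. For $X \subseteq S_n(T)$, $X^\rho = \{q : (\exists p \in X)\,(p,q) \in \rho_n\}$, and $p^\rho=\{p\}^\rho$. For $M,N \models T$, a $\rho$-perturbation from $M$ into $N$ is a map $f\colon M \to N$ such that $\mathrm{tp}^N(f(\bar a)) \in \mathrm{tp}^M(\bar a)^\rho$ for every finite tuple $\bar a\in M$; $\mathrm{Pert}_\rho(M,N)$ is the set of these. $\mathrm{BiPert}_\rho(M,N)$ is the set of bijective $f\in\mathrm{Pert}_\rho(M,N)$ with $f^{-1}\in\mathrm{Pert}_\rho(N,M)$. A perturbation radius is a pre-radius $\rho$ such that for every $n$ and $(p,q)\in\rho_n$ there are $M,N\models T$ and a $\rho$-perturbation $f\colon M\to N$ sending some realisation of $p$ to a realisation of $q$. $\rho$ is symmetric if each $\rho_n$ is a symmetric relation. $\rho\le\rho'$ means $\rho_n\subseteq\rho'_n$ for all $n$. Composition: $(\rho'\circ\rho)_n=\{(p,q):\exists r\,(p,r)\in\rho_n,\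 (r,q)\in\rho'_n\}$. $\mathrm{id}$ is the pre-radius consisting of the diagonals. A perturbation system $\mathfrak p$ for $T$ assigns to each real $\varepsilon\ge0$ a perturbation radius $\mathfrak p(\varepsilon)$ such that: if $\varepsilon_k\searrow\varepsilon$ then $\mathfrak p(\varepsilon)=\bigcap_k\mathfrak p(\varepsilon_k)$; each $\mathfrak p(\varepsilon)$ is symmetric; $\mathfrak p(\varepsilon)\circ\mathfrak p(\varepsilon')\le\mathfrak p(\varepsilon+\varepsilon')$; $\mathfrak p(0)=\mathrm{id}$. Two models $M,N$ of $T$ are $\mathfrak p$-isomorphic if $\mathrm{BiPert}_{\mathfrak p(\varepsilon)}(M,N)\neq\emptyset$ for every $\varepsilon>0$. $T$ is $\mathfrak p$-$\aleph_0$-categorical if it has a model of density character $\aleph_0$ and any two models of $T$ of density character $\aleph_0$ are $\mathfrak p$-isomorphic. The ($[0,\infty]$-valued) metric $\tilde d_{\mathfrak p}$ on $S_n(T)$: $\tilde d_{\mathfrak p}(p,q)$ is the infimum of all $\varepsilon$ for which there exist $M,N\models T$, $\bar a\in M^n$, $\bar b\in N^n$ and $f\in\mathrm{BiPert}_{\mathfrak p(\varepsilon)}(M,N)$ such that $\bar a\models p$, $\bar b\models q$, and $|d^M(c,a_i)-d^N(f(c),b_i)|\le\varepsilon$ for all $i<n$ and $c\in M$. For $U\subseteq S_n(T)$ and $\delta>0$, $U^{\tilde d_{\mathfrak p}<\delta}=\{p:\tilde d_{\mathfrak p}(p,U)<\delta\}$. The system $\mathfrak p$ is weakly open if for all $\varepsilon>0$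 and $n\in\mathbb N$ there is $\delta>0$ such that for every (logic-)open set $U\subseteq S_n(T)$: $U^{\tilde d_{\mathfrak p}<\delta}\subseteq\bigl(U^{\tilde d_{\mathfrak p}<\varepsilon}\bigr)^\circ$, where $^\circ$ is the interior in the logic topology. *)

(* Defs.v *)
From HB Require Import structures.
From mathcomp Require Import all_boot all_order all_algebra.
From mathcomp Require Import all_classical all_reals all_analysis.

Set Implicit Arguments.
Unset Strict Implicit.
Unset Printing Implicit Defensive.

Import Order.TTheory GRing.Theory Num.Theory.
Import numFieldNormedType.Exports.

Local Open Scope classical_set_scope.
Local Open Scope ring_scope.

(** * Continuous first order logic *)

(* A (single-sorted) metric signature: every symbol carries its arity and its
   modulus of uniform continuity, every predicate symbol the compact interval
   of its values, and [diam_bound] bounds the diameter of the structures. *)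
Record language (R : realType) := Language {
  fun_sym : Type;
  pred_sym : Type;
  fun_arity : fun_sym -> nat;
  pred_arity : pred_sym -> nat;
  fun_mod : fun_sym -> R -> R;
  pred_mod : pred_sym -> R -> R;
  pred_lo : pred_sym -> R;
  pred_hi : pred_sym -> R;
  diam_bound : R;
  fun_mod_gt0 : forall f e, 0 < e -> 0 < fun_mod f e;
  pred_mod_gt0 : forall P e, 0 < e -> 0 < pred_mod P e
}.

Definition countable_language (R : realType) (L : language R) :=
  countable [set: fun_sym L] /\ countable [set: pred_sym L].

(* [carrier] is not declared pointed, so nonemptiness is [inhab] and
   convergence in [carrier_complete] cannot be written [cvg F]. *)
Record structure (R : realType) (L : language R) := Structure {
  carrier :> metricType R;
  inhab : inhabited carrier;
  carrier_complete : forall F : set_system carrier,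
    ProperFilter F -> cauchy F -> exists x : carrier, F --> x;
  carrier_diam : forall x y : carrier, mdist x y <= diam_bound L;
  fun_int : forall f : fun_sym L, ('I_(fun_arity f) -> carrier) -> carrier;
  pred_int : forall P : pred_sym L, ('I_(pred_arity P) -> carrier) -> R;
  fun_int_mod : forall (f : fun_sym L) (e : R)
      (x y : 'I_(fun_arity f) -> carrier),
    0 < e -> (forall i, mdist (x i) (y i) < fun_mod f e) ->
    mdist (fun_int x) (fun_int y) <= e;
  pred_int_mod : forall (P : pred_sym L) (e : R)
      (x y : 'I_(pred_arity P) -> carrier),
    0 < e -> (forall i, mdist (x i) (y i) < pred_mod P e) ->
    `|pred_int x - pred_int y| <= e;
  pred_int_itv : forall (P : pred_sym L) (x : 'I_(pred_arity P) -> carrier),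
    pred_lo P <= pred_int x <= pred_hi P
}.

Section Syntax.
Context {R : realType} (L : language R).

(* Terms and formulas whose free variables are indexed by ['I_n]. *)
Inductive term (n : nat) : Type :=
| Var of 'I_n
| App (f : fun_sym L) of ('I_(fun_arity f) -> term n).

(* All continuous functions are connectives.  The variable bound by a
   quantifier over [formula n.+1] is the one of index [ord0]. *)
Inductive formula : nat -> Type :=
| FDist n of term n & term n : formula n
| FPred n (P : pred_sym L) of ('I_(pred_arity P) -> term n) : formula n
| FConn n k (u : 'rV[R]_k -> R) of continuous u & ('I_k -> formula n) :
    formula n
| FSup n of formula n.+1 : formula n
| FInf n of formula n.+1 : formula n.

(* A sentence [s] of a theory stands for the closed condition [s = 0]. *)
Definition theory := set (formula 0).

End Syntax.

Arguments Var {R L n} _.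
Arguments App {R L n} f _.
Arguments FPred {R L n} P _.
Arguments FConn {R L n k} u _ _.

Section Semantics.
Context {R : realType} {L : language R} (M : structure L).

Fixpoint teval n (t : term L n) (a : 'I_n -> M) : M :=
  match t with
  | Var i => a i
  | App f ts => fun_int (fun i => teval (ts i) a)
  end.

Definition scons n (x : M) (a : 'I_n -> M) : 'I_n.+1 -> M :=
  fun i => oapp a x (unlift ord0 i).

Fixpoint feval n (s : formula L n) : ('I_n -> M) -> R :=
  match s in formula _ n return ('I_n -> M) -> R with
  | FDist n t1 t2 => fun a => mdist (teval t1 a) (teval t2 a)
  | FPred n P ts => fun a => pred_int (fun i => teval (ts i) a)
  | FConn n k u _ ss => fun a => u (\row_i feval (ss i) a)
  | FSup n s => fun a => sup [set feval s (scons x a) | x in [set: M]]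
  | FInf n s => fun a => inf [set feval s (scons x a) | x in [set: M]]
  end.

(* There is exactly one assignment ['I_0 -> M]. *)
Definition satisfies (T : theory L) :=
  forall s, T s -> forall a : 'I_0 -> M, feval s a = 0.

(* Density character exactly [aleph_0]. *)
Definition density_aleph0 :=
  (exists D : set M, dense D /\ (D #= [set: nat])%card) /\
  (forall D : set M, dense D -> ~ finite_set D).

End Semantics.

Section Types.
Context {R : realType} {L : language R}.

Record model (T : theory L) := Model {
  str_of :> structure L;
  model_sat : satisfies str_of T
}.

(* Satisfiable, and any two models are elementarily equivalent. *)
Definition complete_theory (T : theory L) :=
  inhabited (model T) /\
  forall (M N : model T) (s : formula L 0) (a : 'I_0 -> M) (b : 'I_0 -> N),
    feval s a = feval s b.

(* A complete type is represented by the values it gives to formulas, i.e. by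
   the conditions [s = r] which it contains. *)
Definition is_type (T : theory L) n :
    set (prod_topology (fun _ : formula L n => R)) :=
  [set p | exists (M : model T) (a : 'I_n -> M), p = fun s => feval s a].

(* [S_n(T)]. The logic topology, for which the sets [s < r] form a basis, is
   the one inherited from the product topology. *)
Definition type_space (T : theory L) n := set_type (@is_type T n).

HB.instance Definition _ (T : theory L) n := Topological.on (type_space T n).

Lemma is_type_feval (T : theory L) n (M : model T) (a : 'I_n -> M) :
  (fun s => feval s a) \in @is_type T n.
Proof. by apply/mem_set; exists M, a. Qed.

Definition tp (T : theory L) n (M : model T) (a : 'I_n -> M) : type_space T n :=
  exist _ (fun s : formula L n => feval s a) (is_type_feval a).

End Types.

(** * Perturbations *)

Section Perturbations.
Context {R : realType} {L : language R} {T : theory L}.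

Definition type_rel := forall n, set (type_space T n * type_space T n).

Definition pre_radius (rho : type_rel) :=
  forall n, closed (rho n) /\ (forall p, rho n (p, p)).

Definition type_nbhd (rho : type_rel) n (X : set (type_space T n)) :
    set (type_space T n) :=
  [set q | exists2 p, X p & rho n (p, q)].

Definition pert (rho : type_rel) (M N : model T) : set (M -> N) :=
  [set f : M -> N | forall n (a : 'I_n -> M),
    type_nbhd rho [set tp a] (tp (f \o a))].

Definition bipert (rho : type_rel) (M N : model T) : set (M -> N) :=
  [set f : M -> N | pert rho f /\
    exists2 g : N -> M, cancel f g /\ cancel g f & pert rho g].

Definition pert_radius (rho : type_rel) :=
  pre_radius rho /\
  forall n p q, rho n (p, q) ->
    exists (M N : model T) (f : M -> N) (a : 'I_n -> M),
      [/\ pert rho f, tp a = p & tp (f \o a) = q].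

Definition symmetric_radius (rho : type_rel) :=
  forall n p q, rho n (p, q) -> rho n (q, p).

Definition radius_le (rho rho' : type_rel) := forall n, rho n `<=` rho' n.

(* [radius_comp rho' rho] applies [rho] first. *)
Definition radius_comp (rho' rho : type_rel) : type_rel :=
  fun n => [set pq | exists r, rho n (pq.1, r) /\ rho' n (r, pq.2)].

Definition radius_id : type_rel := fun n => [set pq | pq.1 = pq.2].

End Perturbations.

Arguments type_rel {R L} T.

(* Values of [psys] at negative reals are irrelevant. *)
Record perturbation_system (R : realType) (L : language R) (T : theory L) :=
PerturbationSystem {
  psys :> R -> type_rel T;
  psys_radius : forall e : R, 0 <= e -> pert_radius (psys e);
  psys_cap : forall (u : nat -> R) (e : R), 0 <= e ->
    {homo u : m n / (m <= n)%N >-> n <= m} -> u @ \oo --> e ->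
    forall n, @psys e n = \bigcap_k @psys (u k) n;
  psys_sym : forall e : R, 0 <= e -> symmetric_radius (psys e);
  psys_comp : forall e e' : R, 0 <= e -> 0 <= e' ->
    radius_le (radius_comp (psys e) (psys e')) (psys (e + e'));
  psys0 : psys 0 = radius_id
}.

Arguments psys {R L T} p e n.

Section Systems.
Context {R : realType} {L : language R} {T : theory L}.
Variable p : perturbation_system T.

Definition pert_isomorphic (M N : model T) :=
  forall e : R, 0 < e -> bipert (p e) (M := M) (N := N) !=set0.

Definition pert_aleph0_categorical :=
  (exists M : model T, density_aleph0 M) /\
  (forall M N : model T,
    density_aleph0 M -> density_aleph0 N -> pert_isomorphic M N).

(* The extended metric [d~_p]; it is [+oo] when no [e] is admissible. *)
Definition dtilde n (s t : type_space T n) : \bar R :=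
  ereal_inf [set e%:E | e in [set e : R | 0 <= e /\
    exists (M N : model T) (a : 'I_n -> M) (b : 'I_n -> N) (f : M -> N),
      [/\ bipert (p e) f, tp a = s, tp b = t &
          forall i (c : M), `|mdist c (a i) - mdist (f c) (b i)| <= e]]].

Definition dtilde_set n (s : type_space T n) (U : set (type_space T n)) :
    \bar R :=
  ereal_inf [set dtilde s t | t in U].

Definition dtilde_nbhd n (U : set (type_space T n)) (r : R) :
    set (type_space T n) :=
  [set s | (dtilde_set s U < r%:E)%E].

Definition weakly_open :=
  forall (e : R) (n : nat), 0 < e ->
    exists2 r : R, 0 < r &
      forall U : set (type_space T n), open U ->
        dtilde_nbhd U r `<=` (dtilde_nbhd U e)^°.

(* Open for the topology whose neighbourhood bases are the balls of [d~_p]. *)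
Definition dtilde_open n (U : set (type_space T n)) :=
  forall s, U s ->
    exists2 r : R, 0 < r & [set t | (dtilde s t < r%:E)%E] `<=` U.

End Systems.

(* Main.v *)
Require Import Defs.
From HB Require Import structures.
From mathcomp Require Import all_boot all_order all_algebra.
From mathcomp Require Import all_classical all_reals all_analysis.
From mathcomp Require Import lra.

Set Implicit Arguments.
Unset Strict Implicit.
Unset Printing Implicit Defensive.

Import Order.TTheory GRing.Theory Num.Theory.
Import numFieldNormedType.Exports.

Local Open Scope classical_set_scope.
Local Open Scope ring_scope.

(** Why the theorem holds.

  The distance [dtilde p] is defined through perturbations between models that
  are left unspecified, and nothing about it can be seen directly: not even the
  triangle inequality, which would require two perturbations with a common
  model in the middle. So it is first expressed by types alone. The types of
  [c ++ a] and of [f c ++ b], where [f] is a perturbation that moves [a] close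
  to [b] and [c] runs through the finite tuples, form a relation that can be
  extended by one element on either side ([carries_bis]); its closure has the
  same property, by compactness of the type spaces ([forth_closure]).
  Conversely such a relation yields two chains of types, built by back and
  forth so as to contain witnesses for a countable dense set of formulas. Each
  chain is the type of a dense sequence in a separable model, and the two dense
  sequences correspond to each other by a perturbation ([bis_carries]). Thus
  [dtilde p s t < r] says that [s] and [t] are related by the largest relation
  [bis p e] of this kind for some [e < r] ([dtilde_ltP]). Now [bis p e] is
  closed, symmetric, and composes ([bis_closed], [bis_sym], [bis_trans]).

  All models are obtained in one way ([henkin_model]): if the values of the
  formulas at a family of points in given models converge, and the limits of
  suprema are witnessed in the family, then the completion of the family for
  the limit distance is a model in which the formulas take the limit values.
  Compactness of the type spaces ([type_space_compact]), separable models and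
  the omitting types theorem ([omitting_types]) are instances.

  A logic open set is always open for [dtilde p], since types at small distance
  give close values to a given formula ([bis_val]). For a categorical theory
  the converse amounts to the fact that the ball around a type [s] is a logic
  neighbourhood of [s]. All models are infinite ([model_infinite]), so that the
  separable ones are those to which categoricity applies. If the closed set of
  the types at distance at most [e] from [s] had empty interior, there would be
  a separable model in which the tuples whose type avoids it are dense; but a
  perturbation from a separable model that realizes [s] onto that model brings
  a realization of [s] into an open set of tuples that realize types close to
  [s] ([categorical_ball_interior]). So the ball has an interior point, and
  weak openness moves this interior point to [s] ([categorical_open]).

  If the two topologies agree, two separable models [M] and [N] are compared by
  back and forth. The state is a pair of tuples of [M] and [N] and a pair of
  types, exactly related by a perturbation radius, which are [dtilde p]-close to
  the types of these tuples ([paired]). A ball of [dtilde p] is open, hence it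
  is met by the tuples of a model that are close to a given one
  ([bis_transfer]); so one can add an element and make the closeness as good as
  desired, at the price of moving the elements found so far by the former
  closeness ([paired_step]). These moves are summable, and the limits are two
  dense sequences whose types are related as required
  ([metrized_isomorphic]). *)

(** * Connectives on a box *)

Section Connectives.
Context {R : realType}.

Lemma cvg_lim_le I (F : set_system I) (FF : ProperFilter F) (f g : I -> R)
    (a b : R) : f @ F --> a -> g @ F --> b -> (forall i, f i <= g i) -> a <= b.
Proof.
move=> fa gb fg; rewrite -subr_ge0; apply: (cvgr_to_ge (cvgB gb fa)).
by apply: nearW => i; rewrite /= subr_ge0.
Qed.

Lemma common_radius k (d : 'I_k -> R) : (forall i, 0 < d i) ->
  exists2 m : R, 0 < m & forall i, m <= d i.
Proof.
move=> d0; exists (\big[Num.min/1]_(i < k) d i); first exact: lt_bigmin.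
by move=> i; apply: bigmin_le.
Qed.

Definition box k (B : R) : set 'rV[R]_k := [set v | forall i, `|v ord0 i| <= B].

Lemma box_compact k B : compact (@box k B).
Proof.
have -> : @box k B = [set v | forall i : 'I_k, `[- B, B]%classic (v ord0 i)].
  by apply/seteqP; split=> v h i; have := h i; rewrite /= in_itv /= ler_norml.
by apply: (@rV_compact _ _ (fun=> `[- B, B]%classic)) => i; apply: segment_compact.
Qed.

(** The sup norm version in which the continuity of all the connectives
  introduced below is checked. *)
Lemma lipschitz_connective k (u : 'rV[R]_k -> R) (C : R) : 0 < C ->
  (forall (v w : 'rV[R]_k) (d : R), 0 <= d -> (forall i, `|v ord0 i - w ord0 i| <= d) ->
    `|u v - u w| <= C * d) -> continuous u.
Proof.
move=> C0 h v A /nbhs_ballP [e /= e0 eA]; apply/nbhs_ballP.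
have d0 : 0 < e / 2 / C by rewrite !divr_gt0.
exists (e / 2 / C) => //= w [_ vw]; apply: eA; rewrite /ball /=.
have eE : C * (e / 2 / C) = e / 2.
  by rewrite mulrC divfK// gt_eqF.
apply: (@le_lt_trans _ _ (C * (e / 2 / C))); last by rewrite eE; lra.
by apply: h => [|i]; [exact: ltW|have := vw ord0 i; rewrite /ball /= => /ltW].
Qed.

Variables (k : nat) (u : 'rV[R]_k -> R).
Hypothesis u_cont : continuous u.

Lemma box_bounded (B : R) : exists C, forall v, box B v -> `|u v| <= C.
Proof.
have /compact_bounded [C [_ hC]] : compact (u @` @box k B).
  apply: continuous_compact (@box_compact k B).
  exact: continuous_subspaceT.
exists (C + 1) => v hv; apply: hC; first by rewrite ltrDl.
by exists v.
Qed.

(** A connective is only applied to the values of formulas, which are bounded;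
  on a box, continuity is uniform by compactness. *)
Lemma box_unif_continuous (B e : R) : 0 < e -> exists2 d : R, 0 < d &
  forall v w, box B v -> box B w ->
    (forall i, `|v ord0 i - w ord0 i| < d) -> `|u v - u w| < e.
Proof.
move=> e0.
have /compact_near_coveringP := @box_compact k B.
move=> /(_ _ (0^'+) (fun d v => forall w : 'rV[R]_k,
    (forall i, `|v ord0 i - w ord0 i| < d) -> `|u v - u w| < e)).
case.
- move=> v _; have /cvgrPdist_lt /(_ (e / 2)) := @u_cont v.
  rewrite divr_gt0// => /(_ isT) /nbhs_ballP [d /= d0 hd].
  exists (ball v (d / 2), [set r | 0 < r < d / 2]); first split=> /=.
  + by apply: nbhsx_ballx; rewrite divr_gt0.
  + near=> r; apply/andP; split; first by [].
    by near: r; apply: nbhs_right_lt; rewrite divr_gt0.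
  + move=> [w r] /= [vw /andP[r0 rd]] z wz.
    have h1 : `|u v - u w| < e / 2.
      by apply: hd; apply: le_ball vw; rewrite ler_pdivrMr// ler_pMr// ler1n.
    have h2 : `|u v - u z| < e / 2.
      apply: hd; rewrite (splitr d); apply: ball_triangle vw _.
      split; first by rewrite divr_gt0.
      by move=> i j; rewrite /ball /= ord1; apply: lt_trans rd.
    rewrite (splitr e) -[u w](subrK (u v)) -addrA.
    by rewrite (le_lt_trans (ler_normD _ _))// ltrD// distrC.
- move=> d /= d0 hd; exists (d / 2); first by rewrite divr_gt0.
  move=> v w bv bw vw.
  apply: (hd (d / 2)) => //=; last by rewrite divr_gt0.
  by rewrite sub0r normrN gtr0_norm ?divr_gt0// ltr_pdivrMr// ltr_pMr// ltr1n.
Unshelve. all: by end_near.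
Qed.

End Connectives.

(** * Semantics *)

Section Quantifiers.
Context {R : realType} {L : language R}.

Lemma teval_uc n (t : term L n) (e : R) : 0 < e ->
  exists2 d : R, 0 < d & forall (M : structure L) (a b : 'I_n -> M),
    (forall i, mdist (a i) (b i) < d) -> mdist (teval t a) (teval t b) < e.
Proof.
elim: t e => [i|f ts IH] e e0; first by exists e => // M a b; apply.
have e20 : 0 < e / 2 by rewrite divr_gt0.
have /choice [d hd] : forall i, exists d : R, 0 < d /\
    forall (M : structure L) (a b : 'I_n -> M),
    (forall i, mdist (a i) (b i) < d) ->
    mdist (teval (ts i) a) (teval (ts i) b) < fun_mod f (e / 2).
  move=> i; have [d d0 hd] := IH i _ (fun_mod_gt0 f e20).
  by exists d; split.
have [m m0 hm] := @common_radius _ _ d (fun i => (hd i).1).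
exists m => // M a b ab /=.
apply: (@le_lt_trans _ _ (e / 2)); last first.
  by rewrite ltr_pdivrMr// ltr_pMr// ltr1n.
apply: fun_int_mod => // i; apply: (hd i).2 => j.
exact: lt_le_trans (ab j) (hm i).
Qed.

Lemma mdist_dist (M : metricType R) (x y x' y' : M) :
  `|mdist x y - mdist x' y'| <= mdist x x' + mdist y y'.
Proof.
have h (a b c d : M) : mdist a b - mdist c d <= mdist a c + mdist b d.
  rewrite lerBlDr (le_trans (metric_triangle a c b))// -addrA lerD2l.
  by rewrite addrC (metric_sym b d) metric_triangle.
have := h x y x' y'; have := h x' y' x y.
rewrite (metric_sym x' x) (metric_sym y' y) ler_norml => h1 h2.
by apply/andP; split; lra.
Qed.

(** The bound depends on the formula and not on the structure, so limits of
  values along a family of models exist. *)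
Lemma feval_bounded n (s : formula L n) : exists B : R,
  forall (M : structure L) (a : 'I_n -> M), `|feval s a| <= B.
Proof.
elim: n / s => [n t1 t2|n P ts|n k u cu ss IH|n s [B hB]|n s [B hB]].
- exists (diam_bound L) => M a /=.
  by rewrite ger0_norm ?mdist_ge0// carrier_diam.
- exists (`|pred_lo P| + `|pred_hi P|) => M a /=.
  have /andP[h1 h2] := pred_int_itv (fun i => teval (ts i) a).
  rewrite ler_norml (le_trans h2) ?andbT; last first.
    by rewrite (le_trans (ler_norm _))// lerDr.
  rewrite (le_trans _ h1)// lerNl (le_trans (ler_norm _))// normrN.
  by rewrite lerDl.
- have /choice [B hB] := IH.
  have [C hC] := box_bounded cu (\big[Num.max/0]_i B i).
  exists C => M a; apply: hC => i; rewrite mxE.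
  apply: le_trans (hB i M a) _; exact: le_bigmax.
- exists B => M a /=; have [x0] := inhab M.
  have ub x : feval s (scons x a) <= B by apply: le_trans (hB M _); apply: ler_norm.
  have lb x : - B <= feval s (scons x a).
    by rewrite lerNl; apply: le_trans (hB M _); rewrite -normrN; apply: ler_norm.
  rewrite ler_norml; apply/andP; split.
    apply: le_trans (lb x0) _; apply: ub_le_sup; last by exists x0.
    by exists B => _ [x _ <-].
  by apply: ge_sup; [exists (feval s (scons x0 a)), x0|move=> _ [x _ <-]].
- exists B => M a /=; have [x0] := inhab M.
  have ub x : feval s (scons x a) <= B by apply: le_trans (hB M _); apply: ler_norm.
  have lb x : - B <= feval s (scons x a).
    by rewrite lerNl; apply: le_trans (hB M _); rewrite -normrN; apply: ler_norm.
  rewrite ler_norml; apply/andP; split.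
    by apply: lb_le_inf; [exists (feval s (scons x0 a)), x0|move=> _ [x _ <-]].
  apply: le_trans (ub x0); apply: ge_inf; last by exists x0.
  by exists (- B) => _ [x _ <-].
Qed.

Section Fixed.
Context {M : structure L} {n : nat} (s : formula L n.+1) (a : 'I_n -> M).

Lemma FSup_ge x : feval s (scons x a) <= feval (FSup s) a.
Proof.
apply: ub_le_sup; last by exists x.
have [B hB] := feval_bounded s; exists B => _ [y _ <-].
by apply: le_trans (hB M _); apply: ler_norm.
Qed.

Lemma FSup_le (r : R) : (forall x, feval s (scons x a) <= r) -> feval (FSup s) a <= r.
Proof.
move=> h; have [x0] := inhab M.
by apply: ge_sup; [exists (feval s (scons x0 a)), x0|move=> _ [x _ <-]].
Qed.

Lemma FSup_adherent (e : R) : 0 < e ->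
  exists x, feval (FSup s) a - e < feval s (scons x a).
Proof.
move=> e0; apply: contrapT => /forallNP h.
suff h2 : feval (FSup s) a <= feval (FSup s) a - e by lra.
by apply: FSup_le => x; rewrite leNgt; apply/negP.
Qed.

Lemma FInf_le x : feval (FInf s) a <= feval s (scons x a).
Proof.
apply: ge_inf; last by exists x.
have [B hB] := feval_bounded s; exists (- B) => _ [y _ <-].
by rewrite lerNl; apply: le_trans (hB M _); rewrite -normrN; apply: ler_norm.
Qed.

Lemma FInf_ge (r : R) : (forall x, r <= feval s (scons x a)) -> r <= feval (FInf s) a.
Proof.
move=> h; have [x0] := inhab M.
by apply: lb_le_inf; [exists (feval s (scons x0 a)), x0|move=> _ [x _ <-]].
Qed.

End Fixed.

Lemma scons_lt (M : structure L) n x y (a b : 'I_n -> M) (d : R) :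
  mdist x y < d -> (forall i, mdist (a i) (b i) < d) ->
  forall i, mdist (scons x a i) (scons y b i) < d.
Proof. by move=> xy ab i; rewrite /scons; case: (unlift _ _) => [j|] /=. Qed.

(** It suffices that each element of one structure has a competitor in the
  other. With equal structures this compares two formulas or two tuples. *)
Lemma quantifier_dist n (s s' : formula L n.+1) (M N : structure L)
    (a : 'I_n -> M) (b : 'I_n -> N) (e : R) :
  (forall x, exists y, feval s (scons x a) <= feval s' (scons y b) + e) ->
  (forall y, exists x, feval s' (scons y b) <= feval s (scons x a) + e) ->
  `|feval (FSup s) a - feval (FSup s') b| <= e.
Proof.
move=> h1 h2; suff : feval (FSup s) a <= feval (FSup s') b + e /\
    feval (FSup s') b <= feval (FSup s) a + e.
  by rewrite ler_norml => -[? ?]; apply/andP; split; lra.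
split; apply: FSup_le => x.
  by have [y /le_trans] := h1 x; apply; rewrite lerD2r FSup_ge.
by have [y /le_trans] := h2 x; apply; rewrite lerD2r FSup_ge.
Qed.

Lemma quantifier_distI n (s s' : formula L n.+1) (M N : structure L)
    (a : 'I_n -> M) (b : 'I_n -> N) (e : R) :
  (forall x, exists y, feval s' (scons y b) <= feval s (scons x a) + e) ->
  (forall y, exists x, feval s (scons x a) <= feval s' (scons y b) + e) ->
  `|feval (FInf s) a - feval (FInf s') b| <= e.
Proof.
move=> h1 h2; suff : feval (FInf s') b - e <= feval (FInf s) a /\
    feval (FInf s) a - e <= feval (FInf s') b.
  by rewrite ler_norml => -[? ?]; apply/andP; split; lra.
split; apply: FInf_ge => x; rewrite lerBlDr.
  by have [y hy] := h1 x; apply: le_trans hy; apply: FInf_le.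
by have [y hy] := h2 x; apply: le_trans hy; apply: FInf_le.
Qed.

(** The symbols come with their moduli and the connectives are uniformly
  continuous on the box of the values, so the modulus of a formula is common to
  all structures. *)
Lemma feval_uc n (s : formula L n) (e : R) : 0 < e ->
  exists2 d : R, 0 < d & forall (M : structure L) (a b : 'I_n -> M),
    (forall i, mdist (a i) (b i) < d) -> `|feval s a - feval s b| <= e.
Proof.
have dxx (M : structure L) (x : M) (d : R) : 0 < d -> mdist x x < d.
  by move=> d0; rewrite mdistxx.
elim: n / s e => [n t1 t2|n P ts|n k u cu ss IH|n s IH|n s IH] e e0.
- have e20 : 0 < e / 2 by rewrite divr_gt0.
  have [d1 d10 h1] := teval_uc t1 e20; have [d2 d20 h2] := teval_uc t2 e20.
  exists (Num.min d1 d2); first by rewrite lt_min d10.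
  move=> M a b ab /=; apply: le_trans (mdist_dist _ _ _ _) _.
  rewrite (splitr e) lerD// ltW//; [apply: h1|apply: h2] => i;
    by have := ab i; rewrite lt_min => /andP[].
- have /choice [d hd] : forall i, exists d : R, 0 < d /\
      forall (M : structure L) (a b : 'I_n -> M),
      (forall i, mdist (a i) (b i) < d) ->
      mdist (teval (ts i) a) (teval (ts i) b) < pred_mod P e.
    move=> i; have [d d0 hd] := teval_uc (ts i) (pred_mod_gt0 P e0).
    by exists d; split.
  have [m m0 hm] := @common_radius _ _ d (fun i => (hd i).1).
  exists m => // M a b ab /=.
  apply: pred_int_mod => // i; apply: (hd i).2 => j.
  exact: lt_le_trans (ab j) (hm i).
- have /choice [B hB] := fun i => feval_bounded (ss i).
  have [d d0 hd] := box_unif_continuous cu (\big[Num.max/0]_i B i) e0.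
  have d20 : 0 < d / 2 by rewrite divr_gt0.
  have /choice [c hc] : forall i, exists c : R, 0 < c /\
      forall (M : structure L) (a b : 'I_n -> M),
      (forall i, mdist (a i) (b i) < c) -> `|feval (ss i) a - feval (ss i) b| <= d / 2.
    by move=> i; have [c c0 hc] := IH i _ d20; exists c; split.
  have [m m0 hm] := @common_radius _ _ c (fun i => (hc i).1).
  exists m => // M a b ab /=; apply/ltW/hd => i; rewrite ?mxE.
  + by apply: le_trans (hB i M a) _; exact: le_bigmax.
  + by apply: le_trans (hB i M b) _; exact: le_bigmax.
  + apply: (@le_lt_trans _ _ (d / 2)); last by rewrite ltr_pdivrMr// ltr_pMr// ltr1n.
    by apply: (hc i).2 => j; apply: lt_le_trans (ab j) (hm i).
- have [d d0 hd] := IH e e0; exists d => // M a b ab.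
  have h x : `|feval s (scons x a) - feval s (scons x b)| <= e.
    by apply: hd; apply: scons_lt => //; apply: dxx.
  apply: quantifier_dist => x; exists x.
    by have := h x; rewrite ler_norml => /andP[? ?]; lra.
  by have := h x; rewrite ler_norml => /andP[? ?]; lra.
- have [d d0 hd] := IH e e0; exists d => // M a b ab.
  have h x : `|feval s (scons x a) - feval s (scons x b)| <= e.
    by apply: hd; apply: scons_lt => //; apply: dxx.
  apply: quantifier_distI => x; exists x.
    by have := h x; rewrite ler_norml => /andP[? ?]; lra.
  by have := h x; rewrite ler_norml => /andP[? ?]; lra.
Qed.

End Quantifiers.

(** * Substitution of variables *)

Section Vcons.

(** The operation [scons] on tuples of any kind, in particular on tuples of
  variables. *)
Definition vcons (A : Type) n (x : A) (a : 'I_n -> A) : 'I_n.+1 -> A :=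
  fun i => oapp a x (unlift ord0 i).

Context {A B : Type}.

Lemma vcons0 n (x : A) (a : 'I_n -> A) : vcons x a ord0 = x.
Proof. by rewrite /vcons unlift_none. Qed.

Lemma vconsS n (x : A) (a : 'I_n -> A) i : vcons x a (lift ord0 i) = a i.
Proof. by rewrite /vcons liftK. Qed.

Lemma vcons_lift n (x : A) (a : 'I_n -> A) : vcons x a \o lift ord0 = a.
Proof. by apply/funext => i; apply: vconsS. Qed.

Lemma vcons_eta n (a : 'I_n.+1 -> A) : vcons (a ord0) (a \o lift ord0) = a.
Proof. by apply/funext => i; rewrite /vcons; case: unliftP => [j|] ->. Qed.

Lemma comp_vcons n (f : A -> B) x (a : 'I_n -> A) :
  f \o vcons x a = vcons (f x) (f \o a).
Proof. by apply/funext => i; rewrite /vcons /=; case: (unlift _ _). Qed.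

End Vcons.

Section Rename.
Context {R : realType} {L : language R}.

Lemma sconsE (M : structure L) n (x : M) (a : 'I_n -> M) :
  scons x a = vcons x a.
Proof. by []. Qed.

Fixpoint trename n m (tau : 'I_n -> 'I_m) (t : term L n) : term L m :=
  match t with
  | Var i => Var (tau i)
  | App f ts => App f (fun i => trename tau (ts i))
  end.

Definition lift_map n m (tau : 'I_n -> 'I_m) : 'I_n.+1 -> 'I_m.+1 :=
  vcons ord0 (lift ord0 \o tau).

Fixpoint rename n (s : formula L n) : forall m, ('I_n -> 'I_m) -> formula L m :=
  match s in formula _ n return forall m, ('I_n -> 'I_m) -> formula L m with
  | FDist n t1 t2 => fun m tau => FDist (trename tau t1) (trename tau t2)
  | FPred n P ts => fun m tau => FPred P (fun i => trename tau (ts i))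
  | FConn n k u cu ss => fun m tau => FConn u cu (fun i => rename (ss i) tau)
  | FSup n s => fun m tau => FSup (rename s (lift_map tau))
  | FInf n s => fun m tau => FInf (rename s (lift_map tau))
  end.

Lemma teval_rename (M : structure L) n m (tau : 'I_n -> 'I_m) (t : term L n)
    (a : 'I_m -> M) : teval (trename tau t) a = teval t (a \o tau).
Proof.
by elim: t => //= f ts IH; congr fun_int; apply/funext => i; apply: IH.
Qed.

Lemma scons_lift_map (M : structure L) n m (tau : 'I_n -> 'I_m) (x : M)
  (a : 'I_m -> M) : scons x a \o lift_map tau = scons x (a \o tau).
Proof.
by rewrite sconsE /lift_map comp_vcons vcons0 compA vcons_lift.
Qed.

Lemma feval_rename (M : structure L) n (s : formula L n) m (tau : 'I_n -> 'I_m)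
  (a : 'I_m -> M) : feval (rename s tau) a = feval s (a \o tau).
Proof.
elim: n / s m tau a => [n t1 t2|n P ts|n k u cu ss IH|n s IH|n s IH] m tau a /=.
- by rewrite !teval_rename.
- by congr pred_int; apply/funext => i; rewrite teval_rename.
- by congr u; apply/rowP => i; rewrite !mxE IH.
- by congr sup; apply/seteqP; split=> _ [x _ <-]; exists x => //;
    rewrite IH scons_lift_map.
- by congr inf; apply/seteqP; split=> _ [x _ <-]; exists x => //;
    rewrite IH scons_lift_map.
Qed.

Lemma opp_coord_continuous : continuous (fun v : 'rV[R]_1 => - v ord0 ord0).
Proof.
have h := @coord_continuous R 1 1 ord0 ord0.
by move=> v; apply: (@cvgN R R^o _ _ _ _ _ (h v)).
Qed.

Definition FNeg n (s : formula L n) : formula L n :=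
  FConn _ opp_coord_continuous (fun=> s).

Lemma feval_FNeg (M : structure L) n (s : formula L n) (a : 'I_n -> M) :
  feval (FNeg s) a = - feval s a.
Proof. by rewrite /= mxE. Qed.

Lemma feval_FSup_FNeg (M : structure L) n (s : formula L n.+1) (a : 'I_n -> M) :
  feval (FSup (FNeg s)) a = - feval (FInf s) a.
Proof.
apply/eqP; rewrite eq_le; apply/andP; split.
  by apply: FSup_le => x; rewrite feval_FNeg lerN2; apply: FInf_le.
rewrite lerNl; apply: FInf_ge => x; rewrite lerNl -feval_FNeg.
exact: FSup_ge.
Qed.

End Rename.

(** * Completion of a pseudometric *)

Section DenseMap.
Context {R : realType} {V : Type} {X : metricType R}.

Definition dense_map (f : V -> X) :=
  forall x (e : R), 0 < e -> exists v, mdist x (f v) < e.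

Variable f : V -> X.

(** The filter of the tuples of indices whose images converge to [x]. *)
Definition near_pts n (x : 'I_n -> X) : set_system ('I_n -> V) :=
  filter_from [set e : R | 0 < e]
    (fun e => [set v | forall i, mdist (x i) (f (v i)) < e]).

Lemma near_pts_filter n (x : 'I_n -> X) : dense_map f ->
  ProperFilter (near_pts x).
Proof.
move=> fd; apply: filter_from_proper; last first.
  by move=> e e0; have /choice [v hv] := fun i => fd (x i) e e0; exists v.
apply: filter_from_filter; first by exists 1 => /=.
move=> e e' e0 e'0; exists (Num.min e e'); first by rewrite /= lt_min e0.
by move=> v hv; split=> i; have := hv i; rewrite lt_min => /andP[].
Qed.

Lemma near_ptsP n (x : 'I_n -> X) (e : R) : 0 < e ->
  near_pts x [set v | forall i, mdist (x i) (f (v i)) < e].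
Proof. by move=> e0; exists e. Qed.

End DenseMap.

Section Completion.
Context {R : realType} {V : Type}.

Record pseudometric := PseudoMetric {
  pdist :> V -> V -> R;
  pdist0 : forall v, pdist v v = 0;
  pdistC : forall v w, pdist v w = pdist w v;
  pdist_triangle : forall v u w, pdist v w <= pdist v u + pdist u w
}.

Variable D : pseudometric.

(** A point [x] of the completion is encoded by the function [w |-> d(x, w)] on
  [V]; these functions are the uniform limits of the functions [D v]. *)
Definition approximable (g : V -> R) :=
  forall e : R, 0 < e -> exists v, forall w, `|g w - D v w| <= e.

Definition completion := {g : V -> R | `[< approximable g >]}.

HB.instance Definition _ := gen_eqMixin completion.
HB.instance Definition _ := gen_choiceMixin completion.

Implicit Types g h : completion.

Lemma completionP g : approximable (sval g).
Proof. by apply/asboolP; case: g. Qed.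

Lemma completion_inj g h : sval g =1 sval h -> g = h.
Proof. case: g h => g pg [h ph] /= /funext gh; subst h.
by rewrite (bool_irrelevance pg ph). Qed.

Definition cdist g h : R := sup [set `|sval g w - sval h w| | w in [set: V]].

Lemma cdist_le g h (r : R) : (forall w, `|sval g w - sval h w| <= r) ->
  cdist g h <= r.
Proof.
move=> gh; have [v _] := completionP g ltr01.
apply: ge_sup; first by exists (`|sval g v - sval h v|), v.
by move=> _ [w _ <-].
Qed.

Lemma pdist_lip v u w : `|D v w - D u w| <= D v u.
Proof.
have := pdist_triangle D v u w; have := pdist_triangle D u v w.
by rewrite ler_norml (pdistC D u v) => ? ?; apply/andP; split; lra.
Qed.

Lemma cdist_ge g h w : `|sval g w - sval h w| <= cdist g h.
Proof.
apply: ub_le_sup; last by exists w.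
have [v hv] := completionP g ltr01; have [u hu] := completionP h ltr01.
exists (D v u + 2) => _ [z _ <-].
have := hv z; have := hu z; have := pdist_lip v u z.
by rewrite !ler_norml => /andP[? ?] /andP[? ?] /andP[? ?]; apply/andP; split; lra.
Qed.

Let cdistxx g : cdist g g = 0.
Proof.
apply/eqP; rewrite eq_le; apply/andP; split.
  by apply: cdist_le => w; rewrite subrr normr0.
by have [v _] := completionP g ltr01; apply: le_trans (cdist_ge g g v).
Qed.

Let cdist_eq0 g h : cdist g h = 0 -> g = h.
Proof.
move=> gh; apply: completion_inj => w; apply/eqP; rewrite -subr_eq0 -normr_le0.
by rewrite -gh cdist_ge.
Qed.

Let cdistC g h : cdist g h = cdist h g.
Proof.
by congr sup; apply/seteqP; split=> _ [w _ <-]; exists w => //; rewrite distrC.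
Qed.

Let cdist_triangle h g k : cdist g k <= cdist g h + cdist h k.
Proof.
apply: cdist_le => w; have := cdist_ge g h w; have := cdist_ge h k w.
by rewrite !ler_norml => /andP[? ?] /andP[? ?]; apply/andP; split; lra.
Qed.

HB.instance Definition _ :=
  isMetric.Build R completion cdistxx cdist_eq0 cdistC cdist_triangle.

Lemma mdist_completion_le g h (r : R) :
  (forall w, `|sval g w - sval h w| <= r) -> mdist g h <= r.
Proof. exact: cdist_le. Qed.

Lemma mdist_completion_ge g h w : `|sval g w - sval h w| <= mdist g h.
Proof. exact: cdist_ge. Qed.

Lemma embed_subproof v : `[< approximable (D v) >].
Proof.
by apply/asboolP => e e0; exists v => w; rewrite subrr normr0 ltW.
Qed.

Definition embed v : completion := exist _ (D v) (embed_subproof v).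

Lemma mdist_embedr g v : mdist g (embed v) = sval g v.
Proof.
apply/eqP; rewrite eq_le; apply/andP; split; last first.
  have := mdist_completion_ge g (embed v) v; rewrite /= pdist0 subr0.
  exact/le_trans/ler_norm.
apply: mdist_completion_le => w; apply/ler_addgt0Pr => e e0.
have e20 : 0 < e / 2 by rewrite divr_gt0.
have [u hu] := completionP g e20.
have := hu w; have := hu v; have := pdist_lip u v w => /=.
by rewrite !ler_norml => /andP[? ?] /andP[? ?] /andP[? ?]; apply/andP; split; lra.
Qed.

Lemma mdist_embed v w : mdist (embed v) (embed w) = D v w.
Proof. by rewrite mdist_embedr. Qed.

Lemma embed_dense : dense_map embed.
Proof.
move=> g e e0; have e20 : 0 < e / 2 by rewrite divr_gt0.
have [v hv] := completionP g e20; exists v.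
rewrite mdist_embedr; have := hv v; rewrite pdist0 subr0 => hgv.
by apply: le_lt_trans (ler_norm _) _; apply: le_lt_trans hgv _; lra.
Qed.

Lemma completion_complete (F : set_system completion) :
  ProperFilter F -> cauchy F -> exists g, F --> g.
Proof.
move=> FF /cauchyP Fc.
have ball_coord x e w g : ball x e g -> `|sval x w - sval g w| < e.
  by rewrite ballEmdist; apply: le_lt_trans; apply: cdist_ge.
have lim_coord w : exists r : R, sval g w @[g --> F] --> r.
  have : cauchy (sval g w @[g --> F]).
    apply/cauchyP => e e0; have [x Fx] := Fc e e0; exists (sval x w).
      suff : F [set g | ball (sval x w) e (sval g w)] by [].
    by apply: filterS Fx => g /ball_coord; apply.
  by move=> /cauchy_cvg h; exists (lim (sval g w @[g --> F])).
have /choice [h hF] := lim_coord.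
have near_h x (e : R) : F (ball x e) -> forall w, `|h w - sval x w| <= e.
  move=> Fx w; have hw : `|sval g w - sval x w| @[g --> F] --> `|h w - sval x w|.
    by apply: cvg_norm; apply: cvgB; [apply: hF|apply: cvg_cst].
  apply: (cvgr_to_le hw); apply: filterS Fx => g /(ball_coord _ _ w) /ltW.
  by rewrite distrC.
have hX : `[< approximable h >].
  apply/asboolP => e e0; have e20 : 0 < e / 2 by rewrite divr_gt0.
  have [x Fx] := Fc _ e20; have [v hv] := completionP x e20; exists v => w.
  have := near_h _ _ Fx w; have := hv w; rewrite !ler_norml.
  by move=> /andP[? ?] /andP[? ?]; apply/andP; split; lra.
exists (exist _ h hX).
apply/metricType_numDomainType.fcvgrPdist_lt => e e0.
have e20 : 0 < e / 3 by rewrite divr_gt0.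
have [x Fx] := Fc _ e20; apply: filterS (Fx) => g; rewrite ballEmdist /= => xg.
apply: le_lt_trans (metric_triangle _ x _) _.
have : mdist (exist _ h hX : completion) x <= e / 3.
  by apply: mdist_completion_le => w; apply: near_h.
by move=> ?; lra.
Qed.

Section Extension.
Context {n : nat} (phi : ('I_n -> V) -> R).

Definition unif_cont := forall e : R, 0 < e -> exists2 d : R, 0 < d &
  forall v w, (forall i, D (v i) (w i) < d) -> `|phi v - phi w| <= e.

(** The extension by continuity of [phi] to tuples of the completion. *)
Definition extend (x : 'I_n -> completion) : R := lim (phi @ near_pts embed x).

Lemma near_embed (x : 'I_n -> completion) (d : R) (v w : 'I_n -> V) :
  (forall i, mdist (x i) (embed (v i)) < d / 2) ->
  (forall i, mdist (x i) (embed (w i)) < d / 2) ->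
  forall i, D (v i) (w i) < d.
Proof.
move=> hv hw i; rewrite -mdist_embed (splitr d).
by apply: le_lt_trans (metric_triangle _ (x i) _) _; rewrite metric_sym ltrD.
Qed.

Lemma extendP x : unif_cont -> phi @ near_pts embed x --> extend x.
Proof.
move=> uc; have PF := near_pts_filter x embed_dense.
apply: cauchy_cvg; apply/cauchyP => e e0.
have e20 : 0 < e / 2 by rewrite divr_gt0.
have [d d0 hd] := uc _ e20.
have d20 : 0 < d / 2 by rewrite divr_gt0.
have [v hv] := filter_ex (near_ptsP embed x d20).
exists (phi v); apply: filterS (near_ptsP embed x d20) => w hw.
by rewrite /ball /=; apply: le_lt_trans (hd _ _ (near_embed hv hw)) _; lra.
Qed.

Lemma extend_mod x y (c e : R) : unif_cont ->
  (forall v w, (forall i, D (v i) (w i) < c) -> `|phi v - phi w| <= e) ->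
  (forall i, mdist (x i) (y i) < c) -> `|extend x - extend y| <= e.
Proof.
move=> uc hc xy; apply/ler_addgt0Pr => r r0.
have PFx := near_pts_filter x embed_dense.
have PFy := near_pts_filter y embed_dense.
have r20 : 0 < r / 2 by rewrite divr_gt0.
have [m m0 hm] := @common_radius R n (fun i => (c - mdist (x i) (y i)) / 2)
  (fun i => ltac:(rewrite divr_gt0// subr_gt0; exact: xy)).
have /cvgrPdist_le /(_ _ r20) hx := @extendP x uc.
have /cvgrPdist_le /(_ _ r20) hy := @extendP y uc.
have [v [hv1 hv2]] := filter_ex (filterI hx (near_ptsP embed x m0)).
have [w [hw1 hw2]] := filter_ex (filterI hy (near_ptsP embed y m0)).
have : `|phi v - phi w| <= e.
  apply: hc => i; rewrite -mdist_embed.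
  apply: le_lt_trans (metric_triangle _ (x i) _) _.
  have h1 := hv2 i; have h2 := hw2 i; have h3 := hm i.
  have h4 := metric_triangle (x i) (y i) (embed (w i)).
  by rewrite metric_sym; lra.
move: hv1 hw1; rewrite !ler_norml => /andP[? ?] /andP[? ?] /andP[? ?].
by apply/andP; split; lra.
Qed.

End Extension.

End Completion.

(** * Henkin limits *)

Section HenkinLimit.
Context {R : realType} {L : language R} {T : theory L}.
Context {I : Type} {F : set_system I} {FF : ProperFilter F}.
Context {M : I -> model T} {V : Type}.
Variable alpha : forall i, V -> M i.
Variable P : forall n, formula L n -> ('I_n -> V) -> R.
Hypothesis P_lim : forall n (s : formula L n) (v : 'I_n -> V),
  feval s (alpha i \o v) @[i --> F] --> P s v.
Hypothesis P_henkin : forall n (s : formula L n.+1) (v : 'I_n -> V) (e : R),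
  0 < e -> exists x, P (FSup s) v - e <= P s (vcons x v).

Arguments P_lim {n} s v _ _.

Let lim_eq (f g : I -> R) (a b : R) : f @ F --> a -> g @ F --> b ->
  f =1 g -> a = b.
Proof. by move=> fa gb /funext fg; apply: (cvg_unique _ fa); rewrite // fg. Qed.

Let P_neg n (s : formula L n) v : P (FNeg s) v = - P s v.
Proof.
apply: lim_eq (P_lim _ _) (cvgN (P_lim _ _)) _ => i.
exact: feval_FNeg.
Qed.

Let P_sup_neg n (s : formula L n.+1) v : P (FSup (FNeg s)) v = - P (FInf s) v.
Proof.
apply: lim_eq (P_lim _ _) (cvgN (P_lim _ _)) _ => i.
exact: feval_FSup_FNeg.
Qed.

Let delta (v w : V) : R :=
  P (FDist (Var ord0) (Var (lift ord0 ord0)))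
    (vcons v (vcons w (fun i : 'I_0 => v))).

Let delta_lim v w : mdist (alpha i v) (alpha i w) @[i --> F] --> delta v w.
Proof.
rewrite (_ : (fun i => _) = (fun i =>
    feval (FDist (Var ord0) (Var (lift ord0 ord0)))
      (alpha i \o vcons v (vcons w (fun i : 'I_0 => v))))).
  exact: P_lim.
by apply/funext => i /=; rewrite vcons0 vconsS vcons0.
Qed.

Arguments delta_lim v w _ _ : clear implicits.

Let delta0 v : delta v v = 0.
Proof.
apply: lim_eq (delta_lim v v) (cvg_cst 0) _ => i.
exact: mdistxx.
Qed.

Let deltaC v w : delta v w = delta w v.
Proof.
apply: lim_eq (delta_lim v w) (delta_lim w v) _ => i.
exact: metric_sym.
Qed.

Let delta_triangle v u w : delta v w <= delta v u + delta u w.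
Proof.
apply: cvg_lim_le (delta_lim v w) (cvgD (delta_lim v u) (delta_lim u w)) _ => i.
exact: metric_triangle.
Qed.

Let D : pseudometric := PseudoMetric delta0 deltaC delta_triangle.
Let X : metricType R := completion D.
Let emb : V -> X := embed D.

Let near_modulus n (v w : 'I_n -> V) (c : R) :
  (forall j, D (v j) (w j) < c) ->
  \forall i \near F, forall j, mdist (alpha i (v j)) (alpha i (w j)) < c.
Proof.
move=> vw; apply: filter_forall => j.
by apply: (cvgr_lt (delta (v j) (w j))); [exact: delta_lim|exact: vw].
Qed.

Let dist_cvg (f g : I -> R) (a b e : R) : f @ F --> a -> g @ F --> b ->
  (\forall i \near F, `|f i - g i| <= e) -> `|a - b| <= e.
Proof.
move=> fa gb; apply: cvgr_to_le.
by apply: cvg_norm; apply: cvgB.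
Qed.

Let dist3 (a b c d e : R) : `|a - b| <= e / 3 -> `|b - c| <= e / 3 ->
  `|d - c| <= e / 3 -> `|a - d| <= e.
Proof.
rewrite !ler_norml => /andP[? ?] /andP[? ?] /andP[? ?].
by apply/andP; split; lra.
Qed.

Let vars n : 'I_n -> term L n := fun i => Var i.

Let Ppred Q (v : 'I_(pred_arity Q) -> V) : R := P (FPred Q (@vars _)) v.

Let Ppred_mod Q (e : R) v w : 0 < e ->
  (forall j, D (v j) (w j) < pred_mod Q e) -> `|@Ppred Q v - Ppred w| <= e.
Proof.
move=> e0 /near_modulus vw; apply: dist_cvg (P_lim _ _) (P_lim _ _) _.
by apply: filterS vw => i; apply: pred_int_mod.
Qed.

Let Ppred_uc Q : unif_cont D (@Ppred Q).
Proof.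
move=> e e0; exists (pred_mod Q e); first exact: pred_mod_gt0.
by move=> v w; apply: Ppred_mod.
Qed.

(** A function symbol cannot be applied inside [V]: what is known of the value
  of [f] at [v] is its distance to each [w]. *)
Let Pfun f (w : V) (v : 'I_(fun_arity f) -> V) : R :=
  P (FDist (App f (fun i => Var (lift ord0 i))) (Var ord0)) (vcons w v).

Let Pfun_lim f w v :
  mdist (fun_int (alpha i \o v)) (alpha i w) @[i --> F] --> @Pfun f w v.
Proof.
rewrite (_ : (fun i => _) = (fun i =>
    feval (FDist (App f (fun i => Var (lift ord0 i))) (Var ord0))
      (alpha i \o vcons w v))); first exact: P_lim.
apply/funext => i /=; rewrite vcons0; congr (mdist (fun_int _) _).
by apply/funext => j; rewrite /= vconsS.
Qed.

Arguments Pfun_lim {f} w v _ _.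

Let Pfun_mod f w (e : R) v v' : 0 < e ->
  (forall j, D (v j) (v' j) < fun_mod f e) ->
  `|@Pfun f w v - Pfun w v'| <= e.
Proof.
move=> e0 /near_modulus vv'; apply: dist_cvg (Pfun_lim _ _) (Pfun_lim _ _) _.
apply: filterS vv' => i /(fun_int_mod e0) h.
by apply: le_trans (mdist_dist _ _ _ _) _; rewrite mdistxx addr0.
Qed.

Let Pfun_uc f w : unif_cont D (@Pfun f w).
Proof.
move=> e e0; exists (fun_mod f e); first exact: fun_mod_gt0.
by move=> v v'; apply: Pfun_mod.
Qed.

(** The infimum over [y] of the distance from [f v] to [y] is 0 in every model,
  so a witness of this infimum is a value of [f] at [v] up to [e]. *)
Let Pfun_henkin f v (e : R) : 0 < e -> exists x, @Pfun f x v <= e.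
Proof.
move=> e0; set s := FDist (App f (fun i => Var (lift ord0 i))) (Var ord0).
have [x hx] := P_henkin (FNeg s) v e0; exists x.
have inf0 : P (FInf s) v = 0.
  apply: lim_eq (P_lim _ _) (cvg_cst 0) _ => i.
  apply/eqP; rewrite eq_le; apply/andP; split; last first.
    by apply: FInf_ge => y; apply: mdist_ge0.
  have := @FInf_le _ _ _ _ s (alpha i \o v) (fun_int (alpha i \o v)).
  rewrite /= sconsE vcons0 (_ : (fun j => _) = (alpha i \o v)) ?mdistxx//.
  by apply/funext => j; rewrite vconsS.
by move: hx; rewrite P_sup_neg inf0 P_neg -/(Pfun x v); lra.
Qed.

Let fun_value f (x : 'I_(fun_arity f) -> X) (w : V) : R :=
  extend (@Pfun f w) x.

Let fun_value_approximable f x : `[< approximable D (@fun_value f x) >].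
Proof.
apply/asboolP => e e0; have e30 : 0 < e / 3 by rewrite divr_gt0.
have PF := near_pts_filter x (@embed_dense _ _ D).
have c20 : 0 < fun_mod f (e / 3) / 2 by rewrite divr_gt0// fun_mod_gt0.
have [v hv] := filter_ex (near_ptsP emb x c20).
have [y hy] := @Pfun_henkin f v _ e30.
exists y => w.
have h1 : `|fun_value x w - Pfun w v| <= e / 3.
  have hl : `|Pfun w v' - Pfun w v| @[v' --> near_pts emb x] -->
      `|fun_value x w - Pfun w v|.
    apply: cvg_norm; apply: cvgB; last exact: cvg_cst.
    exact: extendP (@Pfun_uc f w).
  apply: (cvgr_to_le hl); apply: filterS (near_ptsP emb x c20) => v' hv'.
  by apply: Pfun_mod => // j; apply: near_embed hv' hv j.
have h2 : `|Pfun w v - D y w| <= Pfun y v.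
  have hl : `|mdist (fun_int (alpha i \o v)) (alpha i w) -
      mdist (alpha i y) (alpha i w)| @[i --> F] --> `|@Pfun f w v - D y w|.
    by apply: cvg_norm; apply: cvgB; [exact: Pfun_lim|exact: delta_lim].
  apply: cvg_lim_le hl (Pfun_lim y v) _ => i.
  by apply: le_trans (mdist_dist _ _ _ _) _; rewrite mdistxx addr0.
by move: h1 h2; rewrite !ler_norml => /andP[? ?] /andP[? ?]; apply/andP; split; lra.
Qed.

Let Xfun f (x : 'I_(fun_arity f) -> X) : X :=
  exist _ (fun_value x) (fun_value_approximable x).

Let Xpred Q (x : 'I_(pred_arity Q) -> X) : R := extend (@Ppred Q) x.

Let X_diam (x y : X) : mdist x y <= diam_bound L.
Proof.
apply/ler_addgt0Pr => e e0; have e20 : 0 < e / 2 by rewrite divr_gt0.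
have [v hv] := @embed_dense _ _ D x _ e20.
have [w hw] := @embed_dense _ _ D y _ e20.
have h : D v w <= diam_bound L.
  by apply: (cvgr_to_le (delta_lim v w)); apply: nearW => i; apply: carrier_diam.
have h1 := metric_triangle x (emb v) y.
have h2 := metric_triangle (emb v) (emb w) y.
have h3 : mdist (emb v) (emb w) = D v w := mdist_embed _ _ _.
by move: hv hw h1 h2; rewrite h3 (metric_sym (emb w) y) => ? ? ? ?; lra.
Qed.

Let Xfun_mod f (e : R) (x y : 'I_(fun_arity f) -> X) : 0 < e ->
  (forall i, mdist (x i) (y i) < fun_mod f e) -> mdist (Xfun x) (Xfun y) <= e.
Proof.
move=> e0 xy; apply: mdist_completion_le => w.
apply: extend_mod (@Pfun_uc f w) _ xy => v v'; exact: Pfun_mod.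
Qed.

Let Xpred_mod Q (e : R) (x y : 'I_(pred_arity Q) -> X) : 0 < e ->
  (forall i, mdist (x i) (y i) < pred_mod Q e) -> `|Xpred x - Xpred y| <= e.
Proof.
by move=> e0 xy; apply: extend_mod (@Ppred_uc Q) _ xy => v v'; exact: Ppred_mod.
Qed.

Let Xpred_itv Q (x : 'I_(pred_arity Q) -> X) :
  pred_lo Q <= Xpred x <= pred_hi Q.
Proof.
have PF := near_pts_filter x (@embed_dense _ _ D).
have h (v : 'I_(pred_arity Q) -> V) : pred_lo Q <= Ppred v <= pred_hi Q.
  apply/andP; split.
    apply: (cvgr_to_ge (P_lim _ _)); apply: nearW => i /=.
    by case/andP: (pred_int_itv (fun j => teval (vars j) (alpha i \o v))).
  apply: (cvgr_to_le (P_lim _ _)); apply: nearW => i /=.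
  by case/andP: (pred_int_itv (fun j => teval (vars j) (alpha i \o v))).
apply/andP; split.
  apply: (cvgr_to_ge (extendP (x := x) (@Ppred_uc Q))).
  by apply: nearW => v; case/andP: (h v).
apply: (cvgr_to_le (extendP (x := x) (@Ppred_uc Q))).
by apply: nearW => v; case/andP: (h v).
Qed.

Let X_inhab : inhabited X.
Proof.
have [i _] := filter_ex (@filterT _ F _); have [y] := inhab (M i).
pose s : formula L 1 := FDist (Var ord0) (Var ord0).
have v0 : 'I_0 -> V by case.
by have [x _] := P_henkin s v0 ltr01; exists; exact: (emb x).
Qed.

Let N : structure L := Structure X_inhab (@completion_complete _ _ D)
  X_diam Xfun_mod Xpred_mod Xpred_itv.

Let embN : V -> N := emb.

(** A term has no value in [V], hence the induction is on its distances to the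
  points of [V]. *)
Let term_lim n (t : term L n) (v : 'I_n -> V) (w : V) :
  mdist (teval t (alpha i \o v)) (alpha i w) @[i --> F] -->
  mdist (teval t (embN \o v)) (embN w).
Proof.
elim: t => [j|f ts IH] in w *.
  have -> : mdist (embN (v j)) (embN w) = delta (v j) w by exact: mdist_embed.
  exact: delta_lim.
set x : 'I_(fun_arity f) -> N := fun j => teval (ts j) (embN \o v).
have -> : mdist (teval (App f ts) (embN \o v)) (embN w) = fun_value x w.
  exact: mdist_embedr.
apply/cvgrPdist_le => e e0; have e30 : 0 < e / 3 by rewrite divr_gt0.
have PF := near_pts_filter x (@embed_dense _ _ D).
have /cvgrPdist_le /(_ _ e30) h1 := extendP (x := x) (@Pfun_uc f w).
have [u [hu1 hu2]] :=
  filter_ex (filterI h1 (near_ptsP embN x (fun_mod_gt0 f e30))).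
have h2 : \forall i \near F, forall j,
    mdist (teval (ts j) (alpha i \o v)) (alpha i (u j)) < fun_mod f (e / 3).
  apply: filter_forall => j.
  by apply: (cvgr_lt _ (IH j (u j))); apply: hu2.
have /cvgrPdist_le /(_ _ e30) h3 := Pfun_lim w u.
apply: filterS (filterI h2 h3) => i [/(fun_int_mod e30) h2i h3i] /=.
have h4 := mdist_dist (fun_int (fun j => teval (ts j) (alpha i \o v)))
  (alpha i w) (fun_int (fun j => alpha i (u j))) (alpha i w).
rewrite mdistxx addr0 in h4.
exact: dist3 hu1 h3i (le_trans h4 h2i).
Qed.

Arguments term_lim {n} t v w _ _.

Let feval_lim n (s : formula L n) (v : 'I_n -> V) :
  feval s (embN \o v) = P s v.
Proof.
have density x e : 0 < e -> exists v, mdist (x : N) (embN v) < e.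
  exact: embed_dense.
elim: n / s v => [n t1 t2|n Q ts|n k u cu ss IH|n s IH|n s IH] v.
- apply: (@cvg_unique _ (@Rhausdorff R) _ _ _ _ _ (P_lim (FDist t1 t2) v)).
  apply/cvgrPdist_le => e e0; have e30 : 0 < e / 4 by rewrite divr_gt0.
  have [w hw] := density (teval t2 (embN \o v)) _ e30.
  have /cvgrPdist_le /(_ _ e30) h1 := term_lim t1 v w.
  have /cvgrPdist_le /(_ _ e30) h2 := term_lim t2 v w.
  apply: filterS (filterI h1 h2) => i [h1i h2i] /=.
  have h3 := mdist_dist (teval t1 (embN \o v)) (teval t2 (embN \o v))
    (teval t1 (embN \o v)) (embN w).
  have h4 := mdist_dist (teval t1 (alpha i \o v)) (teval t2 (alpha i \o v))
    (teval t1 (alpha i \o v)) (alpha i w).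
  move: h1i h2i h3 h4; rewrite !mdistxx !add0r !ler_norml.
  move=> /andP[? ?] /andP[? ?] /andP[? ?] /andP[? ?]; apply/andP; split; lra.
- apply: (@cvg_unique _ (@Rhausdorff R) _ _ _ _ _ (P_lim (FPred Q ts) v)).
  set x : 'I_(pred_arity Q) -> N := fun j => teval (ts j) (embN \o v).
  have -> : feval (FPred Q ts) (embN \o v) = Xpred x by [].
  apply/cvgrPdist_le => e e0; have e30 : 0 < e / 3 by rewrite divr_gt0.
  have PF := near_pts_filter x (@embed_dense _ _ D).
  have /cvgrPdist_le /(_ _ e30) h1 := extendP (x := x) (@Ppred_uc Q).
  have [u [hu1 hu2]] :=
    filter_ex (filterI h1 (near_ptsP embN x (pred_mod_gt0 Q e30))).
  have h2 : \forall i \near F, forall j,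
      mdist (teval (ts j) (alpha i \o v)) (alpha i (u j)) < pred_mod Q (e / 3).
    apply: filter_forall => j.
    by apply: (cvgr_lt _ (term_lim (ts j) v (u j))); apply: hu2.
  have /cvgrPdist_le /(_ _ e30) h3 := P_lim (FPred Q (@vars _)) u.
  apply: filterS (filterI h2 h3) => i [/(pred_int_mod e30) h2i h3i] /=.
  exact: dist3 hu1 h3i h2i.
- apply: (@cvg_unique _ (@Rhausdorff R) _ _ _ _ _ (P_lim (FConn u cu ss) v)).
  rewrite /=; under [X in u X]eq_mx do rewrite IH.
  apply: (@cvg_comp _ _ _ (fun i => \row_j feval (ss j) (alpha i \o v)) u).
    2: exact: cu.
  apply/cvg_ballP => e e0.
  have : \forall i \near F, forall j,
      ball (P (ss j) v) e (feval (ss j) (alpha i \o v)).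
    by apply: filter_forall => j; apply: cvg_ball (P_lim _ _) _ e0.
  by apply: filterS => i hi; split => // j k0; rewrite !mxE; apply: hi.
- have Ps w : feval s (scons (embN w) (embN \o v)) = P s (vcons w v).
    by rewrite sconsE -comp_vcons IH.
  apply/eqP; rewrite eq_le; apply/andP; split.
    apply: FSup_le => x; apply/ler_addgt0Pr => e e0.
    have [d d0 hd] := feval_uc s e0; have [w hw] := density x _ d0.
    have : `|feval s (scons x (embN \o v)) - P s (vcons w v)| <= e.
      by rewrite -Ps; apply: hd; apply: scons_lt => // j; rewrite mdistxx.
    have : P s (vcons w v) <= P (FSup s) v.
      apply: cvg_lim_le (P_lim s _) (P_lim (FSup s) v) _ => i.
      by rewrite comp_vcons; apply: FSup_ge.
    by rewrite ler_norml => ? /andP[? ?]; lra.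
  apply/ler_addgt0Pr => e e0; have [w hw] := P_henkin s v e0.
  by have := @FSup_ge _ _ N _ s (embN \o v) (embN w); rewrite Ps; lra.
- have Ps w : feval s (scons (embN w) (embN \o v)) = P s (vcons w v).
    by rewrite sconsE -comp_vcons IH.
  apply/eqP; rewrite eq_le; apply/andP; split.
    apply/ler_addgt0Pr => e e0; have [w] := P_henkin (FNeg s) v e0.
    rewrite P_neg P_sup_neg.
    by have := @FInf_le _ _ N _ s (embN \o v) (embN w); rewrite Ps; lra.
  apply: FInf_ge => x; apply/ler_addgt0Pr => e e0.
  have [d d0 hd] := feval_uc s e0; have [w hw] := density x _ d0.
  have : `|feval s (scons x (embN \o v)) - P s (vcons w v)| <= e.
    by rewrite -Ps; apply: hd; apply: scons_lt => // j; rewrite mdistxx.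
  have : P (FInf s) v <= P s (vcons w v).
    apply: cvg_lim_le (P_lim (FInf s) v) (P_lim s _) _ => i.
    by rewrite comp_vcons; apply: FInf_le.
  by rewrite ler_norml => ? /andP[? ?]; lra.
Qed.

Let N_sat : satisfies N T.
Proof.
move=> s Ts a; have v0 : 'I_0 -> V by case.
have -> : a = embN \o v0 by apply/funext; case.
rewrite feval_lim; apply: lim_eq (P_lim _ _) (cvg_cst 0) _ => i.
exact: model_sat.
Qed.

(** The limit [delta] of the distances is a pseudometric on [V], and the
  symbols extend to the completion since they keep their moduli in the limit.
  The values of formulas then pass to the limit by induction: connectives are
  continuous, and a supremum is at least its values at the points of [V], which
  come close to the limit by [P_henkin], while density of [V] bounds it from
  above. *)
Lemma henkin_model : exists (N : model T) (f : V -> N), dense_map f /\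
  forall n (s : formula L n) (v : 'I_n -> V), feval s (f \o v) = P s v.
Proof.
by exists (Model N_sat), embN; split; [exact: embed_dense|exact: feval_lim].
Qed.

End HenkinLimit.

(** * Spaces of types *)

Section TypeSpace.
Context {R : realType} {L : language R} {T : theory L}.

Definition type_val n (t : type_space T n) (s : formula L n) : R := sval t s.

Lemma type_val_tp n (M : model T) (a : 'I_n -> M) s : type_val (tp a) s = feval s a.
Proof. by []. Qed.

Lemma type_val_inj n (t t' : type_space T n) : type_val t =1 type_val t' -> t = t'.
Proof.
case: t t' => t pt [t' pt'] /= /funext tt'.
have {}tt' : t = t' by exact: tt'.
by subst t'; rewrite (bool_irrelevance pt pt').
Qed.

Lemma tp_surj n (t : type_space T n) :
  exists (M : model T) (a : 'I_n -> M), tp a = t.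
Proof.
case: t => f pf; have [M [a fE]] := set_mem pf.
by exists M, a; apply: type_val_inj => s; rewrite type_val_tp /type_val /= fE.
Qed.

Lemma is_type_rename m n (tau : 'I_m -> 'I_n) (t : type_space T n) :
  (fun s => type_val t (rename s tau)) \in @is_type R L T m.
Proof.
have [M [a <-]] := tp_surj t; apply/mem_set; exists M, (a \o tau).
by apply/funext => s; rewrite type_val_tp feval_rename.
Qed.

Definition tpr m n (tau : 'I_m -> 'I_n) (t : type_space T n) : type_space T m :=
  exist (fun f => f \in @is_type R L T m) (fun s => type_val t (rename s tau))
    (is_type_rename tau t).

Lemma type_val_tpr m n (tau : 'I_m -> 'I_n) t s :
  type_val (tpr tau t) s = type_val t (rename s tau).
Proof. by []. Qed.

Lemma tpr_tp m n (tau : 'I_m -> 'I_n) (M : model T) (a : 'I_n -> M) :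
  tpr tau (tp a) = tp (a \o tau).
Proof. by apply: type_val_inj => s; rewrite type_val_tpr !type_val_tp feval_rename. Qed.

Lemma tpr_comp k m n (tau : 'I_k -> 'I_m) (nu : 'I_m -> 'I_n) t :
  tpr tau (tpr nu t) = tpr (nu \o tau) t.
Proof. by have [M [a <-]] := tp_surj t; rewrite !tpr_tp. Qed.

Lemma type_val_continuous n (s : formula L n) :
  continuous (fun t : type_space T n => type_val t s).
Proof.
move=> t A /= nA.
have h1 : nbhs (set_val t) [set f : prod_topology (fun _ : formula L n => R) |
    A (f s)].
  have /cvg_sup/(_ s) h : nbhs (set_val t) --> set_val t by exact: cvg_id.
  exact/h/(@initial_continuous _ _
    (fun f : (forall _ : formula L n, R) => f s) (set_val t)).
exact: (@initial_continuous _ _ (@set_val _ (@is_type R L T n)) t) h1.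
Qed.

Lemma type_cvgP n (F : set_system (type_space T n)) t : Filter F ->
  F --> t <-> forall s, type_val t' s @[t' --> F] --> type_val t s.
Proof.
move=> FF; split=> [Ft s|h].
  exact: (cvg_comp _ _ Ft (@type_val_continuous n s t)).
move=> A [_ [[C oC <-] Ct sub]]; rewrite nbhs_filterE.
apply: filterS sub _.
suff : (set_val @ F : set_system (prod_topology (fun _ : formula L n => R)))
    --> set_val t.
  by apply; exact: open_nbhs_nbhs.
apply/cvg_sup => s U [V] [[W oW <-] Wt WU]; rewrite nbhs_filterE.
apply: filterS WU _; apply: (h s).
exact: open_nbhs_nbhs.
Qed.

Lemma tpr_continuous m n (tau : 'I_m -> 'I_n) :
  continuous (@tpr m n tau).
Proof.
move=> t; have FF : Filter (tpr tau @ nbhs t) by exact: fmap_filter.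
apply/type_cvgP => s; exact: (@type_val_continuous n (rename s tau) t).
Qed.

Lemma open_type_val_lt n (I : finType) (s : I -> formula L n) (r : R) :
  open [set t : type_space T n | forall i, type_val t (s i) < r].
Proof.
rewrite openE => t h; rewrite /interior.
apply: (@filter_forall _ _ _ _ (nbhs_filter t)) => i.
exact: (cvgr_lt _ (@type_val_continuous n (s i) t) _ (h i)).
Qed.

Lemma type_hausdorff n : hausdorff_space (type_space T n).
Proof.
move=> t t' clt; apply: type_val_inj => s; apply: (@Rhausdorff R).
move=> A B nA nB; have [u [Au Bu]] :=
  clt _ _ (@type_val_continuous n s t _ nA) (@type_val_continuous n s t' _ nB).
by exists (type_val u s).
Qed.

End TypeSpace.

(** * Compactness *)

Lemma ultra_cvg {R : realType} {I : Type} (F : set_system I) (h : I -> R)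
    (B : R) : UltraFilter F -> (forall i, `|h i| <= B) ->
  h @ F --> lim (h @ F).
Proof.
move=> FU hB; suff h_cvg : exists l : R, h @ F --> l by exact/cvg_ex.
have hF : (h @ F) `[- B, B]%classic.
  by apply: nearW => i; rewrite /= in_itv /= -ler_norml.
have [l [_ cl]] := segment_compact (fmap_proper_filter h _) hF.
exists l => A nA; have [//|FnA] := in_ultra_setVsetC (h @^-1` A) FU.
have [|y [ny Ay]] := cl (~` A) A _ nA; last by [].
exact: FnA.
Qed.

Section Compactness.
Context {R : realType} {L : language R}.

(** Variables and witnesses of approximate suprema: interpreted in any model
  that interprets the variables, they form a Henkin family. *)
Inductive skolem (n : nat) :=
| SVar of 'I_n
| SWit m (s : formula L m.+1) of ('I_m -> skolem n) & nat.

Lemma inv_succ_gt0 k : 0 < k.+1%:R^-1 :> R.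
Proof. by rewrite invr_gt0 ltr0Sn. Qed.

Fixpoint skolem_eval n (M : structure L) (a : 'I_n -> M) (v : skolem n) : M :=
  match v with
  | SVar i => a i
  | SWit m s w k =>
    projT1 (cid (FSup_adherent s (fun i => skolem_eval a (w i)) (inv_succ_gt0 k)))
  end.

Lemma skolem_witness n (M : structure L) (a : 'I_n -> M) m (s : formula L m.+1)
    w k :
  feval (FSup s) (skolem_eval a \o w) - k.+1%:R^-1 <=
  feval s (skolem_eval a \o vcons (SWit s w k) w).
Proof. by rewrite comp_vcons /=; case: cid => x /= /ltW. Qed.

Lemma exists_inv_succ (e : R) : 0 < e -> exists k : nat, k.+1%:R^-1 < e.
Proof.
move=> e0; have [k _ hk] := near_infty_natSinv_lt (PosNum e0).
by exists k; apply: (hk k) => /=.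
Qed.

(** An ultrafilter of types is realized in the limit of models that realize
  them: the Skolem terms supply the witnesses of suprema, and the limits exist
  because formulas are bounded. *)
Lemma type_space_compact (T : theory L) n : compact [set: type_space T n].
Proof.
rewrite compact_ultra => F FU _.
have /choice [Ma tpMa] : forall t : type_space T n,
    exists Ma : {M : model T & 'I_n -> M}, tp (projT2 Ma) = t.
  by move=> t; have [M [a <-]] := tp_surj t; exists (existT _ M a).
pose alpha t := skolem_eval (projT2 (Ma t)).
pose P m (s : formula L m) (v : 'I_m -> skolem n) : R :=
  lim (feval s (alpha t \o v) @[t --> F]).
have P_lim m (s : formula L m) v : feval s (alpha t \o v) @[t --> F] --> P m s v.
  by have [B hB] := feval_bounded s; apply: ultra_cvg => t; apply: hB.
have P_henkin m (s : formula L m.+1) v (e : R) : 0 < e ->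
    exists x, P m (FSup s) v - e <= P m.+1 s (vcons x v).
  move=> /exists_inv_succ [k hk]; exists (SWit s v k).
  rewrite lerBlDr; apply: (@le_trans _ _ (P m.+1 s (vcons (SWit s v k) v) +
    k.+1%:R^-1)); last by rewrite lerD2l ltW.
  rewrite -lerBlDr; apply: (@cvg_lim_le _ _ F _
    (fun t => feval (FSup s) (alpha t \o v) - k.+1%:R^-1)
    (fun t => feval s (alpha t \o vcons (SWit s v k) v))).
  - by apply: cvgB; [exact: P_lim|exact: cvg_cst].
  - exact: P_lim.
  - by move=> t; apply: skolem_witness.
have [N [f [_ fP]]] := henkin_model P_lim P_henkin.
exists (tp (f \o @SVar n)); split=> //=; apply/type_cvgP => s.
rewrite type_val_tp fP; have := P_lim _ s (@SVar n).
rewrite (_ : (fun t => _) = (fun t => type_val t s)) //.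
apply/funext => t; exact: (congr1 (fun u => type_val u s) (tpMa t)).
Qed.

End Compactness.

Section Realization.
Context {R : realType} {L : language R} {T : theory L}.

Lemma bump_continuous (e r : R) :
  continuous (fun v : 'rV[R]_1 => e - `|v ord0 ord0 - r|).
Proof.
apply: (@lipschitz_connective _ _ _ 1 ltr01) => v w d d0 /(_ ord0) h.
rewrite mul1r; apply: le_trans h; have := ler_dist_dist (v ord0 ord0 - r) (w ord0 ord0 - r).
rewrite !ler_norml (_ : _ - r - (_ - r) = v ord0 ord0 - w ord0 ord0); last by lra.
by move=> /andP[? ?]; apply/andP; split; lra.
Qed.

Definition FBump n (s : formula L n) (e r : R) : formula L n :=
  FConn _ (@bump_continuous e r) (fun=> s).

Lemma meet_continuous : continuous (fun v : 'rV[R]_2 =>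
  v ord0 ord0 + v ord0 (lift ord0 ord0)
    - `|v ord0 ord0 - v ord0 (lift ord0 ord0)|).
Proof.
apply: (@lipschitz_connective _ _ _ 4 (ltr0Sn _ 3)) => v w d d0 h.
have := h ord0; have := h (lift ord0 ord0).
have := ler_dist_dist (v ord0 ord0 - v ord0 (lift ord0 ord0))
  (w ord0 ord0 - w ord0 (lift ord0 ord0)).
rewrite !ler_norml => /andP[a1 a2] /andP[? ?] /andP[? ?].
have : `|v ord0 ord0 - v ord0 (lift ord0 ord0) -
  (w ord0 ord0 - w ord0 (lift ord0 ord0))| <= 2 * d.
  by rewrite ler_norml; apply/andP; split; lra.
by move=> ?; apply/andP; split; lra.
Qed.

(** Twice the minimum. *)
Definition FMeet n (s s' : formula L n) : formula L n :=
  FConn _ meet_continuous (vcons s (fun=> s')).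

Lemma type_val_FBump n (t : type_space T n) s e r :
  type_val t (FBump s e r) = e - `|type_val t s - r|.
Proof. by have [M [a <-]] := tp_surj t; rewrite !type_val_tp /= mxE. Qed.

Lemma type_val_FMeet n (t : type_space T n) s s' :
  (0 < type_val t (FMeet s s')) = (0 < type_val t s) && (0 < type_val t s').
Proof.
have [M [a <-]] := tp_surj t; rewrite !type_val_tp /= !mxE vcons0 vconsS.
apply/idP/andP => [h|[? ?]].
  have := ler_norm (feval s a - feval s' a).
  have := ler_norm (feval s' a - feval s a); rewrite distrC.
  by split; lra.
by case: (ger0P (feval s a - feval s' a)) => ?; lra.
Qed.

Lemma const_continuous (r : R) : continuous (fun _ : 'rV[R]_0 => r).
Proof.
apply: (@lipschitz_connective _ _ _ 1 ltr01) => v w d d0 h; rewrite subrr normr0 mul1r.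
exact: d0.
Qed.

Definition FConst n (r : R) : formula L n :=
  FConn _ (const_continuous (r := r)) (fun i : 'I_0 => match notF (ltn_ord i) with end).

Lemma type_val_FConst n (t : type_space T n) r : type_val t (FConst n r) = r.
Proof. by have [M [a <-]] := tp_surj t. Qed.

(** Since bumps and minima are connectives, a finite intersection of subbasic
  open sets contains the positivity set of a single formula. *)
Lemma type_basis n (t : type_space T n) (A : set (type_space T n)) : nbhs t A ->
  exists s, 0 < type_val t s /\ [set t' | 0 < type_val t' s] `<=` A.
Proof.
pose F := filter_from [set s | 0 < type_val t s]
  (fun s => [set t' : type_space T n | 0 < type_val t' s]).
have FF : Filter F.
  apply: filter_from_filter; first by exists (FConst n 1); rewrite /= type_val_FConst.
  move=> s s' /= ts ts'; exists (FMeet s s'); first by rewrite /= type_val_FMeet ts.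
  by move=> t' /=; rewrite type_val_FMeet => /andP.
have Ft : F --> t.
  apply/type_cvgP => s; apply/cvgrPdist_lt => e e0.
  exists (FBump s e (type_val t s)); first by rewrite /= type_val_FBump subrr normr0 subr0.
  by move=> t' /=; rewrite type_val_FBump subr_gt0 distrC.
by move=> /Ft [s ts sA]; exists s.
Qed.

Definition res n (t : type_space T n.+1) : type_space T n := tpr (lift ord0) t.

Lemma res_tp n (M : model T) (a : 'I_n.+1 -> M) : res (tp a) = tp (a \o lift ord0).
Proof. exact: tpr_tp. Qed.

Lemma res_scons n (M : model T) x (a : 'I_n -> M) : res (tp (scons x a)) = tp a.
Proof. by rewrite res_tp sconsE vcons_lift. Qed.

Lemma res_continuous n : continuous (@res n).
Proof. exact: tpr_continuous. Qed.

Lemma type_val_sup_ge n (t : type_space T n.+1) s :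
  type_val t s <= type_val (res t) (FSup s).
Proof.
have [M [a <-]] := tp_surj t; rewrite res_tp !type_val_tp.
have := @FSup_ge _ _ M _ s (a \o lift ord0) (a ord0).
by rewrite sconsE vcons_eta.
Qed.

(** The condition [0 < s] on an extended type becomes the condition [0 < FSup
  s] on its restriction, and a positive supremum is positive at some element.
  *)
Lemma res_realize n (O : set (type_space T n.+1)) (M : model T) (a : 'I_n -> M) :
  open O -> (@res n @` O) (tp a) -> exists x, O (tp (scons x a)).
Proof.
move=> oO [t Ot ta]; have [s [ts sO]] := type_basis (open_nbhs_nbhs (conj oO Ot)).
have := type_val_sup_ge t s; rewrite ta type_val_tp => /(lt_le_trans ts) sa.
have [x hx] := FSup_adherent s a sa; exists x; apply: sO.
by move: hx; rewrite subrr.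
Qed.

(** For the same reason, eliminating a variable by a supremum maps basic open
  sets to open sets. *)
Lemma res_open n (O : set (type_space T n.+1)) : open O -> open (@res n @` O).
Proof.
move=> oO; rewrite openE => _ [t Ot <-].
have [s [ts sO]] := type_basis (open_nbhs_nbhs (conj oO Ot)).
have := type_val_sup_ge t s => /(lt_le_trans ts) st.
have : \forall u \near res t, 0 < type_val u (FSup s).
  by apply: (cvgr_gt _ (@type_val_continuous _ _ T _ (FSup s) (res t))).
rewrite /interior; apply: filterS => u.
have [M [a <-]] := tp_surj u; rewrite type_val_tp => sa.
have [x hx] := FSup_adherent s a sa; exists (tp (scons x a)).
  by apply: sO; move: hx; rewrite subrr.
exact: res_scons.
Qed.

Lemma realize_open k n (t : type_space T (k + n)) (O : set (type_space T (k + n)))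
    (M : model T) (a : 'I_n -> M) : open O -> O t -> tpr (@rshift k n) t = tp a ->
  exists2 c : 'I_(k + n) -> M, c \o @rshift k n = a & O (tp c).
Proof.
elim: k => [|k IH] in t O *.
  move=> oO Ot ta; exists a; first by apply/funext => i /=; congr a; apply/val_inj.
  rewrite -ta (_ : tpr _ t = t)//; have [N [b <-]] := tp_surj t.
  by rewrite tpr_tp; congr tp; apply/funext => i /=; congr b; apply/val_inj.
move=> oO Ot ta.
have rS : @rshift k.+1 n = lift ord0 \o @rshift k n.
  by apply/funext => i; apply/val_inj.
have [||c ca Oc] := IH (res (t : type_space T (k + n).+1)) _ (res_open oO).
- by exists t.
- by rewrite /res tpr_comp -rS.
have [x Ox] := res_realize oO Oc; exists (scons x c) => //.
by rewrite rS compA sconsE vcons_lift.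
Qed.

Lemma complete_tp0 (t u : type_space T 0) : complete_theory T -> t = u.
Proof.
case=> _ h; have [M [a <-]] := tp_surj t; have [N [b <-]] := tp_surj u.
by apply: type_val_inj => s; apply: h.
Qed.

End Realization.

(** * A countable dense set of formulas *)

Section Countability.

Lemma countable_union T (A B : set T) :
  countable A -> countable B -> countable (A `|` B).
Proof.
move=> cA cB; pose F b := if b then A else B.
have -> : A `|` B = \bigcup_(b in [set: bool]) F b.
  apply/seteqP; split=> [x [?|?]|x [[] _ ?]];
    by [exists true|exists false|left|right].
by apply: bigcup_countable => // -[].
Qed.

Lemma countable_image T U (f : T -> U) (A : set T) :
  countable A -> countable (f @` A).
Proof. exact/sub_countable/card_image_le. Qed.

Lemma countable_subset T (A B : set T) : A `<=` B -> countable B -> countable A.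
Proof. by move=> AB; apply/sub_countable/subset_card_le. Qed.

Lemma countable_fun T k (A : set T) : countable A ->
  countable [set f : 'I_k -> T | forall i, A (f i)].
Proof.
move=> /countable_injP [g ginj].
have [->|/set0P [f0 Af0]] := eqVneq [set f : 'I_k -> T | forall i, A (f i)] set0.
  exact: countable0.
apply/countable_injP.
exists (fun f => pickle [ffun i => g (f i)]) => f f' /set_mem Af /set_mem Af'.
move=> /(pcan_inj pickleK) /ffunP ff'; apply/funext => i.
by apply: ginj; [exact/mem_set|exact/mem_set|have := ff' i; rewrite !ffunE].
Qed.

End Countability.

Section DenseConnectives.
Context {R : realType}.

Definition sup_dist k (v : 'rV[R]_k) (q : {ffun 'I_k -> rat}) : R :=
  \big[Num.max/0]_i `|v ord0 i - ratr (q i)|.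

Lemma sup_dist_ge0 k (v : 'rV[R]_k) q : 0 <= sup_dist v q.
Proof. exact: bigmax_ge_id. Qed.

Lemma sup_dist_lt k (v : 'rV[R]_k) (q : {ffun 'I_k -> rat}) (d : R) : 0 < d ->
  (forall i, `|v ord0 i - ratr (q i)| < d) -> sup_dist v q < d.
Proof. by move=> d0 h; apply: bigmax_lt. Qed.

Lemma sup_dist_ge k (v : 'rV[R]_k) (q : {ffun 'I_k -> rat}) i :
  `|v ord0 i - ratr (q i)| <= sup_dist v q.
Proof. exact: (le_bigmax _ (fun i => `|v ord0 i - ratr (q i)|)). Qed.

Lemma sup_dist_lip k (v w : 'rV[R]_k) (q : {ffun 'I_k -> rat}) (d : R) : 0 <= d ->
  (forall i, `|v ord0 i - w ord0 i| <= d) -> sup_dist v q <= sup_dist w q + d.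
Proof.
move=> d0 h; apply: bigmax_le; first by rewrite addr_ge0// sup_dist_ge0.
move=> i _; have := sup_dist_ge w q i; have := h i.
have := ler_distD (w ord0 i) (v ord0 i) (ratr (q i)); lra.
Qed.

(** A countable family of functions that is dense for uniform convergence on
  every box: maxima of finitely many downward cones of a common slope [N], with
  rational apexes. *)
Definition cone_code k := (seq ({ffun 'I_k -> rat} * rat) * nat)%type.

Definition cones k (c : cone_code k) (v : 'rV[R]_k) : R :=
  foldr (fun qr y => Num.max (ratr qr.2 - c.2%:R * sup_dist v qr.1) y)
    (- c.2%:R) c.1.

Lemma cones_continuous k (c : cone_code k) : continuous (cones c).
Proof.
case: c => l N; apply: (@lipschitz_connective _ _ _ (N%:R + 1)).
  by have := ler0n R N; lra.
move=> v w d d0 h.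
have N0 : 0 <= N%:R :> R by rewrite ler0n.
have half (v' w' : 'rV[R]_k) : (forall i, `|v' ord0 i - w' ord0 i| <= d) ->
    cones (l, N) v' <= cones (l, N) w' + (N%:R + 1) * d.
  move=> h'; have c0 : 0 <= (N%:R + 1) * d by rewrite mulr_ge0// addr_ge0.
  rewrite /cones /=; elim: l => [|[q r] l IH] /=; first by rewrite lerDl.
  rewrite ge_max; apply/andP; split; last first.
    by apply: le_trans IH _; rewrite lerD2r le_max lexx orbT.
  apply: (@le_trans _ _ (ratr r - N%:R * sup_dist w' q + (N%:R + 1) * d)).
    have := @sup_dist_lip _ w' v' q d d0.
    move=> /(_ (fun i => ltac:(by rewrite distrC; exact: h'))).
    by move=> /(ler_wpM2l N0); rewrite mulrDr mulrDl mul1r; lra.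
  by rewrite lerD2r le_max lexx.
rewrite ler_distl; apply/andP; split.
  by rewrite lerBlDr; apply: half => i; rewrite distrC; exact: h.
by apply: half => i; exact: h.
Qed.

Lemma rat_approx (x e : R) : 0 < e -> exists q : rat, `|x - ratr q| < e.
Proof.
move=> e0; have [|q] := @rat_in_itvoo R (x - e) (x + e); first by lra.
by rewrite in_itv /= => hq; exists q; rewrite ltr_distlC.
Qed.

Lemma cones_le k (l : seq ({ffun 'I_k -> rat} * rat)) N v (y : R) :
  - N%:R <= y -> (forall q r, (q, r) \in l -> ratr r - N%:R * sup_dist v q <= y) ->
  cones (l, N) v <= y.
Proof.
rewrite /cones /= => Ny; elim: l => [|[q r] l IH] //= h.
rewrite ge_max h ?mem_head//=; apply: IH => q' r' h'; apply: h.
by rewrite in_cons h' orbT.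
Qed.

Lemma cones_ge k (l : seq ({ffun 'I_k -> rat} * rat)) N v q r :
  (q, r) \in l -> ratr r - N%:R * sup_dist v q <= cones (l, N) v.
Proof.
rewrite /cones /=; elim: l => [|[q' r'] l IH] //=.
rewrite in_cons => /orP[/eqP [<- <-]|/IH h]; first by rewrite le_max lexx.
by rewrite le_max h orbT.
Qed.

(** A cone whose apex is on the graph of [u] approximates [u] near its apex.
  The slope [N] is so large that the cone drops below the values of [u] before
  leaving the ball where [u] varies by less than [e / 4]; so finitely many
  cones, with apexes on a fine net, have a maximum close to [u]. *)
Lemma cones_dense k (u : 'rV[R]_k -> R) (B e : R) : continuous u -> 0 < e ->
  exists c, forall v, box B v -> `|u v - cones c v| <= e.
Proof.
move=> cu e0; have e40 : 0 < e / 4 by rewrite divr_gt0.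
have [C hC] : exists C : R, forall v, box B v -> `|u v| <= C.
  exact: box_bounded cu B.
have [d d0 hd] := box_unif_continuous cu B e40.
have [N hN] : exists N : nat, `|C| + (2 * `|C| + e) / (d / 2) + 1 <= N%:R.
  exists (Num.bound (`|C| + (2 * `|C| + e) / (d / 2) + 1)).
  apply/ltW/archi_boundP; rewrite addr_ge0// addr_ge0// divr_ge0//.
    by rewrite addr_ge0// ?mulr_ge0// ltW.
  by rewrite ltW// divr_gt0.
have C0 := normr_ge0 C.
have q0 : 0 <= (2 * `|C| + e) / (d / 2).
  by rewrite divr_ge0// ?addr_ge0// ?mulr_ge0// ltW// divr_gt0.
have N1 : 1 <= N%:R :> R by lra.
have NC : `|C| <= N%:R by lra.
have Nd : 2 * `|C| + e <= N%:R * (d / 2).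
  by rewrite -ler_pdivrMr ?divr_gt0//; lra.
have N0 : 0 < N%:R :> R by lra.
pose eta := Num.min (d / 4) (e / 8 / N%:R).
have eta0 : 0 < eta by rewrite lt_min !divr_gt0.
have eta1 : eta <= d / 4 by rewrite ge_min lexx.
have eta2 : N%:R * eta <= e / 8.
  by rewrite mulrC -ler_pdivlMr// ge_min lexx orbT.
have /choice [q hq] : forall x : 'rV[R]_k, exists q : {ffun 'I_k -> rat},
    forall i, `|x ord0 i - ratr (q i)| < eta.
  move=> x; have /choice [q hq] := fun i => rat_approx (x ord0 i) eta0.
  by exists [ffun i => q i] => i; rewrite ffunE.
have /choice [r hr] := fun x : 'rV[R]_k => rat_approx (u x) e40.
have := @box_compact R k B; rewrite compact_cover.
move=> /(_ _ (@box _ k B) (fun x => (ball x eta)°)) [].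
- by move=> x _; apply: open_interior.
- by move=> x bx; exists x => //; apply: nbhsx_ballx.
move=> D Dbox cov; exists ([seq (q x, r x) | x <- finmap.enum_fset D], N).
(* The rational apex is within [eta] of [x], and [v] too. *)
have near_cone (x v : 'rV[R]_k) : box B x -> ball x eta v -> sup_dist v (q x) < 2 * eta.
  move=> _ [_ xv]; apply: sup_dist_lt => [|i]; first by rewrite mulr_gt0.
  have := hq x i; have := xv ord0 i; rewrite /ball /=.
  have := ler_distD (x ord0 i) (v ord0 i) (ratr (q x i)).
  by rewrite (distrC (v ord0 i) (x ord0 i)); lra.
move=> v bv; rewrite ler_distl; apply/andP; split; last first.
- have [x xD /interior_subset vx] := cov v bv.
  have bx : box B x by have := Dbox x xD; rewrite inE.
  have vx' := near_cone _ _ bx vx.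
  have : `|u x - u v| < e / 4.
    apply: hd => // i; have [_ /(_ ord0 i)] := vx; rewrite /ball /=; lra.
  have := @cones_ge _ [seq (q x, r x) | x <- finmap.enum_fset D] N v (q x) (r x).
  move=> /(_ (map_f (fun x => (q x, r x)) xD)).
  have : N%:R * sup_dist v (q x) <= N%:R * (2 * eta) by rewrite ler_pM2l// ltW.
  have := hr x; rewrite !ltr_norml => /andP[? ?] ? ? /andP[? ?]; lra.
- rewrite lerBlDr; apply: cones_le.
    by have := hC _ bv; rewrite ler_norml => /andP[? ?]; have := ler_norm C; lra.
  move=> q' r' /mapP [x xD [-> ->]].
  have bx : box B x by have := Dbox x xD; rewrite inE.
  have := hr x; have := hC _ bx; have := hC _ bv; have := ler_norm C.
  rewrite !ler_norml ltr_norml => ? /andP[? ?] /andP[? ?] /andP[? ?].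
  have s0 := sup_dist_ge0 v (q x).
  have [vq|vq] := ltP (sup_dist v (q x)) (d / 2).
    have : `|u x - u v| < e / 4.
      apply: hd => // i; have := sup_dist_ge v (q x) i; have := hq x i.
      have := ler_distD (ratr (q x i)) (x ord0 i) (v ord0 i).
      by rewrite (distrC (ratr _)); lra.
    have : 0 <= N%:R * sup_dist v (q x) by rewrite mulr_ge0// ltW.
    by rewrite ltr_norml => ? /andP[? ?]; lra.
  have : N%:R * (d / 2) <= N%:R * sup_dist v (q x) by rewrite ler_pM2l.
  by lra.
Qed.

End DenseConnectives.

Section DenseFormulas.
Context {R : realType} (L : language R).

Fixpoint dense_terms n d : set (term L n) :=
  match d with
  | 0%N => range Var
  | d.+1 => @dense_terms n d `|`
      \bigcup_(f in [set: fun_sym L])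
        (App f @` [set ts | forall i, @dense_terms n d (ts i)])
  end.

Fixpoint dense_formulas d n : set (formula L n) :=
  match d with
  | 0%N => (fun tt' => FDist tt'.1 tt'.2) @` [set: term L n * term L n] `|`
      \bigcup_(P in [set: pred_sym L])
        (FPred P @` [set: 'I_(pred_arity P) -> term L n])
  | d.+1 => @dense_formulas d n `|`
      (\bigcup_(k in [set: nat]) \bigcup_(c in [set: cone_code k])
        (FConn (cones c) (@cones_continuous R k c) @`
          [set ss | forall i, @dense_formulas d n (ss i)]) `|`
      (@FSup R L n @` @dense_formulas d n.+1 `|`
       @FInf R L n @` @dense_formulas d n.+1))
  end.

Arguments dense_terms : clear implicits.
Arguments dense_formulas : clear implicits.

Lemma dense_terms_mono n d d' : (d <= d')%N ->
  dense_terms n d `<=` dense_terms n d'.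
Proof.
elim: d' => [|d' IH]; first by rewrite leqn0 => /eqP ->.
by rewrite leq_eqVlt => /orP[/eqP -> //|/IH h] t /h; left.
Qed.

Lemma dense_formulas_mono n d d' : (d <= d')%N ->
  dense_formulas d n `<=` dense_formulas d' n.
Proof.
elim: d' => [|d' IH]; first by rewrite leqn0 => /eqP ->.
by rewrite leq_eqVlt => /orP[/eqP -> //|/IH h] t /h; left.
Qed.

Hypothesis Lc : countable_language L.

Lemma countable_term n : countable [set: term L n].
Proof.
have -> : [set: term L n] = \bigcup_(d in [set: nat]) dense_terms n d.
  apply/seteqP; split=> // t _; elim: t => [i|f ts IH].
    by exists 0%N => //; exists i.
  have /choice [d hd] : forall i, exists d, dense_terms n d (ts i).
    by move=> i; have [d _ ?] := IH i; exists d.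
  exists (\max_i d i).+1 => //; right; exists f => //; exists ts => // i.
  exact: (dense_terms_mono (leq_bigmax i)) (hd i).
apply: bigcup_countable => [|d _]; first exact: countableP.
elim: d => [|d IH] /=; first exact/countable_image/countableP.
apply: countable_union => //; apply: bigcup_countable => [|f _]; first exact: Lc.1.
exact/countable_image/countable_fun.
Qed.

Lemma countable_dense_formulas n : countable (\bigcup_d dense_formulas d n).
Proof.
apply: bigcup_countable => [|d _]; first exact: countableP.
elim: d n => [|d IH] n /=.
  apply: countable_union.
    apply: countable_image; rewrite -setXTT.
    by apply: countableX; exact: countable_term.
  apply: bigcup_countable => [|P _]; first exact: Lc.2.
  apply: countable_image; rewrite (_ : setT = [set ts | forall i, setT (ts i)]).
    exact/countable_fun/countable_term.
  by apply/seteqP; split.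
apply: countable_union => //; apply: countable_union.
  apply: bigcup_countable => [|k _]; first exact: countableP.
  apply: bigcup_countable => [|c _]; first exact: countableP.
  exact/countable_image/countable_fun.
by apply: countable_union; apply: countable_image.
Qed.

(** By induction on the formula, replacing every connective by a maximum of
  cones close to it on the box of the values. *)
Lemma dense_formulasP n (s : formula L n) (e : R) : 0 < e ->
  exists2 g, (\bigcup_d dense_formulas d n) g &
    forall (M : structure L) (a : 'I_n -> M), `|feval s a - feval g a| <= e.
Proof.
elim: n / s e => [n t1 t2|n P ts|n k u cu ss IH|n s IH|n s IH] e e0.
- exists (FDist t1 t2); last by move=> M a; rewrite subrr normr0 ltW.
  by exists 0%N => //; left; exists (t1, t2).
- exists (FPred P ts); last by move=> M a; rewrite subrr normr0 ltW.
  by exists 0%N => //; right; exists P => //; exists ts.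
- have /choice [B hB] := fun i => feval_bounded (ss i).
  pose B' := \big[Num.max/0]_i B i + 1.
  have e20 : 0 < e / 2 by rewrite divr_gt0.
  have [d d0 hd] := box_unif_continuous cu B' e20.
  have [c hc] := cones_dense B' cu e20.
  pose d' := Num.min 1 (d / 2).
  have d'0 : 0 < d' by rewrite lt_min ltr01 divr_gt0.
  have d'1 : d' <= 1 by rewrite ge_min lexx.
  have d'd : d' <= d / 2 by rewrite ge_min lexx orbT.
  have /choice [g hg] : forall i, exists g, (\bigcup_d dense_formulas d n) g /\
      forall (M : structure L) (a : 'I_n -> M), `|feval (ss i) a - feval g a| <= d'.
    by move=> i; have [g ? ?] := IH i _ d'0; exists g.
  have /choice [D hD] : forall i, exists d, dense_formulas d n (g i).
    by move=> i; have [[D _ ?] _] := hg i; exists D.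
  exists (FConn (cones c) (@cones_continuous R k c) g).
    exists (\max_i D i).+1 => //; right; left; exists k => //; exists c => //.
    exists g => // i.
    exact: (dense_formulas_mono (leq_bigmax i)) (hD i).
  move=> M a /=.
  have b1 i : `|feval (ss i) a| <= \big[Num.max/0]_i B i.
    by apply: le_trans (hB i M a) _; exact: le_bigmax.
  have h1 : box B' (\row_i feval (ss i) a).
    by move=> i; rewrite mxE /B'; have := b1 i; lra.
  have h2 : box B' (\row_i feval (g i) a).
    move=> i; rewrite mxE /B'; have := b1 i; have := (hg i).2 M a.
    have := ler_norm (feval (ss i) a - feval (g i) a).
    rewrite !ler_norml => _ /andP[? ?] /andP[? ?]; apply/andP; split; lra.
  have h3 : `|u (\row_i feval (ss i) a) - u (\row_i feval (g i) a)| < e / 2.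
    by apply: hd => // i; rewrite !mxE; have := (hg i).2 M a; lra.
  have := hc _ h2.
  have := ler_distD (u (\row_i feval (g i) a)) (u (\row_i feval (ss i) a))
    (cones c (\row_i feval (g i) a)).
  lra.
- have [g [d _ gd] hg] := IH e e0; exists (FSup g).
    by exists d.+1 => //; right; right; left; exists g.
  move=> M a; apply: quantifier_dist => x; exists x;
    by have := hg M (scons x a); rewrite ler_norml => /andP[? ?]; lra.
- have [g [d _ gd] hg] := IH e e0; exists (FInf g).
    by exists d.+1 => //; right; right; right; exists g.
  move=> M a; apply: quantifier_distI => x; exists x;
    by have := hg M (scons x a); rewrite ler_norml => /andP[? ?]; lra.
Qed.

End DenseFormulas.

(** * Henkin sequences *)

Section Recent.
Context {A : Type}.

(** The first [m] terms of a sequence, the last one first: a quantifier binds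
  the variable of index 0, so a tuple grows at its front. *)
Definition recent m (a : nat -> A) : 'I_m -> A := fun i => a (m - i.+1)%N.

Lemma recentS m (a : nat -> A) : recent a = vcons (a m) (@recent m a).
Proof.
rewrite -[LHS]vcons_eta; by congr vcons; rewrite /recent subn1.
Qed.

Definition seq_of m (b : 'I_m -> A) (x : A) (k : nat) : A :=
  if (k < m)%N then oapp b x (insub (m - k.+1)%N) else x.

Lemma recent_seq_of m (b : 'I_m -> A) x : recent (seq_of b x) = b.
Proof.
apply/funext => i; rewrite /recent /seq_of.
have im := ltn_ord i.
rewrite (_ : (m - i.+1 < m)%N); last by rewrite ltn_subrL (leq_ltn_trans _ im).
rewrite (_ : (m - (m - i.+1).+1)%N = i); last by rewrite -subSn// subSS subKn// ltnW.
by rewrite insubT /=; congr b; apply/val_inj.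
Qed.

Lemma seq_of_last m (b : 'I_m -> A) x : seq_of b x m = x.
Proof. by rewrite /seq_of ltnn. Qed.

Lemma recentS_seq_of m (b : 'I_m -> A) x : recent (seq_of b x) = vcons x b.
Proof. by rewrite recentS seq_of_last recent_seq_of. Qed.

Lemma seq_of_lt m (b : 'I_m -> A) x y k : (k < m)%N -> seq_of b x k = seq_of b y k.
Proof.
move=> km; rewrite /seq_of km insubT /=; last by [].
by rewrite ltn_subrL (leq_ltn_trans _ km).
Qed.

Definition place m k : 'I_m.+1 := inord (m - k).

Lemma recent_place m k (a : nat -> A) : (k <= m)%N -> recent a (place m k) = a k.
Proof.
by move=> km; rewrite /recent /place inordK ?ltnS ?leq_subr// subSS subKn.
Qed.

Lemma recent_comp_place j m (v : 'I_j -> nat) (a : nat -> A) :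
  (forall i, (v i <= m)%N) -> recent a \o (place m \o v) = a \o v.
Proof. by move=> vm; apply/funext => i; apply: recent_place. Qed.

Lemma recent_lshift k n (a : nat -> A) :
  @recent (k + n) a \o @lshift k n = @recent k (a \o addn n).
Proof.
apply/funext => j; rewrite /recent /=; congr a.
by rewrite addnC addnBA.
Qed.

Lemma recent_rshift k n (a : nat -> A) :
  @recent (k + n) a \o @rshift k n = @recent n a.
Proof. by apply/funext => j; rewrite /recent /= -addnS subnDl. Qed.

End Recent.

(** Countably many demands are scheduled by [logn 2], so that each of them comes
  up infinitely often. *)
Lemma frequent_index (i K : nat) : exists2 k, (K <= k)%N & logn 2 k = i.
Proof.
exists (2 ^ i * 3 ^ K)%N; last first.
  by rewrite lognM ?expn_gt0// pfactorK// lognX logn_prime// muln0 addn0.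
by rewrite (leq_trans _ (leq_pmull _ _)) ?expn_gt0//; apply/ltnW/ltn_expl.
Qed.

Definition dist01 {R : realType} {L : language R} : formula L 2 :=
  FDist (Var ord0) (Var (lift ord0 ord0)).

Section HenkinSequence.
Context {R : realType} {L : language R} {T : theory L}.

Lemma res_recent m (M : model T) (a : nat -> M) :
  res (tp (@recent _ m.+1 a)) = tp (@recent _ m a).
Proof. by rewrite res_tp recentS vcons_lift. Qed.

(** The demand for a witness that a supremum is approximately attained. *)
Record task := Task {
  task_arity : nat;
  task_formula : formula L task_arity.+1;
  task_params : 'I_task_arity -> nat;
  task_error : nat
}.

(** The parameters of the witness have been constructed. *)
Definition task_ready (w : task) m := forall i, (task_params (t := w) i < m)%N.

Definition fulfils m (t : type_space T m.+1) (w : task) :=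
  let v := place m \o task_params (t := w) in
  type_val t (rename (FSup (task_formula w)) v) - (task_error w).+1%:R^-1 <
  type_val t (rename (task_formula w) (vcons ord0 v)).

Lemma fulfils_recent m (M : model T) (a : nat -> M) w : task_ready w m ->
  fulfils (tp (@recent _ m.+1 a)) w ->
  feval (FSup (task_formula w)) (a \o task_params (t := w))
    - (task_error w).+1%:R^-1 <
  feval (task_formula w) (a \o vcons m (task_params (t := w))).
Proof.
move=> wm; rewrite /fulfils !type_val_tp !feval_rename.
rewrite recent_comp_place; last by move=> i; apply/ltnW/wm.
rewrite !comp_vcons (_ : recent a ord0 = a m); last by rewrite /recent subn1.
by rewrite recent_comp_place// => i; apply/ltnW/wm.
Qed.

Lemma fulfils_open m w : open [set t : type_space T m.+1 | fulfils t w].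
Proof.
rewrite /fulfils; set f := rename _ _; set g := rename _ _; set e := _^-1.
rewrite (_ : mkset _ = (fun t : type_space T m.+1 => type_val t g - type_val t f + e) @^-1`
    [set x | 0 < x]); last first.
  by apply/seteqP; split=> t /=; lra.
apply: open_comp; last exact: open_gt.
move=> t _; have hf := @type_val_continuous _ _ T _ f t.
have hg := @type_val_continuous _ _ T _ g t.
exact: (cvgD (cvgB hg hf) (cvg_cst e)).
Qed.

Lemma fulfils_extend m (t : type_space T m) w : task_ready w m ->
  exists2 u, res u = t & fulfils u w.
Proof.
move=> wm; have [M [b <-]] := tp_surj t; have [x0] := inhab M.
have [x hx] := FSup_adherent (task_formula w) (seq_of b x0 \o task_params (t := w))
  (inv_succ_gt0 (task_error w)).
exists (tp (scons x b)); first exact: res_scons.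
rewrite sconsE -recentS_seq_of /fulfils !type_val_tp !feval_rename.
rewrite recent_comp_place; last by move=> i; apply/ltnW/wm.
rewrite !comp_vcons (_ : recent _ ord0 = x); last first.
  by rewrite recentS_seq_of vcons0.
rewrite recent_comp_place; last by move=> i; apply/ltnW/wm.
rewrite (_ : seq_of b x \o _ = seq_of b x0 \o task_params (t := w)) //.
by apply/funext => i; apply: seq_of_lt.
Qed.

Definition dense_task (w : task) :=
  (\bigcup_d @dense_formulas R L d (task_arity w).+1) (task_formula w).

Lemma task_enumeration : countable_language L -> exists E : nat -> option task,
  forall w, dense_task w -> forall K, exists2 k, (K <= k)%N & E k = Some w.
Proof.
move=> Lc; have cT : countable [set w | dense_task w].
  pose C := \bigcup_(j in [set: nat])
    ((fun x => @Task j x.1.1 x.1.2 x.2) @`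
      ((\bigcup_d @dense_formulas R L d j.+1) `*` [set: 'I_j -> nat] `*` [set: nat])).
  apply: (@countable_subset _ _ C).
    move=> [j g v l] dg; exists j => //; exists (g, v, l) => //.
  apply: bigcup_countable => [|j _]; first exact: countableP.
  apply: countable_image; apply: countableX; last exact: countableP.
  apply: countableX; first exact: countable_dense_formulas.
  rewrite (_ : setT = [set v : 'I_j -> nat | forall i, setT (v i)]).
    exact/countable_fun/countableP.
  by apply/seteqP; split.
have /countable_injP [f finj] := cT.
exists (fun k => if pselect (exists w, dense_task w /\ f w = logn 2 k) is left h
  then Some (projT1 (cid h)) else None).
move=> w dw K; have [k Kk kE] := frequent_index (f w) K; exists k => //.
rewrite kE.
case: pselect => [h|[]]; last by exists w.
congr Some; case: cid => w' [dw' fw'] /=; apply: finj; try exact/mem_set.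
by [].
Qed.

(** Meeting the demands of a dense set of formulas suffices, by uniform
  approximation. The witnesses have index at least [K] so that the terms from
  the [K]-th one on are already dense: the infimum of the distances to a given
  term is 0, and a witness of this infimum is close to that term. *)
Lemma henkin_sequence (U : set_system nat) (K : nat) (M : nat -> model T)
    (alpha : forall k, nat -> M k) : UltraFilter U -> \oo `<=` U ->
  (forall w, dense_task w -> exists2 v, (K <= v)%N & \forall k \near \oo,
    feval (FSup (task_formula w)) (alpha k \o task_params (t := w))
      - (task_error w).+1%:R^-1 <=
    feval (task_formula w) (alpha k \o vcons v (task_params (t := w)))) ->
  exists (N : model T) (e : nat -> N), dense_map (e \o addn K) /\
    forall n (s : formula L n) (v : 'I_n -> nat),
      feval s (alpha k \o v) @[k --> U] --> feval s (e \o v).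
Proof.
move=> UU ooU ok.
pose P n (s : formula L n) (v : 'I_n -> nat) : R :=
  lim (feval s (alpha k \o v) @[k --> U]).
have P_lim n (s : formula L n) v : feval s (alpha k \o v) @[k --> U] --> P n s v.
  by have [B hB] := feval_bounded s; apply: ultra_cvg => t; apply: hB.
suff P_henkin n (s : formula L n.+1) v (e : R) : 0 < e ->
    exists2 x, (K <= x)%N & P n (FSup s) v - e <= P n.+1 s (vcons x v).
  have henkin n (s : formula L n.+1) v (e : R) : 0 < e ->
      exists x, P n (FSup s) v - e <= P n.+1 s (vcons x v).
    by move=> /(P_henkin n s v) [x _]; exists x.
  have [N [f [fd fP]]] := henkin_model P_lim henkin.
  exists N, f; split=> [y e e0|n s v]; last by rewrite fP.
  have e20 : 0 < e / 2 by rewrite divr_gt0.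
  have [i hi] := fd y _ e20.
  (* A term of index at least [K] close to [f i] witnesses an infimum. *)
  have [x Kx] := P_henkin _ (FNeg dist01) (fun _ : 'I_1 => i) _ e20.
  rewrite -!fP feval_FNeg comp_vcons => hx; exists (x - K)%N.
  rewrite /= subnKC//; apply: le_lt_trans (metric_triangle _ (f i) _) _.
  have := @FSup_ge _ _ N _ (FNeg dist01) (f \o (fun _ : 'I_1 => i)) (f i).
  move: hx; rewrite feval_FNeg sconsE /= !vcons0 !vconsS /= mdistxx.
  by rewrite (metric_sym (f x)) => ? ?; lra.
move=> e0; have e40 : 0 < e / 4 by rewrite divr_gt0.
have [g dg hg] := dense_formulasP s e40; have [l hl] := exists_inv_succ e40.
have [x Kx hx] := ok (Task g v l) dg; exists x => //.
have hU : U [set k | feval (FSup s) (alpha k \o v) - e <=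
    feval s (alpha k \o vcons x v)].
  have hx' : \forall k \near \oo, feval (FSup g) (alpha k \o v) - l.+1%:R^-1 <=
      feval g (alpha k \o vcons x v) by exact: hx.
  apply: filterS (ooU _ hx') => k h.
  suff : feval (FSup s) (alpha k \o v) - e <= feval s (alpha k \o vcons x v) by [].
  move: h.
  have := hg _ (alpha k \o vcons x v); rewrite ler_norml => /andP[? ?].
  have : `|feval (FSup s) (alpha k \o v) - feval (FSup g) (alpha k \o v)| <= e / 4.
    by apply: quantifier_dist => y; exists y;
      have := hg _ (scons y (alpha k \o v)); rewrite ler_norml => /andP[? ?]; lra.
  by rewrite ler_norml => /andP[? ?]; move: (_.+1%:R^-1) hl => r hl ?; lra.
rewrite lerBlDr -subr_ge0.
have hc : feval s (alpha k \o vcons x v) + e - feval (FSup s) (alpha k \o v)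
    @[k --> U] --> P n.+1 s (vcons x v) + e - P n (FSup s) v.
  by apply: cvgB; [apply: cvgD; [exact: P_lim|exact: cvg_cst]|exact: P_lim].
by apply: (cvgr_to_ge hc); apply: filterS hU => k /=; lra.
Qed.

End HenkinSequence.

Arguments task {R} L.

(** * Perturbations and dense sequences *)

Section DensePerturbation.
Context {R : realType} {L : language R} {T : theory L}.
Implicit Type rho : type_rel T.

Lemma compact_pairs m n : compact [set: type_space T m * type_space T n].
Proof.
by rewrite -setXTT; apply: compact_setX; exact: type_space_compact.
Qed.

Lemma radius_tpr rho : pert_radius rho -> forall m n (tau : 'I_m -> 'I_n) t u,
  rho n (t, u) -> rho m (tpr tau t, tpr tau u).
Proof.
move=> [_ rr] m n tau t u /rr [M [N [f [a [pf <- <-]]]]].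
by have [_ ->] := pf m (a \o tau); rewrite !tpr_tp.
Qed.

(** A pair at distance 0 is mapped by a perturbation to a pair at distance 0;
  the radius being closed in a compact space, small distances are mapped to
  small distances, uniformly. *)
Lemma radius_uc rho (e : R) : pert_radius rho -> 0 < e ->
  exists2 d : R, 0 < d & forall t u, rho 2 (t, u) -> type_val t dist01 < d ->
    type_val u dist01 < e.
Proof.
move=> [prho rr] e0.
pose K := rho 2 `&` [set tu | e <= type_val tu.2 dist01].
have Kc : compact K.
  apply: (subclosed_compact _ (@compact_pairs 2 2)) => //.
  apply: closedI; first exact: (prho 2).1.
  apply: (@closed_comp _ _ (fun tu : type_space T 2 * type_space T 2 =>
    type_val tu.2 dist01) [set x | e <= x]); last exact: closed_ge.
  move=> tu _; apply: (@continuous_comp _ _ _ snd (fun u => type_val u dist01)).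
    exact: cvg_snd.
  exact: type_val_continuous.
have /compact_near_coveringP := Kc.
move=> /(_ _ (0^'+) (fun d tu => d <= type_val tu.1 dist01)) [].
- move=> [t u] [/rr [M [N [f [a [_ <- <-]]]]] /=].
  move=> eu.
  have a0 : 0 < mdist (a ord0) (a (lift ord0 ord0)).
    rewrite mdist_gt0; apply/eqP => aE; move: eu.
    by rewrite /= aE mdistxx leNgt e0.
  set r := mdist (a ord0) (a (lift ord0 ord0)) in a0 *.
  have r20 : 0 < r / 2 by rewrite divr_gt0.
  exists ([set tu | r / 2 < type_val tu.1 dist01], [set d | 0 < d < r / 2]).
    split=> /=.
    + apply: (@open_nbhs_nbhs _ _ [set tu | r / 2 < type_val tu.1 dist01]); split=> /=.
        apply: (@open_comp _ _ (fun tu : type_space T 2 * type_space T 2 =>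
          type_val tu.1 dist01) [set x | r / 2 < x]); last exact: open_gt.
        move=> tu _.
        apply: (@continuous_comp _ _ _ fst (fun u => type_val u dist01)).
          exact: cvg_fst.
        exact: type_val_continuous.
      by rewrite -/r; lra.
    + near=> d; apply/andP; split; first by [].
      by near: d; apply: nbhs_right_lt.
  by move=> [tu d] /= [h /andP[_ dr]]; apply/ltW/(lt_trans dr).
- move=> d /= d0 hd; exists (d / 2); first by rewrite divr_gt0.
  move=> t u tu td; rewrite ltNge; apply/negP => eu.
  have hK : K `<=` (fun tu => d / 2 <= type_val tu.1 dist01).
    apply: (hd (d / 2)) => /=; last by rewrite divr_gt0.
    by rewrite sub0r normrN gtr0_norm ?divr_gt0//; lra.
  by have := hK (t, u) (conj tu eu); rewrite /= leNgt td.
Unshelve. all: by end_near.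
Qed.

Context {M N : model T} {V : Type} {f : V -> M} {g : V -> N}.

(** The closure of the graph of the correspondence of [f v] with [g v]. *)
Definition joined (x : M) (y : N) :=
  forall e : R, 0 < e -> exists v, mdist x (f v) < e /\ mdist y (g v) < e.

Definition modulus_of := forall e : R, 0 < e -> exists2 d : R, 0 < d &
  forall v w, mdist (f v) (f w) < d -> mdist (g v) (g w) < e.

Lemma related_modulus rho : pert_radius rho ->
  (forall m (v : 'I_m -> V), rho m (tp (f \o v), tp (g \o v))) -> modulus_of.
Proof.
move=> rr fg e e0; have [d d0 hd] := radius_uc rr e0; exists d => // v w vw.
have := hd _ _ (fg 2 (vcons v (vcons w (fun i : 'I_0 => v)))).
by rewrite !type_val_tp /= !vcons0 !vconsS !vcons0; apply.
Qed.

Lemma joined_exists : dense_map f -> modulus_of -> forall x, exists y, joined x y.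
Proof.
move=> fd fg x; pose F := near_pts f (fun _ : 'I_1 => x).
have PF : ProperFilter F := near_pts_filter _ fd.
have [y Fy] : exists y : N, g (v ord0) @[v --> F] --> y.
  apply: carrier_complete; apply/cauchyP => e e0; have [d d0 hd] := fg e e0.
  have d20 : 0 < d / 2 by rewrite divr_gt0.
  have [v hv] := filter_ex (near_ptsP f (fun _ : 'I_1 => x) d20).
  exists (g (v ord0)).
  suff : F [set w | ball (g (v ord0)) e (g (w ord0))] by [].
  apply: filterS (near_ptsP f (fun _ : 'I_1 => x) d20) => w hw.
  rewrite ballEmdist /=; apply: hd; rewrite (splitr d).
  apply: le_lt_trans (metric_triangle _ x _) _.
  by rewrite metric_sym; apply: ltrD; [exact: hv|exact: hw].
exists y => e e0.
have /metricType_numDomainType.cvgrPdist_lt /(_ _ e0) h := Fy.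
have [v [/= v1 v2]] := filter_ex (filterI (near_ptsP f (fun _ : 'I_1 => x) e0) h).
by exists (v ord0).
Qed.

Lemma joined_fun : modulus_of -> forall x y y', joined x y -> joined x y' -> y = y'.
Proof.
move=> fg x y y' xy xy'; apply: mdist_positivity; apply/eqP.
rewrite eq_le mdist_ge0 andbT; apply/ler_addgt0Pr => e e0.
have e30 : 0 < e / 3 by rewrite divr_gt0.
have [d d0 hd] := fg _ e30.
have m0 : 0 < Num.min (d / 2) (e / 3) by rewrite lt_min e30 divr_gt0.
have [v [v1 v2]] := xy _ m0; have [w [w1 w2]] := xy' _ m0.
move: v1 v2 w1 w2; rewrite !lt_min => /andP[v1 _] /andP[_ v2] /andP[w1 _] /andP[_ w2].
have vw : mdist (g v) (g w) < e / 3.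
  apply: hd; rewrite (splitr d); apply: le_lt_trans (metric_triangle _ x _) _.
  by rewrite metric_sym ltrD.
have := metric_triangle y (g v) y'; have := metric_triangle (g v) (g w) y'.
by rewrite (metric_sym (g w) y'); lra.
Qed.

Lemma joined_pert rho h : pre_radius rho ->
  (forall m (v : 'I_m -> V), rho m (tp (f \o v), tp (g \o v))) ->
  (forall x, joined x (h x)) -> pert rho h.
Proof.
move=> prho fg jh n a; exists (tp a) => //.
pose F := filter_from [set e : R | 0 < e] (fun e => [set v : 'I_n -> V | forall i,
  mdist (a i) (f (v i)) < e /\ mdist (h (a i)) (g (v i)) < e]).
have PF : ProperFilter F.
  apply: filter_from_proper; last first.
    by move=> e e0; have /choice [v hv] := fun i => jh (a i) e e0; exists v.
  apply: filter_from_filter; first by exists 1 => /=.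
  move=> e e' e0 e'0; exists (Num.min e e'); first by rewrite /= lt_min e0.
  by move=> v hv; split=> i; have := hv i; rewrite !lt_min => -[/andP[? ?] /andP[? ?]].
apply: (closed_cvg (rho n) (prho n).1 _ _ (u_ := fun v => (tp (f \o v), tp (g \o v)))
  (F := F)).
  by apply: nearW => v; apply: fg.
have fa : tp (f \o v) @[v --> F] --> tp a.
  apply/type_cvgP => s; apply/cvgrPdist_le => e e0.
  have [d d0 hd] := feval_uc s e0; exists d => // v hv.
  by apply: hd => i; case: (hv i).
have gha : tp (g \o v) @[v --> F] --> tp (h \o a).
  apply/type_cvgP => s; apply/cvgrPdist_le => e e0.
  have [d d0 hd] := feval_uc s e0; exists d => // v hv.
  by apply: hd => i; case: (hv i).
exact: cvg_pair fa gha.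
Qed.

End DensePerturbation.

Arguments joined {R L T M N V} f g.
Arguments modulus_of {R L T M N V} f g.

(** By [radius_uc], the correspondence of [f v] with [g v] is uniformly
  continuous in both directions, so it extends to a bijection of the complete
  structures. A tuple and its image are limits of corresponding tuples, and the
  radius is closed. *)
Lemma dense_bipert {R : realType} {L : language R} {T : theory L}
    (rho : type_rel T) (M N : model T) (V : Type) (f : V -> M) (g : V -> N) :
  pert_radius rho -> symmetric_radius rho -> dense_map f -> dense_map g ->
  (forall m (v : 'I_m -> V), rho m (tp (f \o v), tp (g \o v))) ->
  exists2 h : M -> N, bipert rho h & forall v, h (f v) = g v.
Proof.
move=> rr rs fd gd fg.
have gf m (v : 'I_m -> V) : rho m (tp (g \o v), tp (f \o v)) by exact/rs/fg.
have mfg := related_modulus rr fg; have mgf := related_modulus rr gf.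
have /choice [h hj] := joined_exists fd mfg.
have /choice [k kj] := joined_exists gd mgf.
have swap x y : joined g f y x -> joined f g x y.
  by move=> yx e /yx [v [? ?]]; exists v.
have swap' x y : joined f g x y -> joined g f y x.
  by move=> yx e /yx [v [? ?]]; exists v.
exists h; last first.
  move=> v; apply: (joined_fun mfg (hj _)) => e e0.
  by exists v; rewrite !mdistxx.
split; first exact: joined_pert rr.1 fg hj.
exists k; last exact: joined_pert rr.1 gf kj.
split=> [x|y].
  by apply: (joined_fun mgf (kj _)); exact/swap'/hj.
by apply: (joined_fun mfg (hj _)); exact/swap/kj.
Qed.

(** * Bisimulations of types *)

Section Bisimulation.
Context {R : realType} {L : language R} {T : theory L}.

(** Relations between types of tuples [c ++ a] and [d ++ b], where [a] and [b]
  are fixed tuples of length [n] and [c], [d] grow at the front. *)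
Definition pair_rel n :=
  forall k, set (type_space T (k + n) * type_space T (k + n)).

Definition flip n (F : pair_rel n) : pair_rel n :=
  fun k => [set xy | F k (xy.2, xy.1)].

Definition forth n (F : pair_rel n) := forall k x y x', F k (x, y) ->
  res (x' : type_space T (k + n).+1) = x ->
  exists2 y' : type_space T (k + n).+1, res y' = y & F k.+1 (x', y').

(** An extension [x'] of the type [x] need not be realized over a given
  realization of [x]; only the types in a neighbourhood of [x'] are. *)
Definition approx_forth n (F : pair_rel n) :=
  forall k x y x' O, F k (x, y) ->
  res (x' : type_space T (k + n).+1) = x -> open O -> O x' ->
  exists x'' y'' : type_space T (k + n).+1,
    [/\ O x'', res x'' = x, res y'' = y & F k.+1 (x'', y'')].

Definition bisim n (F : pair_rel n) := forth F /\ forth (flip F).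

Definition approx_bisim n (F : pair_rel n) :=
  approx_forth F /\ approx_forth (flip F).

Definition closure_rel n (F : pair_rel n) : pair_rel n := fun k => closure (F k).

Lemma swap_continuous (A B : topologicalType) :
  continuous (fun ab : A * B => (ab.2, ab.1)).
Proof. by move=> ab; apply: cvg_pair; [exact: cvg_snd|exact: cvg_fst]. Qed.

Lemma closure_flip n (F : pair_rel n) :
  closure_rel (flip F) = flip (closure_rel F).
Proof.
apply/functional_extensionality_dep => k; apply/seteqP.
split=> -[x y] /= cl B nB.
  have [[u v] [? ?]] := cl _ (@swap_continuous _ _ (x, y) _ nB).
  by exists (v, u).
have [[u v] [? ?]] := cl _ (@swap_continuous _ _ (y, x) _ nB).
by exists (v, u).
Qed.

(** The answers [y''] to better and better approximations [x''] of [x'] have a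
  cluster point by compactness, and this cluster point extends [y] since
  restriction is continuous. *)
Lemma forth_closure n (F : pair_rel n) : approx_forth F -> forth (closure_rel F).
Proof.
move=> aF k x y x' clF x'x.
pose A (UW : set (type_space T (k + n).+1) * set (type_space T (k + n))) :=
  [set z : type_space T (k + n).+1 * type_space T (k + n).+1 |
    [/\ F k.+1 z, UW.1 z.1 & UW.2 (res z.2)]].
pose G := filter_from [set UW | nbhs x' UW.1 /\ nbhs y UW.2] A.
have GF : ProperFilter G.
  apply: filter_from_proper.
    apply: filter_from_filter.
      by exists (setT, setT); split; exact: filterT.
    move=> [U W] [U' W'] [/= nU nW] [/= nU' nW'].
    exists (U `&` U', W `&` W'); first by split; exact: filterI.
    by move=> z [? [? ?] [? ?]]; split; split.
  move=> [U W] [/= nU nW].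
  have nx : nbhs (x, y) ((@res R L T (k + n) @` U°) `*` W).
    exists (@res R L T (k + n) @` U°, W) => //; split => //=.
    apply: open_nbhs_nbhs; split; first exact/res_open/open_interior.
    by exists x'.
  have [[x1 y1] [F1 [[x1' Ux1' x1E] Wy1]]] := clF _ nx.
  have [x2 [y2 [Ux2 _ y2E F2]]] :=
    aF _ _ _ _ _ F1 x1E (@open_interior _ U) Ux1'.
  exists (x2, y2); split => //=; first exact: interior_subset.
  by rewrite y2E.
have [[z y'] [_ clG]] := @compact_pairs _ _ T _ _ G GF filterT.
have GA U W : nbhs x' U -> nbhs y W -> G (A (U, W)) by move=> nU nW; exists (U, W).
have zx : x' = z.
  apply: type_hausdorff => U B nU nB.
  have nB' : nbhs (z, y') (B `*` setT).
    by exists (B, setT) => //; split => //; exact: filterT.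
  have [[u v] [[_ /= Uu _] [/= Bu _]]] := clG _ _ (GA _ _ nU filterT) nB'.
  by exists u.
have yy : y = res y'.
  apply: type_hausdorff => W B nW nB.
  have nB' : nbhs (z, y') (setT `*` (@res R L T (k + n) @^-1` B)).
    exists (setT, @res R L T (k + n) @^-1` B) => //; split; first exact: filterT.
    exact: (@res_continuous R L T (k + n) y' _ nB).
  have [[u v] [[_ _ /= Wv] [/= _ Bv]]] := clG _ _ (GA _ _ filterT nW) nB'.
  by exists (res v).
exists y' => //; rewrite zx => B nB.
by have [[u v] [[Fuv _ _] Buv]] := clG _ _ (GA _ _ filterT filterT) nB; exists (u, v).
Qed.

Lemma bisim_closure n (F : pair_rel n) : approx_bisim F -> bisim (closure_rel F).
Proof.
by move=> [aF aF']; split; [|rewrite -closure_flip]; exact: forth_closure.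
Qed.

Lemma bisim_approx n (F : pair_rel n) : bisim F -> approx_bisim F.
Proof.
move=> [h h']; split=> k x y x' O Fxy x'x oO Ox'.
  by have [y' ? ?] := h _ _ _ _ Fxy x'x; exists x', y'; split.
by have [y' ? ?] := h' _ _ _ _ Fxy x'x; exists x', y'; split.
Qed.

Section Local.
Variable p : perturbation_system T.

Definition cross_dist k n (j : 'I_k) (i : 'I_n) : formula L (k + n) :=
  FDist (Var (lshift n j)) (Var (rshift k i)).

(** What a perturbation of size [e] that carries [c] to [d] and moves [a] to
  within [e] of [b] imposes on the types of [c ++ a] and [d ++ b]. *)
Definition local (e : R) n (F : pair_rel n) := forall k x y, F k (x, y) ->
  psys p e k (tpr (@lshift k n) x, tpr (@lshift k n) y) /\
  forall (j : 'I_k) (i : 'I_n),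
    `|type_val x (cross_dist j i) - type_val y (cross_dist j i)| <= e.

Lemma psys_closed (e : R) n : 0 <= e -> closed (psys p e n).
Proof. by move=> e0; have [+ _] := (psys_radius p e0).1 n. Qed.

Lemma psys_diag (e : R) n t : 0 <= e -> psys p e n (t, t).
Proof. by move=> e0; have [_ +] := (psys_radius p e0).1 n; apply. Qed.

Lemma psys_le (e e' : R) n : 0 <= e -> e <= e' ->
  psys p e n `<=` psys p e' n.
Proof.
move=> e0 ee' [t u] tu; rewrite -(subrK e e').
apply: (@psys_comp _ _ _ p) => //; first by rewrite subr_ge0.
by exists u; split=> //=; apply: psys_diag; rewrite subr_ge0.
Qed.

Lemma local_closure (e : R) n (F : pair_rel n) : 0 <= e ->
  local e F -> local e (closure_rel F).
Proof.
move=> e0 lF k x y cl.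
pose C := (fun xy : type_space T (k + n) * type_space T (k + n) =>
    (tpr (@lshift k n) xy.1, tpr (@lshift k n) xy.2)) @^-1` psys p e k
  `&` \bigcap_(ji in [set: 'I_k * 'I_n])
    (fun xy : type_space T (k + n) * type_space T (k + n) =>
      `|type_val xy.1 (cross_dist ji.1 ji.2) - type_val xy.2 (cross_dist ji.1 ji.2)|)
      @^-1` [set r | r <= e].
have cC : closed C.
  have c1 (A B : topologicalType) (g : type_space T (k + n) -> A) :
      continuous g -> continuous (fun xy : type_space T (k + n) * B => g xy.1).
    by move=> gc xy; apply: (@continuous_comp _ _ _ fst g); [exact: cvg_fst|exact: gc].
  have c2 (A B : topologicalType) (g : type_space T (k + n) -> A) :
      continuous g -> continuous (fun xy : B * type_space T (k + n) => g xy.2).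
    by move=> gc xy; apply: (@continuous_comp _ _ _ snd g); [exact: cvg_snd|exact: gc].
  have tc := @tpr_continuous _ _ T _ _ (@lshift k n).
  apply: closedI.
    apply: closed_comp; last exact: psys_closed.
    by move=> xy _; exact: cvg_pair (c1 _ _ _ tc xy) (c2 _ _ _ tc xy).
  apply: closed_bigI => ji _; apply: closed_comp; last exact: closed_le.
  have vc := @type_val_continuous _ _ T _ (cross_dist ji.1 ji.2).
  by move=> xy _; exact: cvg_norm (cvgB (c1 _ _ _ vc xy) (c2 _ _ _ vc xy)).
have FC : F k `<=` C.
  by move=> [u v] /lF [h1 h2]; split=> //= ji _; exact: h2.
have [h1 h2] : C (x, y).
  rewrite (closure_id C).1 //.
  exact: closure_subset FC _ cl.
by split=> // j i; apply: (h2 (j, i)).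
Qed.

(** For [k := 0] and a countable language, two [n]-types are related exactly when
  some perturbation of size [e] moves a realization of the one to within [e] of
  a realization of the other, so that [dtilde p s t] is the infimum of the [e] that relate [s] to
  [t]. *)
Definition bis (e : R) n : pair_rel n := fun k =>
  [set xy | exists F : pair_rel n, [/\ bisim F, local e F & F k xy]].

Arguments bis : clear implicits.

Lemma bis_bisim (e : R) n : bisim (bis e n).
Proof.
split=> k x y x' [F [[h h'] lF Fxy]] x'x.
  by have [y' ? ?] := h _ _ _ _ Fxy x'x; exists y' => //; exists F.
by have [y' ? ?] := h' _ _ _ _ Fxy x'x; exists y' => //; exists F.
Qed.

Lemma bis_local (e : R) n : local e (bis e n).
Proof. by move=> k x y [F [_ lF Fxy]]; apply: lF. Qed.

Lemma bis_closed (e : R) n k : 0 <= e -> closed (bis e n k).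
Proof.
move=> e0 xy cl; exists (closure_rel (bis e n)); split=> //.
  exact/bisim_closure/bisim_approx/bis_bisim.
exact/local_closure/bis_local.
Qed.

Lemma bis_sym (e : R) n k x y : 0 <= e -> bis e n k (x, y) -> bis e n k (y, x).
Proof.
move=> e0 [F [[h h'] lF Fxy]]; exists (flip F); split=> //.
move=> j u v /lF [h1 h2]; split; first exact: psys_sym.
by move=> *; rewrite distrC.
Qed.

Lemma bis_le (e e' : R) n k : 0 <= e -> e <= e' -> bis e n k `<=` bis e' n k.
Proof.
move=> e0 ee' xy [F [bF lF Fxy]]; exists F; split=> // j u v /lF [h1 h2].
by split=> [|? ?]; [exact: psys_le h1|exact: le_trans ee'].
Qed.

(** The relational composite of two back-and-forth systems is one again. On
  models the same fact would need two perturbations with a common intermediate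
  model. *)
Lemma bis_trans (e e' : R) n k x y z : 0 <= e -> 0 <= e' ->
  bis e n k (x, y) -> bis e' n k (y, z) -> bis (e + e') n k (x, z).
Proof.
move=> e0 e'0 xy yz.
exists (fun j => [set uv | exists2 t, bis e n j (uv.1, t) & bis e' n j (t, uv.2)]).
have [h h'] := bis_bisim e n; have [g g'] := bis_bisim e' n.
split; last by exists y.
  split=> j u v u' [t ut tv] u'u.
    have [t' t't ut'] := h _ _ _ _ ut u'u; have [v' v'v tv'] := g _ _ _ _ tv t't.
    by exists v' => //; exists t'.
  have [t' t't ut'] := g' _ _ _ _ tv u'u; have [v' v'v tv'] := h' _ _ _ _ ut t't.
  by exists v' => //; exists t'.
move=> j u v [t /= /bis_local [a1 a2] /bis_local [b1 b2]]; split.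
  rewrite addrC; apply: (@psys_comp _ _ _ p) => //.
  by exists (tpr (@lshift j n) t).
move=> q i; apply: le_trans (ler_distD (type_val t (cross_dist q i)) _ _) _.
exact: lerD.
Qed.

End Local.

End Bisimulation.

Arguments bis {R L T} p e n k.

(** * From perturbations to bisimulations *)

Section Configurations.
Context {R : realType} {L : language R} {T : theory L}.
Variable p : perturbation_system T.

Lemma rshiftS k n : @rshift k.+1 n = lift ord0 \o @rshift k n.
Proof. by apply/funext => i; apply/val_inj. Qed.

Lemma lshiftS k n : @lshift k.+1 n = vcons ord0 (lift ord0 \o @lshift k n).
Proof.
rewrite -[LHS]vcons_eta; congr vcons; first exact/val_inj.
by apply/funext => i; apply/val_inj.
Qed.

Lemma vcons_rshift A k n (x : A) (u : 'I_(k + n) -> A) :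
  vcons x u \o @rshift k.+1 n = u \o @rshift k n.
Proof. by rewrite rshiftS compA vcons_lift. Qed.

Lemma vcons_lshift A k n (x : A) (u : 'I_(k + n) -> A) :
  vcons x u \o @lshift k.+1 n = vcons x (u \o @lshift k n).
Proof. by rewrite lshiftS comp_vcons vcons0 compA vcons_lift. Qed.

(** For [c := a i], the last condition says that [f] moves [a i] to within [e] of
  [b i]. *)
Definition carries (e : R) (M N : model T) (f : M -> N) n (a : 'I_n -> M)
    (b : 'I_n -> N) :=
  bipert (p e) f /\
  forall i (c : M), `|mdist c (a i) - mdist (f c) (b i)| <= e.

(** The types of [c ++ a] and [f c ++ b] form an approximate back-and-forth
  system because [f] is onto; it becomes exact on taking closures. *)
Lemma carries_bis (e : R) (M N : model T) (f : M -> N) n (a : 'I_n -> M) b :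
  0 <= e -> carries e f a b -> bis p e n 0 (tp a, tp b).
Proof.
move=> e0 [[pf [g [fg gf] pg]] fab].
pose F : pair_rel n := fun k => [set xy | exists u w, [/\ xy = (tp u, tp w),
  u \o @rshift k n = a, w \o @rshift k n = b &
  w \o @lshift k n = f \o (u \o @lshift k n)]].
exists (closure_rel F); split.
- apply: bisim_closure; split=> k x y x' O [u [w [[-> ->] ua wb uw]]] x'x oO Ox'.
    have [c Oc] := res_realize oO (ex_intro2 _ _ x' Ox' x'x).
    exists (tp (scons c u)), (tp (scons (f c) w)).
    split; rewrite ?res_scons//; exists (scons c u), (scons (f c) w); split=> //.
    + by rewrite sconsE vcons_rshift.
    + by rewrite sconsE vcons_rshift.
    + by rewrite !sconsE !vcons_lshift uw comp_vcons.
  have [c Oc] := res_realize oO (ex_intro2 _ _ x' Ox' x'x).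
  exists (tp (scons c w)), (tp (scons (g c) u)).
  split; rewrite ?res_scons//; exists (scons (g c) u), (scons c w); split=> //.
  + by rewrite sconsE vcons_rshift.
  + by rewrite sconsE vcons_rshift.
  + by rewrite !sconsE !vcons_lshift uw comp_vcons gf.
- apply: local_closure => // k x y [u [w [[-> ->] ua wb uw]]]; split.
    by rewrite !tpr_tp uw; have [_ ->] := pf k (u \o @lshift k n).
  move=> j i; rewrite !type_val_tp /=.
  have -> : u (rshift k i) = a i by rewrite -ua.
  have -> : w (rshift k i) = b i by rewrite -wb.
  have -> : w (lshift n j) = f (u (lshift n j)).
    by have := congr1 (fun h => h j) uw.
  exact: fab.
- apply: subset_closure; exists a, b; split=> //; apply/funext => i /=.
  + by congr a; apply/val_inj.
  + by congr b; apply/val_inj.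
  + by case: i.
Qed.

End Configurations.

(** * From bisimulations to perturbations *)

Section DependentChain.

Lemma dependent_chain (X : nat -> Type) (F : forall k, X k -> Prop)
    (S : forall k, X k -> X k.+1 -> Prop) (x0 : X 0%N) : F 0%N x0 ->
  (forall k x, F k x -> exists2 y, F k.+1 y & S k x y) ->
  exists z : forall k, X k, z 0%N = x0 /\
    forall k, F k (z k) /\ S k (z k) (z k.+1).
Proof.
move=> F0 step.
have step' k (x : {x | F k x}) : {y : {y | F k.+1 y} | S k (sval x) (sval y)}.
  apply: cid; case: x => x Fx /=; have [y Fy Sxy] := step k x Fx.
  by exists (exist _ y Fy).
pose z := fix z k : {x | F k x} :=
  if k is j.+1 then sval (step' j (z j)) else exist _ x0 F0.
exists (fun k => sval (z k)); split=> // k; split; first exact: proj2_sig (z k).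
exact: proj2_sig (step' k (z k)).
Qed.

End DependentChain.

Section BackAndForth.
Context {R : realType} {L : language R} {T : theory L}.
Hypothesis Lc : countable_language L.

Lemma type_sequence m (t : type_space T m) :
  exists Ma : {M : model T & nat -> M}, tp (@recent _ m (projT2 Ma)) = t.
Proof.
have [M [b <-]] := tp_surj t; have [x] := inhab M.
by exists (existT _ M (seq_of b x)); rewrite /= recent_seq_of.
Qed.

Lemma nat_ultrafilter : exists2 U : set_system nat, UltraFilter U & \oo `<=` U.
Proof.
by have [U [? ?]] := ultraFilterLemma (F := \oo) _; exists U.
Qed.

(** The types of a coherent chain are realized by longer and longer sequences
  in varying models. The limit of these sequences along an ultrafilter is a
  sequence with all these types. *)
Lemma chain_model k0 n (t : forall i, type_space T (i + k0 + n)) :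
  (forall i, res (t i.+1 : type_space T (i + k0 + n).+1) = t i) ->
  (forall w, dense_task w -> exists2 i, task_ready w (i + k0 + n) &
    fulfils (t i.+1 : type_space T (i + k0 + n).+1) w) ->
  exists (N : model T) (e : nat -> N), dense_map (e \o addn n) /\
    forall i, tp (@recent _ (i + k0 + n) e) = t i.
Proof.
move=> tres tasks; have [U UU ooU] := nat_ultrafilter.
have /choice [Ma MaE] := fun i => type_sequence (t i).
have MaE' d i : tp (@recent _ (i + k0 + n) (projT2 (Ma (d + i)%N))) = t i.
  elim: d i => [|d IH] i; first exact: MaE.
  by rewrite addSnnS -tres -(IH i.+1) -res_recent.
have MaE2 i j : (i <= j)%N -> tp (@recent _ (i + k0 + n) (projT2 (Ma j))) = t i.
  by move=> /subnK <-; exact: MaE'.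
have [w /tasks [i wi tw]|N [e [ed elim]]] :=
    @henkin_sequence R L T U n (fun j => projT1 (Ma j)) (fun j => projT2 (Ma j)) UU ooU.
  exists (i + k0 + n)%N; first exact: leq_addl.
  exists i.+1 => // j /= ij; apply/ltW/fulfils_recent => //.
  by rewrite -(MaE2 i.+1 j ij) in tw.
exists N, e; split=> // i; apply: type_val_inj => s.
have h1 := elim _ s (@recent _ (i + k0 + n) id).
apply: (cvg_unique (@Rhausdorff R) h1).
apply: cvg_near_cst; apply: ooU; exists i => // j /= /MaE2 <-.
by rewrite type_val_tp.
Qed.

Lemma extend_option m (t : type_space T m) (w : option (task L)) :
  exists2 u, res u = t & forall w', w = Some w' -> task_ready w' m -> fulfils u w'.
Proof.
have any : exists u : type_space T m.+1, res u = t.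
  have [M [b <-]] := tp_surj t; have [x] := inhab M.
  by exists (tp (scons x b)); exact: res_scons.
case: w => [w|]; last by have [u ut] := any; exists u.
have [wm|nwm] := pselect (task_ready w m).
  by have [u ut uw] := fulfils_extend t wm; exists u => // w' [<-].
by have [u ut] := any; exists u => // w' [<-] /nwm.
Qed.

Variable p : perturbation_system T.

Lemma pert_modulus (rho : type_rel T) (M N : model T) (f : M -> N) :
  pert_radius rho -> pert rho f -> modulus_of (@id M) f.
Proof.
move=> rr pf; apply: (related_modulus (M := M) (f := id) (g := f) rr) => m v.
by have [_ ->] := pf m v.
Qed.

Lemma task_ready_from (w : task L) : exists K, forall m, (K <= m)%N -> task_ready w m.
Proof.
exists (\max_i task_params (t := w) i).+1 => m Km i; apply: leq_trans Km.
by rewrite ltnS; exact: (leq_bigmax (F := task_params (t := w)) i).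
Qed.

(** Two chains of extensions of [x] and [y] are built together; the even steps
  meet a demand on the first chain, the odd steps one on the second, and the
  relation provides the extension of the other chain. The chains are realized
  by dense sequences of two models. By the local constraint the radius relates
  the types of corresponding tuples, so there is a perturbation between the
  models, and the distances to [a] and [b] differ by at most [e] on the dense
  sequences, hence everywhere. *)
Lemma bis_carries (e : R) n k0 x y : 0 <= e -> bis p e n k0 (x, y) ->
  exists (M N : model T) (f : M -> N) (u : 'I_(k0 + n) -> M) (w : 'I_(k0 + n) -> N),
    [/\ carries p e f (u \o @rshift k0 n) (w \o @rshift k0 n),
        w \o @lshift k0 n = f \o (u \o @lshift k0 n),
        tp u = x, tp w = y & exists d : nat -> M, dense_map d].
Proof.
move=> e0 xy; have [E Eall] := task_enumeration Lc.
pose X i := (type_space T (i + k0 + n) * type_space T (i + k0 + n))%type.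
pose S i (z : X i) (z' : X i.+1) :=
  [/\ res (z'.1 : type_space T (i + k0 + n).+1) = z.1,
      res (z'.2 : type_space T (i + k0 + n).+1) = z.2 &
      forall w, E i./2 = Some w -> task_ready w (i + k0 + n) ->
        fulfils ((if odd i then z'.2 else z'.1) : type_space T (i + k0 + n).+1) w].
have [z [z0 zP]] : exists z : forall i, X i, z 0%N = (x, y) /\
    forall i, bis p e n (i + k0) (z i) /\ S i (z i) (z i.+1).
  apply: (dependent_chain (F := fun i => bis p e n (i + k0))) => // i [u v] uv.
  have [h h'] := bis_bisim p e n.
  case oi: (odd i).
    have [v' v'v v'w] := extend_option v (E i./2).
    have [u' u'u u'v'] := h' _ _ _ _ uv v'v.
    by exists (u', v') => //; split=> //; rewrite oi.
  have [u' u'u u'w] := extend_option u (E i./2).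
  have [v' v'v u'v'] := h _ _ _ _ uv u'u.
  by exists (u', v') => //; split=> //; rewrite oi.
have task_at b w : dense_task w -> exists2 i, odd i = b &
    E i./2 = Some w /\ task_ready w (i + k0 + n).
  move=> dw; have [K hK] := task_ready_from w; have [k Kk Ek] := Eall w dw K.
  exists (b + k.*2)%N; first by rewrite oddD odd_double addbF; case: b.
  rewrite half_bit_double; split=> //; apply: hK.
  by rewrite -addnA (leq_trans Kk)// (leq_trans _ (leq_addr _ _))// -addnn addnA leq_addl.
have [|w /(task_at false) [i oi [Ei wi]]|M [d [dd dE]]] :=
    @chain_model k0 n (fun i => (z i).1).
- by move=> i; have [_ []] := zP i.
- by exists i => //; have [_ [_ _ /(_ w Ei wi)]] := zP i; rewrite oi.
have [|w /(task_at true) [i oi [Ei wi]]|N [d' [dd' dE']]] :=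
    @chain_model k0 n (fun i => (z i).2).
- by move=> i; have [_ []] := zP i.
- by exists i => //; have [_ [_ _ /(_ w Ei wi)]] := zP i; rewrite oi.
have lrec A i := @recent_lshift A (i + k0) n.
have rrec A i := @recent_rshift A (i + k0) n.
have rho_dd' m (v : 'I_m -> nat) :
    psys p e m (tp ((d \o addn n) \o v), tp ((d' \o addn n) \o v)).
  pose i := (\max_j v j).+1.
  have vi j : (v j < i + k0)%N.
    by rewrite ltn_addr// ltnS; exact: (leq_bigmax (F := v) j).
  have tau_lt j : (i + k0 - (v j).+1 < i + k0)%N.
    by rewrite ltn_subrL (leq_ltn_trans _ (vi j)).
  pose tau j := Ordinal (tau_lt j).
  have tauE A (a : nat -> A) : a \o v = @recent _ (i + k0) a \o tau.
    apply/funext => j; rewrite /recent /=; congr a.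
    by rewrite -subSn// subSS subKn// ltnW.
  rewrite !tauE -!(tpr_tp tau); apply: (radius_tpr (psys_radius p e0)).
  rewrite -!lrec -!(tpr_tp (@lshift _ _)) dE dE'.
  by have [+ _] := zP i; rewrite [z i]surjective_pairing => /bis_local [].
have [f bf fd] := dense_bipert (psys_radius p e0) (psys_sym e0) dd dd' rho_dd'.
exists M, N, f, (@recent _ (0 + k0 + n) d), (@recent _ (0 + k0 + n) d').
split.
- split=> // i c; apply/ler_addgt0Pr => r r0.
  have r20 : 0 < r / 2 by rewrite divr_gt0.
  have [t t0 ht] := pert_modulus (psys_radius p e0) bf.1 r20.
  have m0 : 0 < Num.min t (r / 2) by rewrite lt_min t0.
  have [q hq] := dd c _ m0; move: hq; rewrite lt_min => /andP[/ht hq1 hq2].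
  have tau_lt : (q.+1 + k0 - q.+1 < q.+1 + k0)%N by rewrite ltn_subrL.
  have [+ _] := zP q.+1; rewrite [z q.+1]surjective_pairing.
  move=> /bis_local [_ /(_ (Ordinal tau_lt) i)].
  rewrite -(dE q.+1) -(dE' q.+1) !type_val_tp /=.
  have lE A (a : nat -> A) : @recent _ (q.+1 + k0 + n) a (lshift n (Ordinal tau_lt))
      = (a \o addn n) q.
    have := congr1 (fun h => h (Ordinal tau_lt)) (lrec _ q.+1 a).
    move=> /= ->; rewrite /recent; congr (a (n + _)%N).
    by rewrite /= addKn addSn subSS addnK.
  have rE A (a : nat -> A) : @recent _ (q.+1 + k0 + n) a (rshift (q.+1 + k0) i)
      = @recent _ (0 + k0 + n) a (rshift (0 + k0) i).
    have h1 := congr1 (fun h => h i) (rrec _ q.+1 a).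
    have h2 := congr1 (fun h => h i) (rrec _ 0%N a).
    exact: etrans h1 (esym h2).
  rewrite !lE !rE -fd /= => hloc.
  set a1 := recent d _ in hloc *; set b1 := recent d' _ in hloc *.
  have h1 := mdist_dist c a1 (d (n + q)) a1.
  have h2 := mdist_dist (f c) b1 (f (d (n + q))) b1.
  rewrite !mdistxx !addr0 in h1 h2.
  move: hloc h1 h2 hq1 hq2; rewrite /= !ler_norml.
  move=> /andP[? ?] /andP[? ?] /andP[? ?] ? ?; apply/andP; split; lra.
- by rewrite (lrec _ 0%N d') (lrec _ 0%N d); apply/funext => j; rewrite /recent /= fd.
- by rewrite (dE 0%N) z0.
- by rewrite (dE' 0%N) z0.
- by exists (d \o addn n).
Qed.

(** The downward Lowenheim-Skolem theorem, as the case of a perturbation of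
  size 0. *)
Lemma separable_realization n (t : type_space T n) :
  exists (M : model T) (a : 'I_n -> M), tp a = t /\ exists d : nat -> M, dense_map d.
Proof.
have [M0 [a0 a0t]] := tp_surj t.
have : bis p 0 n 0 (tp a0, tp a0).
  apply: (@carries_bis _ _ _ p 0 M0 M0 id) => //; split; last first.
    by move=> i c; rewrite subrr normr0.
  have pid : pert (psys p 0) (@id M0).
    by move=> m b; exists (tp b) => //; exact: psys_diag.
  by split=> //; exists id.
move=> /(bis_carries (lexx 0)) [M [N [f [u [w [_ _ ut _ dM]]]]]].
by exists M, u; rewrite ut.
Qed.

(** * The metric on types *)

Lemma dtilde_ltP n (s t : type_space T n) (r : R) :
  (dtilde p s t < r%:E)%E <-> exists e, [/\ 0 <= e, e < r & bis p e n 0 (s, t)].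
Proof.
split=> [/ereal_inf_lt [_ [e [e0 [M [N [a [b [f [bf <- <- fab]]]]]]] <-]]|].
  rewrite lte_fin => er; exists e; split=> //.
  exact: (carries_bis (f := f) e0).
move=> [e [e0 er /(bis_carries e0) [M [N [f [u [w [[bf fuw] _ us wt _]]]]]]]].
apply: (@le_lt_trans _ _ e%:E); last by rewrite lte_fin.
apply: ereal_inf_lbound; exists e => //; split=> //.
exists M, N, (u \o @rshift 0 n), (w \o @rshift 0 n), f; split=> //.
  rewrite -us; congr tp; apply/funext => i /=; congr u; exact/val_inj.
rewrite -wt; congr tp; apply/funext => i /=; congr w; exact/val_inj.
Qed.

End BackAndForth.

(** * Small perturbations *)

Section SmallPerturbations.
Context {R : realType} {L : language R} {T : theory L}.
Hypothesis Lc : countable_language L.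
Variable p : perturbation_system T.

Lemma psys_cap0 n t u : (forall k : nat, psys p k.+1%:R^-1 n (t, u)) -> t = u.
Proof.
move=> h; have : psys p 0 n (t, u).
  rewrite (@psys_cap _ _ _ p (fun k => k.+1%:R^-1) 0 (lexx 0)).
  - by move=> k _; exact: h.
  - move=> i j ij; rewrite lef_pV2 ?posrE ?ltr0Sn// ler_nat ltnS.
    exact: ij.
  - exact: cvg_harmonic.
by rewrite psys0.
Qed.

(** The radii decrease to the diagonal as the size tends to 0; by compactness
  of the complement of [O] one of them is already contained in [O]. *)
Lemma psys_near n (O : set (type_space T n * type_space T n)) : open O ->
  (forall t, O (t, t)) -> exists2 e : R, 0 < e & psys p e n `<=` O.
Proof.
move=> oO diagO.
have Kc : compact (~` O).
  apply: (subclosed_compact _ (@compact_pairs _ _ T n n)) => //.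
  exact: open_closedC.
have /compact_near_coveringP := Kc.
move=> /(_ _ (0^'+) (fun (e : R) tu => ~ psys p e n tu)) [].
- move=> [t u] nO.
  have [k hk] : exists k : nat, ~ psys p k.+1%:R^-1 n (t, u).
    apply: contrapT => /forallNP h; apply: nO; suff -> : t = u by [].
    by apply: psys_cap0 => k; apply: contrapT; exact: h.
  exists (~` psys p k.+1%:R^-1 n, [set e | 0 < e < k.+1%:R^-1]); first split=> /=.
  + apply: open_nbhs_nbhs; split=> //.
    by apply: closed_openC; apply: psys_closed; rewrite ltW// inv_succ_gt0.
  + near=> e; apply/andP; split; first by [].
    by near: e; apply: nbhs_right_lt; exact: inv_succ_gt0.
  + move=> [tu e] /= [h /andP[e0 ek]] h'; apply: h.
    exact: psys_le (ltW e0) (ltW ek) _ h'.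
- move=> d /= d0 hd; exists (d / 2); first by rewrite divr_gt0.
  have hK : ~` O `<=` (fun tu => ~ psys p (d / 2) n tu).
    apply: (hd (d / 2)) => /=; last by rewrite divr_gt0.
    by rewrite sub0r normrN gtr0_norm ?divr_gt0//; lra.
  by move=> tu ptu; apply: contrapT => /hK.
Unshelve. all: by end_near.
Qed.

Lemma psys_val n (s : formula L n) (r : R) : 0 < r ->
  exists2 e : R, 0 < e & forall t u, psys p e n (t, u) ->
    `|type_val t s - type_val u s| < r.
Proof.
move=> r0.
pose O := (fun tu : type_space T n * type_space T n =>
  `|type_val tu.1 s - type_val tu.2 s|) @^-1` [set x | x < r].
have oO : open O.
  apply: open_comp; last exact: open_lt.
  move=> tu _; apply: cvg_norm; apply: cvgB.
    apply: (@continuous_comp _ _ _ fst (fun t => type_val t s)).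
      exact: cvg_fst.
    exact: type_val_continuous.
  apply: (@continuous_comp _ _ _ snd (fun t => type_val t s)).
    exact: cvg_snd.
  exact: type_val_continuous.
have [t|e e0 eO] := psys_near oO; first by rewrite /O /= subrr normr0.
by exists e => // t u /eO.
Qed.

(** Types at small distance give close values to any fixed formula: a
  perturbation changes the type of [a] little, and carries [a] close to [b]. *)
Lemma bis_val n (s : formula L n) (r : R) : 0 < r ->
  exists2 e : R, 0 < e & forall t u d, 0 <= d -> d < e ->
    bis p d n 0 (t, u) -> `|type_val t s - type_val u s| <= r.
Proof.
move=> r0; have r20 : 0 < r / 2 by rewrite divr_gt0.
have [e e0 he] := psys_val s r20; have [c c0 hc] := feval_uc s r20.
exists (Num.min e c); first by rewrite lt_min e0.
move=> t u d d0; rewrite lt_min => /andP[de dc] /(bis_carries Lc d0).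
move=> [M [N [f [a [b [[[pf _] fab] _ <- <- _]]]]]].
have fafb i : mdist ((f \o a) i) (b i) < c.
  have ri : i = @rshift 0 n i by exact/val_inj.
  apply: le_lt_trans dc; have := fab i (a i).
  rewrite /= -ri mdistxx sub0r normrN ger0_norm ?mdist_ge0//.
have [_ -> pd] := pf n a.
have h1 := he _ _ (psys_le d0 (ltW de) pd).
have h2 := hc N _ _ fafb.
move: h1 h2; rewrite !type_val_tp ltr_norml !ler_norml.
by move=> /andP[? ?] /andP[? ?]; apply/andP; split; lra.
Qed.

Lemma dtilde_open_of_open n (U : set (type_space T n)) : open U -> dtilde_open p U.
Proof.
move=> oU s Us; have [c [sc cU]] := type_basis (open_nbhs_nbhs (conj oU Us)).
have r0 : 0 < type_val s c / 2 by rewrite divr_gt0.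
have [e e0 he] := bis_val c r0; exists e => // t /= /(dtilde_ltP Lc) [d [d0 de st]].
apply: cU => /=; have := he _ _ _ d0 de st.
by rewrite ler_norml => /andP[? ?]; lra.
Qed.

Lemma bis_refl (e : R) n t : 0 <= e -> bis p e n 0 (t, t).
Proof.
move=> e0; have [M [a <-]] := tp_surj t.
apply: (@carries_bis _ _ _ p e M M id) => //; split; last first.
  by move=> i c; rewrite subrr normr0.
have pid : pert (psys p e) (@id M).
  by move=> m b; exists (tp b) => //; exact: psys_diag.
by split=> //; exists id.
Qed.

Lemma bis_tpr (e : R) m n (tau : 'I_m -> 'I_n) t u : 0 <= e ->
  bis p e n 0 (t, u) -> bis p e m 0 (tpr tau t, tpr tau u).
Proof.
move=> e0 /(bis_carries Lc e0) [M [N [f [a [b [[bf fab] _ <- <- _]]]]]].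
rewrite !tpr_tp; apply: (carries_bis (f := f) e0); split=> // i c.
have ri (j : 'I_n) : j = @rshift 0 n j by exact/val_inj.
by have := fab (tau i) c; rewrite /= -!ri.
Qed.

End SmallPerturbations.

(** * Omitting types *)

Section OmittingTypes.
Context {R : realType} {L : language R} {T : theory L}.
Hypothesis Lc : countable_language L.

Lemma tpr_rshift_open k n (O : set (type_space T (k + n))) : open O ->
  open (tpr (@rshift k n) @` O).
Proof.
elim: k => [|k IH] in O *; move=> oO.
  rewrite (_ : _ @` O = O)//; apply/seteqP; split=> [_ [t Ot <-]|t Ot].
    have [M [a aE]] := tp_surj t; rewrite -aE tpr_tp in Ot *.
    by rewrite (_ : a \o _ = a)//; apply/funext => i /=; congr a; exact/val_inj.
  exists t => //; have [M [a <-]] := tp_surj t; rewrite tpr_tp; congr tp.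
  by apply/funext => i /=; congr a; exact/val_inj.
have := IH _ (@res_open R L T (k + n) O oO); congr open.
apply/seteqP; split=> [_ [_ [t Ot <-] <-]|_ [t Ot <-]].
  by exists t => //; rewrite /res tpr_comp rshiftS.
by exists (res (t : type_space T (k + n).+1)); [exists t|rewrite /res tpr_comp rshiftS].
Qed.

Definition swap_sides n m (i : 'I_(n + m)) : 'I_(m + n) :=
  match fintype.split i with inl j => rshift m j | inr k => lshift n k end.

Lemma swap_lshift n m j : swap_sides (@lshift n m j) = rshift m j.
Proof. by rewrite /swap_sides (unsplitK (inl j)). Qed.

Lemma swap_rshift n m j : swap_sides (@rshift n m j) = lshift n j.
Proof. by rewrite /swap_sides (unsplitK (inr j)). Qed.

Lemma swap_swap n m : @swap_sides n m \o @swap_sides m n = id.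
Proof.
apply/funext => i; rewrite /= -[i]splitK.
by case: (fintype.split i) => j /=;
  rewrite (swap_lshift, swap_rshift) (swap_lshift, swap_rshift).
Qed.

(** The first coordinates of the types in [Q] fill an open set, and [B]
  contains no nonempty open set. *)
Lemma lshift_avoid n m (B : set (type_space T n)) (Q : set (type_space T (n + m))) :
  B° = set0 -> open Q -> Q !=set0 -> exists2 t, Q t & ~ B (tpr (@lshift n m) t).
Proof.
move=> B0 oQ [t0 Qt0]; apply: contrapT => nex.
pose Q' := tpr (@swap_sides n m) @^-1` Q.
have oQ' : open Q'.
  by apply: open_comp => // u _; exact: tpr_continuous.
have oI := tpr_rshift_open oQ'.
have IB : tpr (@rshift m n) @` Q' `<=` B.
  move=> _ [u Qu <-]; apply: contrapT => nB; apply: nex.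
  exists (tpr (@swap_sides n m) u) => //; rewrite tpr_comp.
  by rewrite (_ : _ \o _ = @rshift m n)//; apply/funext => i; exact: swap_lshift.
have [M [a aE]] := tp_surj t0.
suff : B° (tpr (@lshift n m) t0) by rewrite B0.
rewrite /interior; apply: filterS IB _; apply: open_nbhs_nbhs; split=> //.
exists (tpr (@swap_sides m n) t0).
  by rewrite /Q' /= tpr_comp swap_swap -aE tpr_tp in Qt0 *.
by rewrite tpr_comp; congr tpr; apply/funext => i; exact: swap_rshift.
Qed.

(** The [n] new elements are close to a given tuple [v] of the old ones while
  their type stays outside [B]; the condition [r <= c] keeps it outside [B] in
  the limit. *)
Lemma avoid_step n m (O : set (type_space T m)) (v : 'I_n -> nat) (d : R)
    (B : set (type_space T n)) : closed B -> B° = set0 -> open O -> O !=set0 ->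
  (forall i, (v i < m)%N) -> 0 < d ->
  exists (Q : set (type_space T (n + m))) (c : formula L n) (r : R),
    [/\ open Q, Q !=set0, 0 < r, forall u, r <= type_val u c -> ~ B u &
     forall (M : model T) (a : nat -> M), Q (tp (recent a)) ->
       [/\ O (tp (recent a)), r <= feval c (recent (a \o addn m)) &
        forall i, mdist (@recent _ n (a \o addn m) i) (a (v i)) <= d]].
Proof.
move=> cB B0 oO [t Ot] vm d0.
have pos_lt i : (m - (v i).+1 < m)%N.
  by rewrite ltn_subrL (leq_ltn_trans _ (vm i)).
pose pos i := Ordinal (pos_lt i).
have recent_pos (A : Type) (a : nat -> A) i : recent a (pos i) = a (v i).
  by rewrite /recent /= -subSn// subSS subKn// ltnW.
pose dst i : formula L (n + m) := FDist (Var (lshift m i)) (Var (rshift n (pos i))).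
pose Q0 := [set u : type_space T (n + m) |
  O (tpr (@rshift n m) u) /\ forall i, type_val u (dst i) < d].
have oQ0 : open Q0.
  apply: (@openI _ (tpr (@rshift n m) @^-1` O)); last exact: open_type_val_lt.
  by apply: open_comp => // u _; exact: tpr_continuous.
have Q0n : Q0 !=set0.
  have [M [a aE]] := tp_surj t.
  (* The new elements may be equal to the given ones. *)
  exists (tp (fun q => match fintype.split q with inl j => a (pos j) | inr k => a k end)).
  split.
    rewrite tpr_tp (_ : _ \o _ = a) ?aE//; apply/funext => k /=.
    by rewrite (unsplitK (inr k)).
  by move=> i; rewrite type_val_tp /= (unsplitK (inl i)) (unsplitK (inr (pos i))) mdistxx.
have [t1 Q0t1 nB] := lshift_avoid B0 oQ0 Q0n.
have [c [ct cB']] := type_basis (open_nbhs_nbhs (conj (closed_openC cB) nB)).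
pose r := type_val (tpr (@lshift n m) t1) c / 2.
have r0 : 0 < r by rewrite divr_gt0.
exists (Q0 `&` [set u | r < type_val u (rename c (@lshift n m))]), c, r; split=> //.
- apply: openI => //; rewrite openE => u /= ru.
  exact: (cvgr_gt _ (@type_val_continuous _ _ T _ _ u) _ ru).
- exists t1; split=> //=; rewrite -type_val_tpr /r.
  by set y := type_val _ _ in ct *; have y0 : 0 < y by []; lra.
- by move=> u ru; apply: cB' => /=; exact: lt_le_trans ru.
move=> M a [[Oa da] /= ra]; split.
- by move: Oa; rewrite tpr_tp recent_rshift.
- by move: ra; rewrite feval_rename recent_lshift => /ltW.
move=> i; have := da i; rewrite type_val_tp /= => /ltW.
have -> : recent a (lshift m i) = recent (a \o addn m) i.
  by rewrite -recent_lshift.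
have -> : recent a (rshift n (pos i)) = recent a (pos i).
  exact: (congr1 (fun h => h (pos i)) (@recent_rshift M n m a)).
by rewrite recent_pos.
Qed.

(** Each stage adds [n] elements for [avoid_step] and one witness. *)
Fixpoint stage n k := if k is j.+1 then (n + stage n j).+1 else 0%N.

Lemma stage_ge n k : (k <= stage n k)%N.
Proof. by elim: k => //= k IH; rewrite ltnS (leq_trans IH)// leq_addl. Qed.

(** A decreasing chain of nonempty open conditions on longer and longer tuples.
  Each step meets one demand for a witness and, since [B] has empty interior,
  puts a tuple outside [B] arbitrarily close to one of the tuples constructed
  before; every tuple of the dense sequence is treated infinitely often. *)
Theorem omitting_types n (B : set (type_space T n)) : inhabited (model T) ->
  closed B -> B° = set0 -> exists N : model T, (exists d : nat -> N, dense_map d) /\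
    forall (b : 'I_n -> N) (e : R), 0 < e ->
      exists c : 'I_n -> N, (forall i, mdist (b i) (c i) < e) /\ ~ B (tp c).
Proof.
move=> [M0] cB B0; have [E Eall] := task_enumeration Lc.
(* The indices of the tuple that [avoid_step] treats at stage [k], and its
   error. *)
pose E' k : {ffun 'I_n -> nat} * nat := odflt ([ffun=> 0%N], 0%N) (unpickle (logn 2 k)).
have E'all v l K : exists2 k, (K <= k)%N & E' k = (v, l).
  have [k Kk kE] := frequent_index (pickle (v, l)) K; exists k => //.
  by rewrite /E' kE pickleK.
pose X k := set (type_space T (stage n k)).
pose F k (O : X k) := open O /\ O !=set0.
pose S k (O : X k) (O' : X k.+1) :=
  [/\ forall (M : model T) (a : nat -> M),
        O' (tp (recent a)) -> O (tp (recent a)),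
      forall w, E k = Some w -> task_ready w (n + stage n k) ->
        forall t : type_space T (n + stage n k).+1, O' t -> fulfils t w &
      (forall i, (E' k).1 i < stage n k)%N ->
        exists (c : formula L n) (r : R),
          [/\ 0 < r, forall u, r <= type_val u c -> ~ B u &
           forall (M : model T) (a : nat -> M), O' (tp (recent a)) ->
             r <= feval c (recent (a \o addn (stage n k))) /\
             forall i, mdist (@recent _ n (a \o addn (stage n k)) i)
               (a ((E' k).1 i)) <= (E' k).2.+1%:R^-1]].
have F0 : F 0%N setT.
  split; first exact: openT.
  have [x] := inhab M0; by exists (tp (@recent _ 0 (fun=> x))).
have step k (O : X k) : F k O -> exists2 O' : X k.+1, F k.+1 O' & S k O O'.
  move=> [oO On].
  have [Q [oQ Qn QO Qv]] : exists Q : set (type_space T (n + stage n k)),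
    [/\ open Q, Q !=set0,
      forall (M : model T) (a : nat -> M), Q (tp (recent a)) -> O (tp (recent a)) &
      (forall i, (E' k).1 i < stage n k)%N ->
        exists (c : formula L n) (r : R),
          [/\ 0 < r, forall u, r <= type_val u c -> ~ B u &
           forall (M : model T) (a : nat -> M), Q (tp (recent a)) ->
             r <= feval c (recent (a \o addn (stage n k))) /\
             forall i, mdist (@recent _ n (a \o addn (stage n k)) i)
               (a ((E' k).1 i)) <= (E' k).2.+1%:R^-1]].
    have [vlt|nv] := pselect (forall i, (E' k).1 i < stage n k)%N.
      have [Q [c [r [oQ Qn r0 cB' hQ]]]] :=
        avoid_step cB B0 oO On vlt (inv_succ_gt0 (E' k).2).
      exists Q; split=> //; first by move=> M a /hQ [].
      by move=> _; exists c, r; split=> // M a /hQ [].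
    exists (tpr (@rshift n (stage n k)) @^-1` O); split=> //.
    - by apply: open_comp => // u _; exact: tpr_continuous.
    - have [t Ot] := On; have [[M a] /= aE] := type_sequence t.
      by exists (tp (recent a)); rewrite /= tpr_tp recent_rshift aE.
    - by move=> M a; rewrite /= tpr_tp recent_rshift.
  pose D := [set u : type_space T (n + stage n k).+1 | forall w, E k = Some w ->
    task_ready w (n + stage n k) -> fulfils u w].
  have oD : open D.
    rewrite /D; case: (E k) => [w|]; last first.
      by rewrite (_ : mkset _ = setT); [exact: openT|apply/seteqP; split].
    have [wr|nwr] := pselect (task_ready w (n + stage n k)).
      rewrite (_ : mkset _ = [set u | fulfils u w]); first exact: fulfils_open.
      by apply/seteqP; split=> u /= h; [exact: h|move=> w' [<-]].
    rewrite (_ : mkset _ = setT); first exact: openT.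
    by apply/seteqP; split=> // u _ w' [<-].
  exists ((@res R L T (n + stage n k) @^-1` Q) `&` D).
    split.
      apply: openI => //; apply: open_comp => // u _; exact: res_continuous.
    have [t Qt] := Qn; have [u ut uE] := extend_option t (E k).
    by exists u; split; rewrite /= ?ut.
  split=> [M a [/= + _]|w Ew wr t [_]|vlt].
  - by rewrite res_recent => /QO.
  - exact.
  have [c [r [r0 cB' h]]] := Qv vlt; exists c, r; split=> // M a [/= + _].
  by rewrite res_recent; exact: h.
have [Oc [_ OP]] := dependent_chain F0 step.
have /choice [Ma MaE] : forall k, exists Ma : {M : model T & nat -> M},
    Oc k (tp (@recent _ (stage n k) (projT2 Ma))).
  move=> k; have [[_ [t Ot]] _] := OP k; have [Ma MaE] := type_sequence t.
  by exists Ma; rewrite MaE.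
have Odown d k : Oc k (tp (@recent _ (stage n k) (projT2 (Ma (d + k)%N)))).
  elim: d k => [|d IH] k; first exact: MaE.
  by have [_ [h _ _]] := OP k; apply: h; rewrite addSnnS; exact: IH.
have Ole k j : (k <= j)%N -> Oc k (tp (@recent _ (stage n k) (projT2 (Ma j)))).
  by move=> /subnK <-; exact: Odown.
have [U UU ooU] := nat_ultrafilter.
have [w dw|N [e [ed elim]]] :=
    @henkin_sequence R L T U 0 (fun j => projT1 (Ma j)) (fun j => projT2 (Ma j)) UU ooU.
  have [K hK] := task_ready_from w; have [k Kk Ek] := Eall w dw K.
  have wr : task_ready w (n + stage n k).
    by apply: hK; rewrite (leq_trans Kk)// (leq_trans (stage_ge n k))// leq_addl.
  exists (n + stage n k)%N => //; exists k.+1 => // j /= kj.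
  have [_ [_ hf _]] := OP k; apply/ltW/fulfils_recent => //.
  exact: hf (Ole k.+1 j kj).
exists N; split; first by exists e.
move=> b r r0; have r20 : 0 < r / 2 by rewrite divr_gt0.
have /choice [v hv] := fun i => ed (b i) _ r20.
have [l hl] := exists_inv_succ r20.
have [k kv Ek] := E'all [ffun i => v i] l (\max_i v i).+1.
have vlt i : ((E' k).1 i < stage n k)%N.
  rewrite Ek /= ffunE (leq_trans _ (stage_ge n k))// (leq_trans _ kv)// ltnS.
  exact: (leq_bigmax (F := v) i).
have [_ [_ _ /(_ vlt) [c [s [s0 cB' hc]]]]] := OP k.
rewrite Ek /= in hc.
exists (recent (e \o addn (stage n k))); split=> [i|].
  set q := (stage n k + (n - i.+1))%N.
  have h : mdist (e q) (e (v i)) <= l.+1%:R^-1.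
    have := elim _ dist01 (vcons q (vcons (v i) (fun _ : 'I_0 => 0%N))).
    rewrite /= !vcons0 !vconsS !vcons0 => h; apply: (cvgr_to_le h).
    apply: ooU; exists k.+1 => // j /= kj.
    have [_ /(_ i)] := hc _ _ (Ole k.+1 j kj).
    by rewrite ffunE.
  have := hv i; have := metric_triangle (b i) (e (v i)) (e q).
  rewrite (metric_sym (e (v i)) (e q)) /= /recent -/q.
  by move: (_.+1%:R^-1) hl h => z *; rewrite /= -/q; lra.
apply: cB'; rewrite type_val_tp.
have h := elim _ c (@recent _ n (addn (stage n k))).
apply: (cvgr_to_ge h); apply: ooU; exists k.+1 => // j /= kj.
by have [+ _] := hc _ _ (Ole k.+1 j kj).
Qed.

End OmittingTypes.

(** * Infinite separable models *)

Section Density.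
Context {R : realType} {L : language R}.

Lemma distinct_points (X : Type) k : ~ finite_set [set: X] ->
  exists a : 'I_k -> X, injective a.
Proof.
move=> Xoo; elim: k => [|k [a ainj]].
  by exists (fun i : 'I_0 => match notF (ltn_ord i) with end); case.
have [x xa] : exists x, ~ range a x.
  apply: contrapT => /forallNP h; apply: Xoo.
  rewrite (_ : setT = range a); first exact/finite_image/finite_finset.
  by apply/seteqP; split=> // x _; apply: contrapT; exact: h.
exists (vcons x a) => i j; case: (unliftP ord0 i) => [i' ->|->];
  case: (unliftP ord0 j) => [j' ->|->]; rewrite ?vconsS ?vcons0//.
- by move/ainj ->.
- by move=> h; case: xa; exists i'.
- by move=> h; case: xa; exists j'.
Qed.

Lemma finite_no_distinct (X : Type) : finite_set [set: X] ->
  exists k, forall a : 'I_k -> X, ~ injective a.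
Proof.
move=> /finite_setP [n /card_set_bijP [f [fn finj _]]].
exists n.+1 => a ainj.
pose g i := Ordinal (fn (a i) I).
have : injective g.
  by move=> i j /(congr1 val) /= h; apply/ainj/finj; rewrite ?inE.
by move=> /leq_card; rewrite !card_ord ltnn.
Qed.

(** To have [k] distinct elements is expressed by sentences, on which the models
  of a complete theory agree; and a model which is not compact has them for
  every [k]. *)
Lemma model_infinite (T : theory L) (M N : model T) : complete_theory T ->
  ~ compact [set: M] -> ~ finite_set [set: N].
Proof.
move=> Tc Mc /finite_no_distinct [k hk].
have [a ainj] : exists a : 'I_(k + 0) -> M, injective a.
  by apply: distinct_points => /finite_compact.
pose O := [set t : type_space T (k + 0) | forall ij : 'I_(k + 0) * 'I_(k + 0),
  ij.1 != ij.2 -> 0 < type_val t (FDist (Var ij.1) (Var ij.2))].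
have oO : open O.
  rewrite openE => t Ot; rewrite /interior.
  apply: (@filter_forall _ _ _ _ (nbhs_filter t)) => ij.
  have [->|ij12] := eqVneq ij.1 ij.2; first exact: nearW.
  have h : \forall u \near t, 0 < type_val u (FDist (Var ij.1) (Var ij.2)).
    exact: (cvgr_gt _ (@type_val_continuous _ _ T _ _ t) _ (Ot ij ij12)).
  by apply: filterS h.
have Oa : O (tp a).
  by move=> [i j] /= ij; rewrite mdist_gt0; apply: contra_neq ij => /ainj.
have [b0] : inhabited ('I_0 -> N).
  by have [x] := inhab N; constructor => _; exact: x.
have [c _ Oc] := @realize_open _ _ T k 0 (tp a) O N b0 oO Oa (complete_tp0 _ _ Tc).
apply: (hk (c \o @lshift k 0)) => i j /= cij; apply: contrapT => /eqP ij.
have /= := Oc (lshift 0 i, lshift 0 j); rewrite cij mdistxx ltxx.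
have h : lshift 0 i != lshift 0 j by apply: contra_neq ij => /lshift_inj.
by move/(_ h).

Qed.

Lemma dense_infinite (X : metricType R) (D : set X) : ~ finite_set [set: X] ->
  dense D -> ~ finite_set D.
Proof.
move=> Xoo Dd fD; apply: Xoo; rewrite (_ : setT = D)//.
apply/seteqP; split=> // x _; apply: contrapT => Dx.
have [|y [/= nDy Dy]] := Dd (~` D) (ex_intro _ x Dx); last exact: nDy.
exact/closed_openC/(compact_closed (@metric_hausdorff _ _))/finite_compact.
Qed.

Lemma dense_map_dense (X : metricType R) (d : nat -> X) : dense_map d -> dense (range d).
Proof.
move=> dd O [x Ox] oO.
have /nbhs_ballP [e /= e0 eO] := open_nbhs_nbhs (conj oO Ox).
have [k hk] := dd x e e0; exists (d k); split; last by exists k.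
by apply: eO; rewrite ballEmdist.
Qed.

Lemma density_dense_map (M : structure L) : density_aleph0 M ->
  exists d : nat -> M, dense_map d.
Proof.
move=> [[D [Dd]]]; have [x0] := inhab M.
rewrite card_eq_le => /andP[/countable_injP [f finj] _] _.
pose d k := if pselect (exists x, D x /\ f x = k) is left h
  then projT1 (cid h) else x0.
exists d => x e e0.
have [|y [/= xy Dy]] := Dd (ball x e)° _ (@open_interior _ _).
  by exists x; exact: nbhsx_ballx.
exists (f y); rewrite /d; case: pselect => [h|[]]; last by exists y.
case: cid => z /= [Dz fz]; rewrite (finj _ _ (mem_set Dz) (mem_set Dy) fz).
by have := interior_subset xy; rewrite ballEmdist.
Qed.

Lemma dense_map_density (M : structure L) (d : nat -> M) : ~ finite_set [set: M] ->
  dense_map d -> density_aleph0 M.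
Proof.
move=> Moo dd; split; last by move=> D; exact: dense_infinite.
exists (range d); split; first exact: dense_map_dense.
rewrite card_eq_le; apply/andP; split; last first.
  by apply/infiniteP; apply: dense_infinite Moo _; exact: dense_map_dense.
exact/(card_le_trans (card_image_le _ _))/card_lexx.
Qed.

End Density.

(** * Categorical theories *)

Lemma closed_section (A B : topologicalType) (C : set (A * B)) x :
  closed C -> closed [set y | C (x, y)].
Proof.
move=> cC; apply: (@closed_comp _ _ (fun y => (x, y)) C) => // y _.
exact: cvg_pair (cvg_cst x) cvg_id.
Qed.

Section Categorical.
Context {R : realType} {L : language R} {T : theory L}.
Hypothesis Lc : countable_language L.
Variable p : perturbation_system T.

Lemma pert_le (e e' : R) (M N : model T) (f : M -> N) : 0 <= e -> e <= e' ->
  bipert (psys p e) f -> bipert (psys p e') f.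
Proof.
move=> e0 ee'; have pS (M' N' : model T) (h : M' -> N') :
    pert (psys p e) h -> pert (psys p e') h.
  by move=> ph n a; have [_ -> ha] := ph n a; exists (tp a) => //; exact: psys_le ha.
by move=> [pf [g fg pg]]; split; [exact: pS|exists g => //; exact: pS].
Qed.

(** Otherwise some separable model nearly omits the types at distance at most
  [e] from [s], while a perturbation of a separable model that realizes [s]
  brings a realization of such a type into every separable model. *)
Lemma categorical_ball_interior n (s : type_space T n) (e : R) :
  (forall M : model T, ~ finite_set [set: M]) -> pert_aleph0_categorical p ->
  0 < e -> [set t | bis p e n 0 (s, t)]° !=set0.
Proof.
move=> Moo [_ cat] e0; apply: contrapT => /set0P/negP/negPn/eqP B0.
have [M [a [as_ [dM dMd]]]] := separable_realization Lc p s.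
have cB : closed [set t | bis p e n 0 (s, t)].
  exact: (@closed_section (type_space T (0 + n)) _ _ s (@bis_closed _ _ _ p e n 0 (ltW e0))).
have [N [[dN dNd] omit]] := omitting_types Lc (inhabits M) cB B0.
have e20 : 0 < e / 2 by rewrite divr_gt0.
have [d d0 hd] := psys_val p dist01 e20.
have m0 : 0 < Num.min d e / 2 by rewrite divr_gt0 // lt_min d0.
have [md me] : Num.min d e / 2 < d /\ Num.min d e / 2 <= e.
  have : Num.min d e <= d by rewrite ge_min lexx.
  have : Num.min d e <= e by rewrite ge_min lexx orbT.
  by move: m0; split; lra.
have [f bf] := cat M N (dense_map_density (Moo M) dMd) (dense_map_density (Moo N) dNd) _ m0.
have [c [ac nc]] := omit (f \o a) _ e20; apply: nc; rewrite /= -as_.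
apply: (carries_bis (f := f) (ltW e0)); split=> [|i x].
  exact: pert_le (ltW m0) me bf.
have [_ -> /psys_le xai] := bf.1 2 (vcons x (vcons (a i) (fun _ : 'I_0 => x))).
have := hd _ _ (xai _ (ltW m0) (ltW md)).
rewrite !type_val_tp /= !vcons0 !vconsS !vcons0.
have := mdist_dist (f x) (f (a i)) (f x) (c i); rewrite mdistxx add0r.
have := ac i; rewrite /= !ltr_norml !ler_norml.
by move=> ? /andP[? ?] /andP[? ?]; apply/andP; split; lra.
Qed.

(** The closed ball around [s] has an interior point; the set [V] of its
  interior points is open and at a small distance from [s], so by weak openness
  the types close to [V] form a logic neighbourhood of [s]. *)
Lemma categorical_open n (U : set (type_space T n)) :
  (forall M : model T, ~ finite_set [set: M]) -> weakly_open p ->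
  pert_aleph0_categorical p -> dtilde_open p U -> open U.
Proof.
move=> Moo wo cat dU; rewrite openE => s /dU [r r0 rU].
have r20 : 0 < r / 2 by rewrite divr_gt0.
have [d d0 hd] := wo (r / 2) n r20.
pose e := Num.min (r / 2) d / 2.
have e0 : 0 < e by rewrite divr_gt0// lt_min r20.
have [er ed] : e < r / 2 /\ e < d.
  have : Num.min (r / 2) d <= r / 2 by rewrite ge_min lexx.
  have : Num.min (r / 2) d <= d by rewrite ge_min lexx orbT.
  by move: e0; rewrite /e; split; lra.
have [t Vt] := categorical_ball_interior s Moo cat e0.
set V := _° in Vt.
have VU : dtilde_nbhd p V (r / 2) `<=` U.
  move=> u /ereal_inf_lt [_ [v Vv <-]] /(dtilde_ltP Lc) [g [g0 gr uv]].
  apply: rU; apply/(dtilde_ltP Lc); exists (e + g); split; first exact: addr_ge0 (ltW e0) g0.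
    by lra.
  exact: (bis_trans (ltW e0) g0 (interior_subset Vv) (bis_sym g0 uv)).
have : (dtilde_nbhd p V (r / 2))° s; last exact: filterS.
apply: (hd V (@open_interior _ _)).
  apply: (@le_lt_trans _ _ (dtilde p s t)); first by apply: ereal_inf_lbound; exists t.
  by apply/(dtilde_ltP Lc); exists e; split=> //; [exact: ltW|exact: interior_subset Vt].
Qed.

End Categorical.

(** * Back and forth between separable models *)

Section Approximations.
Context {R : realType} {X : metricType R}.

Lemma recent_near m (alpha : nat -> X) c (a : 'I_m.+1 -> X) (r : R) :
  (forall q, mdist (a q) (vcons c (recent alpha) q) < r) ->
  exists beta, [/\ recent beta = a, forall i, (i < m)%N -> mdist (beta i) (alpha i) < r &
    mdist (beta m) c < r].
Proof.
move=> ac; exists (seq_of a c); have ra := recent_seq_of a c.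
split=> // [i im|].
  rewrite -(recent_place _ (ltnW im)) ra.
  apply: le_lt_trans (ac (place m i)).
  pose gamma j := if j == m then c else alpha j.
  have -> : vcons c (@recent _ m alpha) = recent gamma.
    rewrite recentS /gamma eqxx; congr vcons; apply/funext => j.
    by rewrite /recent ltn_eqF// ltn_subrL (leq_ltn_trans _ (ltn_ord j)).
  by rewrite (recent_place _ (ltnW im)) /gamma ltn_eqF.
rewrite -(recent_place _ (leqnn m)) ra.
rewrite (_ : place m m = ord0) ?(le_lt_trans _ (ac ord0)) ?vcons0//.
by apply/val_inj; rewrite /= inordK ?subnn.
Qed.

End Approximations.

Section Limits.
Context {R : realType} {L : language R}.

Lemma drift_limit (M : structure L) (u : nat -> M) (d : nat -> R) (K : nat) :
  (forall k, (K <= k)%N -> mdist (u k) (u k.+1) <= d k - d k.+1) ->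
  (forall k, 0 <= d k) -> d @ \oo --> 0 ->
  exists l, forall k, (K <= k)%N -> mdist (u k) l <= d k.
Proof.
move=> ud d0 dl.
have far i k : (K <= k)%N -> mdist (u k) (u (i + k)%N) <= d k - d (i + k)%N.
  move=> Kk; elim: i => [|i IH]; first by rewrite mdistxx subrr.
  apply: le_trans (metric_triangle _ (u (i + k)%N) _) _.
  have := ud (i + k)%N (leq_trans Kk (leq_addl _ _)); rewrite addSn; lra.
have farj k j : (K <= k)%N -> (k <= j)%N -> mdist (u k) (u j) <= d k.
  move=> Kk /subnK <-; apply: le_trans (far _ _ Kk) _.
  by have := d0 (j - k + k)%N; lra.
have [l ul] : exists l : M, u @ \oo --> l.
  apply: carrier_complete; apply/cauchyP => e e0.
  have [k Kk dk] : exists2 k, (K <= k)%N & d k < e.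
    have : \forall k \near \oo, (K <= k)%N /\ d k < e.
      by apply: filterI; [exact: nbhs_infty_ge|exact: (cvgr_lt _ dl)].
    by move=> /filter_ex [k [? ?]]; exists k.
  exists (u k); exists k => // j /= kj; rewrite ballEmdist /=.
  exact: le_lt_trans (farj _ _ Kk kj) dk.
exists l => k Kk; apply/ler_addgt0Pr => e e0.
have /metricType_numDomainType.cvgrPdist_lt /(_ _ e0) h := ul.
have /filter_ex [j [kj jl]] : \forall j \near \oo, (k <= j)%N /\ mdist l (u j) < e.
  by apply: filterI; [exact: nbhs_infty_ge|exact: h].
apply: le_trans (metric_triangle _ (u j) _) _.
by rewrite (metric_sym (u j)) lerD ?farj// ltW.
Qed.

End Limits.

Section Metrized.
Context {R : realType} {L : language R} {T : theory L}.
Hypothesis Lc : countable_language L.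
Variable p : perturbation_system T.

(** A radius consists of types of tuples and their images under perturbations,
  which extend by one element over the realizations; compactness makes the
  extension exact. *)
Lemma psys_forth (e : R) n x y (x' : type_space T n.+1) : 0 <= e ->
  psys p e n (x, y) -> res x' = x ->
  exists2 y' : type_space T n.+1, res y' = y & psys p e n.+1 (x', y').
Proof.
move=> e0 xy x'x; pose F : pair_rel n := fun k => psys p e (k + n).
have aF : approx_forth F.
  move=> k t u t' O /(psys_radius p e0).2 [M [N [f [a [pf <- <-]]]]] t't oO Ot'.
  have [c Oc] := res_realize oO (ex_intro2 _ _ t' Ot' t't).
  exists (tp (scons c a)), (tp (f \o scons c a)); split=> //; rewrite ?res_scons//.
    by rewrite sconsE comp_vcons res_tp vcons_lift.
  by have [_ ->] := pf _ (scons c a).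
have FE : closure_rel F = F.
  apply/functional_extensionality_dep => k; rewrite /closure_rel -(closure_id _).1//.
  exact: psys_closed.
have := forth_closure aF; rewrite FE => /(_ 0%N x y x' xy x'x).
by [].
Qed.

(** [z] is the type of the image of a realization of [x] under a perturbation
  [f] that moves it to within [e] of a realization [w] of [t]. The type of this
  image together with [w] has an open neighbourhood on which the two tuples are
  at distance less than [r] and the first has its type in [O]; [V] is its
  projection. *)
Lemma bis_transfer (e : R) m (x t : type_space T (1 + m)) : 0 <= e ->
  bis p e m 1 (x, t) ->
  exists2 z, psys p e (1 + m) (x, z) &
    forall (O : set (type_space T (1 + m))) (r : R), open O -> O z -> e < r ->
    exists V, [/\ open V, V t & forall (M : model T) a, V (tp a) ->
      exists2 c : 'I_(1 + m) -> M, O (tp c) & forall q, mdist (c q) (a q) < r].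
Proof.
move=> e0 /(bis_carries Lc e0) [M [N [f [u [w [[bf fuw] fl <- <- _]]]]]].
have fu q : mdist (f (u q)) (w q) <= e.
  rewrite -[q]splitK; case: (fintype.split q) => i /=.
    by rewrite -[w _]/((w \o @lshift 1 m) i) fl /= mdistxx.
  have := fuw i (u (rshift 1 i)); rewrite mdistxx sub0r normrN.
  by rewrite ger0_norm ?mdist_ge0.
exists (tp (f \o u)); first by have [_ ->] := bf.1 _ u.
move=> O r oO Oz er.
pose D q : formula L ((1 + m) + (1 + m)) :=
  FDist (Var (@lshift (1 + m) (1 + m) q)) (Var (@rshift (1 + m) (1 + m) q)).
pose J := [set t : type_space T ((1 + m) + (1 + m)) |
  O (tpr (@lshift (1 + m) (1 + m)) t) /\ forall q, type_val t (D q) < r].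
have oJ : open J.
  apply: (@openI _ (tpr (@lshift (1 + m) (1 + m)) @^-1` O)).
    by apply: open_comp => // t' _; exact: tpr_continuous.
  exact: open_type_val_lt.
exists (tpr (@rshift (1 + m) (1 + m)) @` J); split; first exact: tpr_rshift_open.
  (* The image of [u], followed by [w]. *)
  pose j q := match fintype.split q with inl i => f (u i) | inr i => w i end.
  exists (tp (j : 'I_((1 + m) + (1 + m)) -> N)).
    split; rewrite ?tpr_tp.
      rewrite (_ : _ \o _ = f \o u)//; apply/funext => i.
      by rewrite /j /= (unsplitK (inl i)).
    move=> q; rewrite type_val_tp /= /j (unsplitK (inl q)) (unsplitK (inr q)).
    exact: le_lt_trans (fu q) er.
  by rewrite tpr_tp; congr tp; apply/funext => i; rewrite /j /= (unsplitK (inr i)).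
move=> P a [t' Jt' t'a]; have [c ca [Oc Dc]] := realize_open oJ Jt' t'a.
exists (c \o @lshift (1 + m) (1 + m)); first by rewrite tpr_tp in Oc.
by move=> q; have := Dc q; rewrite type_val_tp /= -ca.
Qed.

Hypothesis metrized : forall n (U : set (type_space T n)), dtilde_open p U -> open U.

Lemma metrized_ball n (s : type_space T n) (r : R) : 0 < r ->
  exists O, [/\ open O, O s & forall t, O t -> bis p r n 0 (s, t)].
Proof.
move=> r0; exists [set t | exists e, [/\ 0 <= e, e < r & bis p e n 0 (s, t)]].
split.
- apply: metrized => t [e [e0 er st]]; exists (r - e); first by rewrite subr_gt0.
  move=> u /= /(dtilde_ltP Lc) [e' [e'0 e'r tu]]; exists (e + e').
  by split; [exact: addr_ge0|lra|exact: bis_trans st tu].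
- by exists 0; split=> //; exact: bis_refl.
- by move=> t [e [e0 er st]]; exact: bis_le (ltW er) _ st.
Qed.

(** The types of [a] and [b] themselves are not assumed to be related by a
  perturbation of size [e], only to be close to such types: a perturbation
  cannot be extended exactly inside given models. *)
Definition paired (e h : R) m (M N : model T) (a : 'I_m -> M) (b : 'I_m -> N)
    (x y : type_space T m) :=
  [/\ psys p e m (x, y), bis p h m 0 (x, tp a) & bis p h m 0 (y, tp b)].

(** The element [c] extends the type of [a], hence [x] because [x] is close to
  it, hence [y] by the radius, hence approximately the type of [b]. Moving both
  extended types by perturbations of size [h] makes them [h']-close to the
  types of tuples of [M] and [N], at distance less than [2 * h] from the given
  ones. *)
Lemma paired_step (e h h' : R) m (M N : model T) (a : 'I_m -> M) (b : 'I_m -> N) x y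
    (c : M) : 0 <= e -> 0 < h -> 0 < h' -> paired e h a b x y ->
  exists (a' : 'I_m.+1 -> M) (b' : 'I_m.+1 -> N) x' y' (d : N),
    [/\ paired (e + 2 * h) h' a' b' x' y',
      forall q, mdist (a' q) (vcons c a q) < 2 * h &
      forall q, mdist (b' q) (vcons d b q) < 2 * h].
Proof.
move=> e0 h0 h'0 [xy xa yb]; have h2 : h < 2 * h by lra.
have [forth_p back_p] := bis_bisim p h m.
have [x1 x1x x1a] := back_p 0%N _ _ (tp (scons c a)) xa (res_scons c a).
have [y1 y1y x1y1] := psys_forth e0 xy x1x.
have [t ty y1t] := forth_p 0%N _ _ y1 yb y1y.
have [x2 x12 toM] := bis_transfer (ltW h0) x1a.
have [y2 y12 toN] := bis_transfer (ltW h0) y1t.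
have [Ox [oOx Oxx Ox']] := metrized_ball x2 h'0.
have [Oy [oOy Oyy Oy']] := metrized_ball y2 h'0.
have [V [_ Va Vc]] := toM Ox _ oOx Oxx h2.
have [W [oW Wt Wc]] := toN Oy _ oOy Oyy h2.
have [a' Oa' aa'] := Vc _ _ Va.
have [d Wd] := res_realize oW (ex_intro2 _ _ t Wt ty).
have [b' Ob' bb'] := Wc _ _ Wd.
exists a', b', x2, y2, d; split=> //; split; [|exact: Ox'|exact: Oy'].
have h0' := ltW h0.
rewrite (_ : e + 2 * h = h + (e + h)); last by lra.
apply: (@psys_comp _ _ _ p); [by []|exact: addr_ge0|].
exists y1; split=> //=; apply: (@psys_comp _ _ _ p) => //.
by exists x1; split=> //=; exact: psys_sym.
Qed.

Lemma paired_sym (e h : R) m (M N : model T) (a : 'I_m -> M) (b : 'I_m -> N) x y :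
  0 <= e -> paired e h a b x y -> paired e h b a y x.
Proof. by move=> e0 [xy xa yb]; split=> //; exact: psys_sym. Qed.

(** [x k] is close to the type of the first terms of the [k]-th sequence, and
  these terms converge. *)
Lemma drift_type_cvg (M : model T) (alpha : nat -> nat -> M) (l : nat -> M)
    (x : forall k, type_space T k) (d : nat -> R) :
  (forall k, 0 <= d k) -> d @ \oo --> 0 ->
  (forall k, bis p (d k) k 0 (x k, tp (recent (alpha k)))) ->
  (forall k i, (i < k)%N -> mdist (alpha k i) (l i) <= d k) ->
  forall m (v : 'I_m -> nat), tpr (place k \o v) (x k.+1) @[k --> \oo] --> tp (l \o v).
Proof.
move=> d0 dl xa al m v; apply/type_cvgP => s; apply/cvgrPdist_le => r r0.
have r20 : 0 < r / 2 by rewrite divr_gt0.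
have [e e0 he] := bis_val Lc p s r20; have [c c0 hc] := feval_uc s r20.
have dS : d k.+1 @[k --> \oo] --> 0 by rewrite (cvg_shiftS d).
have m0 : 0 < Num.min e c by rewrite lt_min e0.
have near_dS : \forall k \near \oo, d k.+1 < Num.min e c by exact: (cvgr_lt _ dS).
suff : \forall k \near \oo,
  `|type_val (tp (l \o v)) s - type_val (tpr (place k \o v) (x k.+1)) s| <= r by [].
near=> k.
have vk i : (v i <= k)%N.
  apply: (@leq_trans (\max_i v i)); first exact: (leq_bigmax (F := v) i).
  by near: k; exact: nbhs_infty_ge.
have : d k.+1 < Num.min e c by near: k.
rewrite lt_min => /andP[de dc].
have := bis_tpr Lc (place k \o v) (d0 k.+1) (xa k.+1).
rewrite tpr_tp recent_comp_place// => /(he _ _ _ (d0 k.+1) de) h1.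
have h2 : forall i, mdist ((alpha k.+1 \o v) i) ((l \o v) i) < c.
  by move=> i; apply: le_lt_trans dc; apply: al; rewrite ltnS.
have := hc M _ _ h2; rewrite -!type_val_tp => {}h2.
rewrite distrC (splitr r); apply: le_trans (lerD h1 h2).
exact: ler_distD.
Unshelve. all: by end_near.
Qed.

(** The size of the radius at stage [k] is [eps - d k], where [d k] is [eps]
  divided by the [k]-th power of 2, and the closeness is [d k / 4]. A step adds
  twice the closeness to the size, that is [d k - d k.+1], and moves the
  elements by less than that amount; so the size stays below [eps] and the
  total move from stage [k] on is at most [d k]. The even steps bring in the
  terms of [dM], the odd ones those of [dN], each infinitely often, hence with
  arbitrarily small final error. *)
Lemma metrized_isomorphic (M N : model T) (dM : nat -> M) (dN : nat -> N) :
  complete_theory T -> dense_map dM -> dense_map dN -> pert_isomorphic p M N.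
Proof.
move=> Tc dMd dNd eps eps0.
pose d k : R := eps * 2^-1 ^+ k.
have d0 k : 0 < d k by rewrite mulr_gt0// exprn_gt0// invr_gt0.
have dS k : d k.+1 = d k / 2 by rewrite /d exprSr mulrA.
have d_eps k : d k <= eps.
  elim: k => [|k IH]; first by rewrite /d expr0 mulr1.
  by rewrite dS; have := d0 k; lra.
have dl : d @ \oo --> 0.
  rewrite -(mulr0 eps); apply: cvgM; first exact: cvg_cst.
  by apply: cvg_expr; rewrite ger0_norm; lra.
pose X k := ((nat -> M) * (nat -> N) * (type_space T k * type_space T k))%type.
pose F k (z : X k) := paired (eps - d k) (d k / 4) (@recent _ k z.1.1)
  (@recent _ k z.1.2) z.2.1 z.2.2.
pose S k (z : X k) (z' : X k.+1) :=
  [/\ forall i, (i < k)%N -> mdist (z.1.1 i) (z'.1.1 i) <= d k - d k.+1,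
      forall i, (i < k)%N -> mdist (z.1.2 i) (z'.1.2 i) <= d k - d k.+1 &
      if odd k then mdist (dN (logn 2 k./2)) (z'.1.2 k) <= d k - d k.+1
      else mdist (dM (logn 2 k./2)) (z'.1.1 k) <= d k - d k.+1].
have [xM] := inhab M; have [xN] := inhab N.
pose t0 := tp (@recent _ 0 (fun=> xM)).
pose z0 : X 0%N := (fun=> xM, fun=> xN, (t0, t0)).
have F0 : F 0%N z0.
  have h0 : 0 <= d 0%N / 4 by have := d0 0%N; lra.
  split.
  - by apply: psys_diag; rewrite subr_ge0.
  - exact: bis_refl.
  - by rewrite (complete_tp0 (tp (recent z0.1.2)) z0.2.2 Tc); exact: bis_refl.
have step k (z : X k) : F k z -> exists2 z' : X k.+1, F k.+1 z' & S k z z'.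
  move=> Fz.
  have e0 : 0 <= eps - d k by rewrite subr_ge0.
  have h0 : 0 < d k / 4 by rewrite divr_gt0.
  have h'0 : 0 < d k.+1 / 4 by rewrite divr_gt0.
  have eE : eps - d k + 2 * (d k / 4) = eps - d k.+1 by rewrite dS; lra.
  have hE : 2 * (d k / 4) = d k - d k.+1 by rewrite dS; lra.
  have e0' : 0 <= eps - d k.+1 by rewrite subr_ge0.
  rewrite /F /S; case ok: (odd k).
    have [b' [a' [y' [x' [c [P bb' aa']]]]]] :=
      paired_step (dN (logn 2 k./2)) e0 h0 h'0 (paired_sym e0 Fz).
    rewrite eE hE in P bb' aa'.
    have [beta [bE bn bl]] := recent_near bb'; have [alpha [aE an al]] := recent_near aa'.
    exists (alpha, beta, (x', y')); first by rewrite /= aE bE; exact: paired_sym.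
    by split=> [i ik|i ik|]; rewrite metric_sym ltW// ?an ?bn.
  have [a' [b' [x' [y' [c [P aa' bb']]]]]] := paired_step (dM (logn 2 k./2)) e0 h0 h'0 Fz.
  rewrite eE hE in P bb' aa'.
  have [beta [bE bn bl]] := recent_near bb'; have [alpha [aE an al]] := recent_near aa'.
  exists (alpha, beta, (x', y')); first by rewrite /= aE bE.
  by split=> [i ik|i ik|]; rewrite metric_sym ltW// ?an ?bn.
have [z [_ zP]] := dependent_chain F0 step.
have d0' k : 0 <= d k by exact: ltW.
have /choice [l1 l1P] : forall i, exists l : M, forall k, (i < k)%N ->
    mdist ((z k).1.1 i) l <= d k.
  move=> i; apply: (drift_limit (u := fun k => (z k).1.1 i)) => // k ik.
  by have [_ [+ _ _]] := zP k; apply.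
have /choice [l2 l2P] : forall i, exists l : N, forall k, (i < k)%N ->
    mdist ((z k).1.2 i) l <= d k.
  move=> i; apply: (drift_limit (u := fun k => (z k).1.2 i)) => // k ik.
  by have [_ [_ + _]] := zP k; apply.
have late b i (r : R) : 0 < r -> exists k, [/\ odd k = b, logn 2 k./2 = i & d k < r].
  move=> r0; have [K _ hK] : \forall k \near \oo, d k < r by exact: (cvgr_lt _ dl).
  have [k Kk kE] := frequent_index i K; exists (b + k.*2)%N.
  rewrite oddD odd_double addbF half_bit_double; split=> //; first by case: b.
  by apply: hK => /=; rewrite (leq_trans Kk)// (leq_trans _ (leq_addl _ _))// -addnn leq_addr.
have l1d : dense_map l1.
  move=> x r r0; have r20 : 0 < r / 2 by rewrite divr_gt0.
  have [i hi] := dMd x _ r20; have [k [ok ki dk]] := late false i _ r20.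
  exists k; have [_ [_ _]] := zP k; rewrite ok ki => h.
  apply: le_lt_trans (metric_triangle _ (dM i) _) _.
  have := metric_triangle (dM i) ((z k.+1).1.1 k) (l1 k).
  by have := l1P k k.+1 (leqnn _); lra.
have l2d : dense_map l2.
  move=> x r r0; have r20 : 0 < r / 2 by rewrite divr_gt0.
  have [i hi] := dNd x _ r20; have [k [ok ki dk]] := late true i _ r20.
  exists k; have [_ [_ _]] := zP k; rewrite ok ki => h.
  apply: le_lt_trans (metric_triangle _ (dN i) _) _.
  have := metric_triangle (dN i) ((z k.+1).1.2 k) (l2 k).
  by have := l2P k k.+1 (leqnn _); lra.
have h4 k : 0 <= d k / 4 /\ d k / 4 <= d k by have := d0 k; lra.
have l12 m (v : 'I_m -> nat) : psys p eps m (tp (l1 \o v), tp (l2 \o v)).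
  apply: (closed_cvg (psys p eps m) (@psys_closed _ _ _ p _ m (ltW eps0)) _ _
    (u_ := fun k => (tpr (place k \o v) (z k.+1).2.1, tpr (place k \o v) (z k.+1).2.2))
    (F := \oo)).
    apply: nearW => k; apply: (radius_tpr (psys_radius p (ltW eps0))).
    have [[zk _ _] _] := zP k.+1.
    have e0 : 0 <= eps - d k.+1 by rewrite subr_ge0.
    by apply: psys_le zk => //; rewrite gerBl.
  have x_near k : bis p (d k) k 0 ((z k).2.1, tp (@recent _ k (z k).1.1)).
    by have [[_ xa _] _] := zP k; have [h ?] := h4 k; exact: bis_le xa.
  have y_near k : bis p (d k) k 0 ((z k).2.2, tp (@recent _ k (z k).1.2)).
    by have [[_ _ yb] _] := zP k; have [h ?] := h4 k; exact: bis_le yb.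
  have c1 := drift_type_cvg (v := v) d0' dl x_near (fun k i => l1P i k).
  have c2 := drift_type_cvg (v := v) d0' dl y_near (fun k i => l2P i k).
  exact: cvg_pair c1 c2.
have [f bf _] :=
  dense_bipert (psys_radius p (ltW eps0)) (psys_sym (ltW eps0)) l1d l2d l12.
by exists f.
Qed.

End Metrized.

Theorem theorem3p15 (R : realType) (L : language R) (T : theory L)
    (p : perturbation_system T) :
  countable_language L ->
  complete_theory T ->
  (exists M : model T, ~ compact [set: M]) ->
  weakly_open p ->
  (pert_aleph0_categorical p <->
   forall (n : nat) (U : set (type_space T n)), open U <-> dtilde_open p U).
Proof.
move=> Lc Tc [M0 M0c] wo.
have Moo (M : model T) : ~ finite_set [set: M] := model_infinite Tc M0c.
split=> [cat n U|metr].
  by split; [exact: dtilde_open_of_open|exact: categorical_open].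
split.
  have [x0] := inhab M0.
  have [M [_ [_ [d dd]]]] := separable_realization Lc p (tp (fun _ : 'I_0 => x0)).
  by exists M; exact: dense_map_density dd.
move=> M N /density_dense_map [dM dMd] /density_dense_map [dN dNd].
by apply: metrized_isomorphic dMd dNd => // n U; rewrite metr.
Qed.
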